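(* Let $n\ge 0$ be an integer. For all $1<p<\infty$, the Cauchy–Szegő projection $C_{\mathcal{U}^n}$ satisfies $$\|C_{\mathcal{U}^n}\|_{L^p(b\mathcal{U}^n)\to H^p(\mathcal{U}^n)}\;\ge\;\frac{\Gamma\left(\frac{n+1}{p}\right)\Gamma\left(\frac{n+1}{q}\right)}{\Gamma^2\left(\frac{n+1}{2}\right)},$$ where $q:=\frac{p}{p-1}$ is the conjugate exponent of $p$.
   Context: Write points of $\mathbb{C}^{n+1}$ as $z=(z',z_{n+1})$ with $z'=(z_1,\dots,z_n)\in\mathbb{C}^n$, $z_{n+1}\in\mathbb{C}$, and $z'\cdot\overline{w'}=\sum_{j=1}^n z_j\overline{w_j}$. The Siegel upper half-space is $\mathcal{U}^n=\{z\in\mathbb{C}^{n+1}:\operatorname{Im}z_{n+1}>|z'|^2\}$ (so $\mathcal{U}^0$ is the upper half-plane), with boundary $b\mathcal{U}^n=\{z:\operatorname{Im}z_{n+1}=|z'|^2\}$. The measure $d\boldsymbol{\beta}$ on $b\mathcal{U}^n$ is defined by $$\int_{b\mathcal{U}^n}f\,d\boldsymbol{\beta}=\int_{\mathbb{C}^n\times\mathbb{R}}f(z',t+i|z'|^2)\,dz'\,dt$$ (Lebesgue measure on $\mathbb{C}^n\times\mathbb{R}$), and $L^p(b\mathcal{U}^n)$ is taken with respect to $d\boldsymbol{\beta}$. With $\mathbf{i}=(0',i)\in\mathbb{C}^{n+1}$, the Hardy space $H^p(\mathcal{U}^n)$ consists of the holomorphic $f$ on $\mathcal{U}^n$ with $$\|f\|_{H^p}:=\sup_{t>0}\left\{\int_{b\mathcal{U}^n}|f(u+t\mathbf{i})|^p\,d\boldsymbol{\beta}(u)\right\}^{1/p}<\infty.$$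 Put $\boldsymbol{\rho}(z,w):=\frac{i}{2}(\overline{w}_{n+1}-z_{n+1})-z'\cdot\overline{w'}$. The Cauchy–Szegő projection (the orthogonal projection of $L^2(b\mathcal{U}^n)$ onto $H^2(\mathcal{U}^n)$, the latter identified with its space of boundary values) is given by $$(C_{\mathcal{U}^n}f)(z)=\frac{n!}{4\pi^{n+1}}\int_{b\mathcal{U}^n}\boldsymbol{\rho}(z,u)^{-n-1}f(u)\,d\boldsymbol{\beta}(u),\qquad z\in\mathcal{U}^n,$$ and it extends to a bounded operator from $L^p(b\mathcal{U}^n)$ onto $H^p(\mathcal{U}^n)$ for $1<p<\infty$. The norm in the claim is the operator norm $\sup\{\|C_{\mathcal{U}^n}f\|_{H^p}/\|f\|_{L^p(b\mathcal{U}^n)}: f\in L^p(b\mathcal{U}^n),\ f\ne0\}$. *)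

(* Defs.v *)
From HB Require Import structures.
From mathcomp Require Import all_boot all_order all_algebra.
From mathcomp Require Import complex.
From mathcomp Require Import all_classical all_reals all_analysis.
From mathcomp Require Import measurable_realfun.

Set Implicit Arguments.
Unset Strict Implicit.
Unset Printing Implicit Defensive.

Import Order.TTheory GRing.Theory Num.Theory.
Import numFieldNormedType.Exports.
Import ComplexField.Normc.

Local Open Scope classical_set_scope.
Local Open Scope ring_scope.
Local Open Scope complex_scope.

Definition Gamma {R : realType} (x : R) : R :=
  \int[lebesgue_measure]_(t in `]0, +oo[) (t `^ (x - 1) * expR (- t)).

Section complex_measurable.
Context {R : realType}.

Definition complex_pair (z : R[i]) : R * R := (complex.Re z, complex.Im z).
Definition pair_complex (x : R * R) : R[i] := x.1 +i* x.2.

Lemma complex_pairK : cancel complex_pair pair_complex.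
Proof. by case. Qed.

Lemma pair_complexK : cancel pair_complex complex_pair.
Proof. by case. Qed.

(* The Borel sets of the plane R * R, transported to R[i]. *)
Definition measurable_complex : set (set R[i]) :=
  preimage_set_system setT complex_pair measurable.

Let measurable_complex0 : measurable_complex set0.
Proof. by exists set0 => //; rewrite preimage_set0 setI0. Qed.

Let measurable_complexC A : measurable_complex A -> measurable_complex (~` A).
Proof.
move=> [B mB <-]; exists (~` B); first exact: measurableC.
by rewrite !setTI preimage_setC.
Qed.

Let measurable_complex_bigcup (F : (set R[i])^nat) :
  (forall k, measurable_complex (F k)) -> measurable_complex (\bigcup_k F k).
Proof.
move=> mF; pose G k := sval (cid2 (mF k)).
exists (\bigcup_k G k).
  by apply: bigcup_measurable => k _; rewrite /G; case: cid2.
rewrite setTI preimage_bigcup; apply: eq_bigcupr => k _.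
by rewrite /G; case: cid2 => B mB /= <-; rewrite setTI.
Qed.

HB.instance Definition _ := isPointed.Build R[i] 0.
HB.instance Definition _ := @isMeasurable.Build default_measure_display R[i]
  measurable_complex measurable_complex0 measurable_complexC
  measurable_complex_bigcup.

Lemma measurable_complex_pair : measurable_fun [set: R[i]] complex_pair.
Proof. by move=> _ B mB; exists B. Qed.

Lemma measurable_pair_complex : measurable_fun [set: R * R] pair_complex.
Proof.
move=> _ _ [B mB <-]; rewrite !setTI -comp_preimage.
by rewrite (_ : _ \o _ = id) ?preimage_id //; apply/funext; exact: pair_complexK.
Qed.

Lemma measurable_Re : measurable_fun [set: R[i]] (@complex.Re R).
Proof.
by apply: (measurableT_comp measurable_fst measurable_complex_pair).
Qed.

Lemma measurable_Im : measurable_fun [set: R[i]] (@complex.Im R).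
Proof.
by apply: (measurableT_comp measurable_snd measurable_complex_pair).
Qed.

Lemma sqr_normc_ReIm (z : R[i]) :
  normc z ^+ 2 = complex.Re z ^+ 2 + complex.Im z ^+ 2.
Proof. by case: z => a b; rewrite /= sqr_sqrtr// addr_ge0 ?sqr_ge0. Qed.

Lemma measurable_sqr_normc :
  measurable_fun [set: R[i]] (fun z => normc z ^+ 2 : R).
Proof.
under eq_fun do rewrite sqr_normc_ReIm.
apply: measurable_funD; apply: measurable_funX.
  exact: measurable_Re.
exact: measurable_Im.
Qed.

End complex_measurable.

Section transport_measure.
Context d d' (T : measurableType d) (T' : measurableType d') (R : realType).
Variables (m : {sigma_finite_measure set T -> \bar R}).
Variables (f : T -> T') (g : T' -> T).
Hypotheses (mf : measurable_fun [set: T] f) (mg : measurable_fun [set: T'] g).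
Hypothesis fgK : cancel f g.

Let pushforward_sigma_finite : sigma_finite setT (pushforward m f).
Proof.
have [F FT mF] := sigma_finiteT m.
exists (fun k => g @^-1` F k); first by rewrite -preimage_bigcup -FT.
move=> k; have [mFk Fkoo] := mF k; split.
  by rewrite -[X in measurable X]setTI; exact: mg.
rewrite /pushforward -comp_preimage (_ : g \o f = id) ?preimage_id//.
exact/funext.
Qed.

Let m_measure : {measure set T' -> \bar R} :=
  @measure_function_pushforward__canonical__measure_function_Measure
    _ _ _ _ _ m f mf.

Definition transport : {sigma_finite_measure set T' -> \bar R} :=
  HB.pack (Measure.sort m_measure)
    (@Measure_isSigmaFinite.Build _ _ _ m_measure pushforward_sigma_finite).

Lemma transportE A : transport A = m (f @^-1` A).
Proof. by []. Qed.

Lemma ge0_integral_transport (h : T' -> \bar R) :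
  measurable_fun [set: T'] h -> (forall y, 0 <= h y)%E ->
  (\int[transport]_y h y = \int[m]_x h (f x))%E.
Proof. by move=> mh h0; exact: (ge0_integral_pushforward mf m). Qed.

End transport_measure.

Section product_sigma_finite.
Context d d' (T : measurableType d) (T' : measurableType d') (R : realType).
Variables (m : {sigma_finite_measure set T -> \bar R}).
Variables (m' : {sigma_finite_measure set T' -> \bar R}).

Let product_sigma_finite : sigma_finite setT (m \x m')%E.
Proof.
have /sigma_finiteP[F [TF ndF Foo]] := sigma_finiteT m.
have /sigma_finiteP[G [TG ndG Goo]] := sigma_finiteT m'.
exists (fun k => F k `*` G k).
  rewrite -setXTT TF TG predeqE => -[x y]; split.
    move=> [/= [k _ Fkx] [l _ Gly]]; exists (maxn k l) => //; split.
    - by move: x Fkx; exact/subsetPset/ndF/leq_maxl.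
    - by move: y Gly; exact/subsetPset/ndG/leq_maxr.
  by move=> [k _ []/= ? ?]; split; exists k.
move=> k; have [? ?] := Foo k; have [? ?] := Goo k.
split; first exact: measurableX.
by rewrite product_measure1E// lte_mul_pinfty// ge0_fin_numE.
Qed.

(* the measure m \x m' bundled with its sigma-finiteness, which is not inferred
   for the bare expression *)
Definition product_measure : {sigma_finite_measure set (T * T')%type -> \bar R} :=
  HB.pack (Measure.sort ((m \x m')%E : {measure set (T * T')%type -> \bar R}))
    (@Measure_isSigmaFinite.Build _ _ _
      ((m \x m')%E : {measure set (T * T')%type -> \bar R})
      product_sigma_finite).

End product_sigma_finite.

Section lebesgue_complex.
Variable R : realType.

Definition lebesgueC : {sigma_finite_measure set R[i] -> \bar R} :=
  transport (product_measure (@lebesgue_measure R) (@lebesgue_measure R))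
    measurable_pair_complex measurable_complex_pair pair_complexK.

Definition tuple_split n (z : n.+1.-tuple R[i]) : R[i] * n.-tuple R[i] :=
  (thead z, [tuple of behead z]).
Definition tuple_join n (x : R[i] * n.-tuple R[i]) : n.+1.-tuple R[i] :=
  [tuple of x.1 :: x.2].

Lemma tuple_joinK n : cancel (@tuple_join n) (@tuple_split n).
Proof. by move=> [x t]; congr pair; apply/val_inj. Qed.

Lemma measurable_tuple_split n :
  measurable_fun [set: n.+1.-tuple R[i]] (@tuple_split n).
Proof.
apply: measurable_fun_pair; first exact: measurable_tnth.
exact: measurable_behead.
Qed.

Lemma measurable_tuple_join n :
  measurable_fun [set: R[i] * n.-tuple R[i]] (@tuple_join n).
Proof. exact: measurable_cons. Qed.

(* On the one-point space C^0 Lebesgue measure is the unit mass. *)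
Fixpoint lebesgueCn n : {sigma_finite_measure set (n.-tuple R[i]) -> \bar R} :=
  match n with
  | 0 => dirac ([tuple] : 0.-tuple R[i])
  | k.+1 => transport (product_measure lebesgueC (lebesgueCn k))
     (@measurable_tuple_join k) (@measurable_tuple_split k) (@tuple_joinK k)
  end.

End lebesgue_complex.

Section siegel.
Variables (R : realType) (n : nat).

(* z = (z', z_{n+1}) *)
Definition cpoint : Type := (n.-tuple R[i] * R[i])%type.

Definition sqnorm (z' : n.-tuple R[i]) : R :=
  \sum_(j < n) normc (tnth z' j) ^+ 2.

Definition hdot (z' w' : n.-tuple R[i]) : R[i] :=
  \sum_(j < n) tnth z' j * conjc (tnth w' j).

Definition siegel : set cpoint := [set z | sqnorm z.1 < complex.Im z.2].

Definition bsiegel : set cpoint := [set z | complex.Im z.2 = sqnorm z.1].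

Definition bsiegel_param (x : n.-tuple R[i] * R) : cpoint :=
  (x.1, x.2 +i* sqnorm x.1).

Definition bsiegel_coord (z : cpoint) : n.-tuple R[i] * R :=
  (z.1, complex.Re z.2).

Lemma bsiegel_paramK : cancel bsiegel_param bsiegel_coord.
Proof. by case. Qed.

Lemma measurable_sqnorm : measurable_fun [set: n.-tuple R[i]] sqnorm.
Proof.
apply: measurable_sum => j.
exact: (measurableT_comp measurable_sqr_normc (measurable_tnth j)).
Qed.

Lemma measurable_bsiegel_param :
  measurable_fun [set: n.-tuple R[i] * R] bsiegel_param.
Proof.
apply: measurable_fun_pair; first exact: measurable_fst.
have mp : measurable_fun [set: n.-tuple R[i] * R] (fun x => (x.2, sqnorm x.1)).
  apply: measurable_fun_pair; first exact: measurable_snd.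
  exact: (measurableT_comp measurable_sqnorm measurable_fst).
exact: (measurableT_comp measurable_pair_complex mp).
Qed.

Lemma measurable_bsiegel_coord : measurable_fun [set: cpoint] bsiegel_coord.
Proof.
apply: measurable_fun_pair; first exact: measurable_fst.
exact: (measurableT_comp measurable_Re measurable_snd).
Qed.

(* beta is a measure on the whole of C^{n+1}, carried by bsiegel (beta_carrier);
   accordingly functions on bsiegel are represented by functions on C^{n+1},
   whose values off bsiegel do not matter. *)
Definition beta : {sigma_finite_measure set cpoint -> \bar R} :=
  transport (product_measure (lebesgueCn R n) (@lebesgue_measure R))
    measurable_bsiegel_param measurable_bsiegel_coord bsiegel_paramK.

Lemma beta_carrier : beta (~` bsiegel) = 0%E.
Proof.
rewrite transportE (_ : _ @^-1` _ = set0) ?measure0//.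
by apply/seteqP; split=> // -[z t] /=; apply.
Qed.

Lemma ge0_integral_beta (f : cpoint -> \bar R) :
  measurable_fun [set: cpoint] f -> (forall u, 0 <= f u)%E ->
  (\int[beta]_u f u =
   \int[(product_measure (lebesgueCn R n) (@lebesgue_measure R))]_x f (x.1, x.2 +i* sqnorm x.1))%E.
Proof.
by move=> mf f0; exact: (ge0_integral_transport _ _ _ _ mf f0).
Qed.

Definition Cintegral (f : cpoint -> R[i]) : R[i] :=
  (\int[beta]_u complex.Re (f u)) +i* (\int[beta]_u complex.Im (f u)).

Definition LpC_norm (p : R) (f : cpoint -> R[i]) : \bar R :=
  'N[beta]_p%:E[(fun u => (normc (f u))%:E)]%E.

Definition LpC (p : R) : set (cpoint -> R[i]) :=
  [set f | measurable_fun setT f /\ (LpC_norm p f < +oo)%E].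

Definition vshift (t : R) (u : cpoint) : cpoint := (u.1, u.2 + t*i).

Lemma vshift_siegel t u : 0 < t -> bsiegel u -> siegel (vshift t u).
Proof.
by case: u => u' [x y] t0 /= uE; rewrite /siegel/= -uE /= ltrDl.
Qed.

Definition hardy_norm (p : R) (F : cpoint -> R[i]) : \bar R :=
  ereal_sup [set LpC_norm p (fun u => F (vshift t u)) | t in [set t | 0 < t]].

Definition rho (z w : cpoint) : R[i] :=
  (0 +i* 1) / 2 * (conjc w.2 - z.2) - hdot z.1 w.1.

(* The integral converges absolutely for z in siegel and f in L^p, 1 < p < oo;
   the values outside siegel are irrelevant. *)
Definition cauchy_szego (f : cpoint -> R[i]) (z : cpoint) : R[i] :=
  (n`!%:R / (4 * pi ^+ n.+1))%:C * Cintegral (fun u => rho z u ^- n.+1 * f u).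

(* f <> 0 in L^p, i.e. f is not beta-almost everywhere zero; then the
   denominator lies in ]0, +oo[. *)
Definition opnorm_Lp_Hp (p : R) (T : (cpoint -> R[i]) -> (cpoint -> R[i])) :
    \bar R :=
  ereal_sup [set (hardy_norm p (T f) / LpC_norm p f)%E |
    f in [set f | LpC p f /\ ~ {ae beta, forall u, f u = 0}]].

End siegel.

(* Main.v *)
Require Import Defs.
From mathcomp Require Import all_boot all_order all_algebra.
From mathcomp Require Import complex.
From mathcomp Require Import all_classical all_reals all_analysis.
From mathcomp Require Import measurable_realfun.
From mathcomp Require Import ring lra.

Set Implicit Arguments.
Unset Strict Implicit.
Unset Printing Implicit Defensive.

Import Order.TTheory GRing.Theory Num.Theory.
Import numFieldNormedType.Exports.
Import ComplexField.Normc.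

Local Open Scope classical_set_scope.
Local Open Scope ring_scope.
Local Open Scope complex_scope.

(** Write N = n+1, al = N/p and be = N/q, so that al + be = N. The bound is the
    value of the projection on a homogeneous function f that only just fails to
    lie in L^p, and f is approximated by truncation.

    The boundary is C^n x R with the coordinate W(x) = |x'|^2 + i t. The
    dilations (x', t) -> (sqrt s x', s t) multiply W by s and the measure by
    s^N. For z above the boundary put Z = -i z_(n+1); then
    2 rho(z, x) = W + Z - 2 z'.conj(x') ([rho_param]). Take
    f = |W|^(-al) e^(i be arg W) ([hom_test]). The modulus of C f at z is
    c |Z|^(-al), where c is the quotient of Gamma values, for two reasons.
    - W is invariant under the rotations of x', so that only the constant term
      of the expansion of (W + Z - 2 z'.conj(x'))^(-N) in powers of z'.conj(x')
      contributes to the integral ([cint_mean_value]): the kernel may be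
      replaced by (W + Z)^(-N).
    - On the orbit of x under the dilations the integral becomes that of
      s^(be-1) (s W + Z)^(-N), which is a constant times W^(-be) Z^(-al) with
      principal powers ([beta_ray]). The phase of f cancels that of W^(-be), so
      the orbits all contribute the same phase, and their total mass, found
      from Gaussian integrals, gives the remaining constant ([bmassE],
      [cint_hom_kernel]).

    At height one above y, |Z| is between |W(y)| and |W(y)| + 1, so that C f is
    there almost c times as large as f(y) when |W(y)| is large. Now cut f off to
    the shell 1 <= |W| < M ([trial]). If K <= |W(y)| < M/K, the removed parts of
    f only change C f by a multiple of |W(y)|^(-al) that tends to 0 as K tends
    to infinity, since |rho| is comparable with the larger of |W| and |Z| when
    one of them is much larger than the other ([cauchy_szego_lower]). As
    |f|^p = |W|^(-N) is the density of a dilation-invariant measure, for M = K^m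
    the p-th power of the norm of the truncated f is m times that of a single
    shell of ratio K, whereas for its projection at height one it is at least
    (m - 2) times as much, up to the factor b^p with b close to c
    ([opnorm_lower]). Let m, then K, tend to infinity. *)

(** * Complex numbers and measurability *)

Section complex_basics.
Context {R : realType}.
Implicit Types (z w : R[i]) (a b : R).

Lemma normc_ge0 z : 0 <= normc z.
Proof. by case: z => a b; exact: sqrtr_ge0. Qed.

Lemma normcX z k : normc (z ^+ k) = normc z ^+ k.
Proof.
by elim: k => [|k IH]; rewrite ?expr0 ?normc1// !exprS normcM IH.
Qed.

Lemma normcR a : normc a%:C = `|a|.
Proof. by rewrite /= expr0n /= addr0 sqrtr_sqr. Qed.

Lemma normc_conjc z : normc (conjc z) = normc z.
Proof. by case: z => a b /=; rewrite sqrrN. Qed.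

Lemma normRe_le z : `|complex.Re z| <= normc z.
Proof.
by case: z => a b /=; rewrite -sqrtr_sqr ler_wsqrtr// lerDl sqr_ge0.
Qed.

Lemma normIm_le z : `|complex.Im z| <= normc z.
Proof.
by case: z => a b /=; rewrite -sqrtr_sqr ler_wsqrtr// lerDr sqr_ge0.
Qed.

Lemma Re_le_normc z : complex.Re z <= normc z.
Proof. exact: le_trans (ler_norm _) (normRe_le _). Qed.

Lemma normc_le_ReIm z : normc z <= `|complex.Re z| + `|complex.Im z|.
Proof.
case: z => a b; have -> : a +i* b = a%:C + (0 +i* b).
  by apply/eqP; rewrite eq_complex /= addr0 add0r !eqxx.
apply: (le_trans (le_normcD _ _)); rewrite normcR /=.
by rewrite expr0n /= !addr0 !add0r sqrtr_sqr.
Qed.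

Lemma normc_eq0 z : (normc z == 0) = (z == 0).
Proof.
apply/eqP/eqP => [/eq0_normc //|->]; exact: normc0.
Qed.

Lemma normc_gt0 z : z != 0 -> 0 < normc z.
Proof. by move=> z0; rewrite lt0r normc_eq0 z0 normc_ge0. Qed.

Lemma le_normcB z w : normc z - normc w <= normc (z + w).
Proof.
rewrite lerBlDr; have := le_normcD (z + w) (- w).
by rewrite addrK normcN.
Qed.

Lemma normc_sum I (r : seq I) (F : I -> R[i]) :
  normc (\sum_(i <- r) F i) <= \sum_(i <- r) normc (F i).
Proof.
elim: r => [|i r IH]; first by rewrite !big_nil normc0.
by rewrite !big_cons (le_trans (le_normcD _ _))// lerD2l.
Qed.

Definition cis a : R[i] := cos a +i* sin a.

Lemma cisD a b : cis (a + b) = cis a * cis b.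
Proof.
apply/eqP; rewrite eq_complex /= cosD sinD eqxx /=.
by rewrite [X in X == _]addrC.
Qed.

Lemma cis0 : cis 0 = 1.
Proof. by rewrite /cis cos0 sin0. Qed.

Lemma cisM_nat a k : cis (a * k%:R) = cis a ^+ k.
Proof.
elim: k => [|k IH]; first by rewrite mulr0 cis0 expr0.
by rewrite -[in LHS]addn1 natrD mulrDr mulr1 cisD IH exprSr.
Qed.

Lemma normc_cis a : normc (cis a) = 1.
Proof. by rewrite /= cos2Dsin2 sqrtr1. Qed.

Lemma cis_neq0 a : cis a != 0.
Proof. by rewrite -normc_eq0 normc_cis oner_eq0. Qed.

Lemma cisN a : cis (- a) = (cis a)^-1.
Proof.
apply: (mulfI (cis_neq0 a)).
by rewrite -cisD subrr cis0 mulfV// cis_neq0.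
Qed.

Lemma conj_cis a : conjc (cis a) = cis (- a).
Proof. by rewrite /cis /= cosN sinN. Qed.

(** The argument on the closed right half-plane. The half-angle formula makes it
    a measurable function of [w] that is correct up to the imaginary axis, which
    carries the whole boundary when n = 0. *)
Definition carg w : R := 2 * atan (complex.Im w / (complex.Re w + normc w)).

Lemma polar_form w : 0 <= complex.Re w -> w != 0 ->
  w = (normc w)%:C * cis (carg w).
Proof.
move=> w0 wn0; have r0 := normc_gt0 wn0.
have r2 : normc w ^+ 2 = complex.Re w ^+ 2 + complex.Im w ^+ 2.
  exact: sqr_normc_ReIm.
rewrite /carg; move: r0 r2; set r := normc w; case: w w0 {wn0} @r => x y /=.
set r := Num.sqrt _; move=> x0 r0 r2.
set t := y / (x + r).
have xr0 : 0 < x + r by lra.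
have ct : cos (atan t) ^+ 2 = (1 + t ^+ 2)^-1.
  by rewrite cos_atan exprVn sqr_sqrtr// addr_ge0// sqr_ge0.
have t1 : (1 + t ^+ 2)^-1 = (x + r) / (2 * r).
  have -> : 1 + t ^+ 2 = (2 * r) / (x + r).
    have -> : 2 * r / (x + r) = ((x + r) ^+ 2 + y ^+ 2) / (x + r) ^+ 2.
      rewrite (_ : _ + y ^+ 2 = 2 * r * (x + r)); last by rewrite sqrrD; ring: r2.
      by field; lra.
    by rewrite /t expr_div_n mulrDl divff// sqrf_eq0; lra.
  by rewrite invf_div.
have cn0 : cos (atan t) != 0.
  by apply: lt0r_neq0; apply: cos_gt0_pihalf; rewrite atan_gtNpi2 atan_ltpi2.
have st : sin (atan t) = t * cos (atan t).
  by rewrite -[t in t * _]atanK /tan -mulrA mulVf// mulr1.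
have rn : r != 0 by lra.
have xrn : x + r != 0 by lra.
apply/eqP; rewrite eq_complex /= !mul0r subr0 addr0.
have -> : 2 * atan t = atan t + atan t by lra.
rewrite cosD sinD st; apply/andP; split; apply/eqP.
  have -> : cos (atan t) * cos (atan t) - t * cos (atan t) * (t * cos (atan t)) =
     (2 - (1 + t ^+ 2)) * cos (atan t) ^+ 2 by ring.
  rewrite ct mulrBl divff; last by rewrite -invr_eq0 t1 mulf_neq0// ?invr_eq0 ?mulf_neq0 //; lra.
  by rewrite t1; field; rewrite rn.
have -> : t * cos (atan t) * cos (atan t) + cos (atan t) * (t * cos (atan t)) =
     2 * t * cos (atan t) ^+ 2 by ring.
by rewrite ct t1 /t; field; rewrite rn xrn.
Qed.

Lemma carg_le w : 0 <= complex.Re w -> `|carg w| <= pi / 2.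
Proof.
move=> x0; have [->|wn0] := eqVneq w 0.
  by rewrite /carg/= mul0r atan0 mulr0 normr0 divr_ge0// pi_ge0.
have r0 := normc_gt0 wn0; have yr := normIm_le w.
have t1 : `|complex.Im w / (complex.Re w + normc w)| <= 1.
  rewrite normrM normfV ler_pdivrMr ?normr_gt0; last by rewrite lt0r_neq0//; lra.
  by rewrite mul1r (le_trans yr)// (le_trans _ (ler_norm _))// lerDr.
have P4 : atan 1 = pi / 4 :> R by exact: atan1.
rewrite /carg normrM ger0_norm//.
suff : `|atan (complex.Im w / (complex.Re w + normc w))| <= pi / 4 by lra.
move: t1; rewrite !ler_norml => /andP[t1 t2]; apply/andP; split.
  by rewrite -P4 -atanN le_atan.
by rewrite -P4 le_atan.
Qed.

Lemma carg_lt w : 0 < complex.Re w -> `|carg w| < pi / 2.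
Proof.
move=> x0; rewrite lt_neqAle carg_le ?andbT ?ltW//; apply/negP => /eqP aE.
have wn0 : w != 0 by apply: contraTneq x0 => ->; rewrite ltxx.
have c0 : cos (carg w) = 0 by rewrite -cos_norm aE cos_pihalf.
have := x0; rewrite (polar_form (ltW x0) wn0) /= c0.
by rewrite mulr0 mul0r subr0 ltxx.
Qed.

Lemma cargZ a w : 0 < a -> carg (a%:C * w) = carg w.
Proof.
move=> a0; rewrite /carg normcM normcR gtr0_norm//; case: w => x y /=.
by rewrite !mul0r subr0 addr0 -mulrDr -mulf_div divff ?gt_eqF// mul1r.
Qed.

End complex_basics.

Section complex_measurability.
Context {R : realType} d {T : measurableType d}.
Implicit Types f g : T -> R[i].

Lemma measurable_ReImP f : measurable_fun setT (fun x => complex.Re (f x)) ->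
  measurable_fun setT (fun x => complex.Im (f x)) -> measurable_fun setT f.
Proof.
move=> mR mI; have -> : f = pair_complex \o (fun x => (complex.Re (f x), complex.Im (f x))).
  by apply/funext => x /=; case: (f x).
apply: (measurableT_comp measurable_pair_complex).
exact: measurable_fun_pair.
Qed.

Lemma mReC f : measurable_fun setT f ->
  measurable_fun setT (fun x => complex.Re (f x)).
Proof. by move=> mf; exact: (measurableT_comp measurable_Re mf). Qed.

Lemma mImC f : measurable_fun setT f ->
  measurable_fun setT (fun x => complex.Im (f x)).
Proof. by move=> mf; exact: (measurableT_comp measurable_Im mf). Qed.

Lemma mnormC f : measurable_fun setT f ->
  measurable_fun setT (fun x => normc (f x)).
Proof.
move=> mf; have -> : (fun x => normc (f x)) = (fun x =>
    ((complex.Re (f x) ^+ 2 + complex.Im (f x) ^+ 2) `^ 2^-1)).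
  apply/funext => x; rewrite powR12_sqrt ?addr_ge0 ?sqr_ge0//.
  by case: (f x).
apply: (measurableT_comp (measurable_powR _)).
apply: measurable_funD; apply: measurable_funX; [exact: mReC|exact: mImC].
Qed.

Lemma mrealC (h : T -> R) : measurable_fun setT h ->
  measurable_fun setT (fun x => (h x)%:C).
Proof. by move=> mh; apply: measurable_ReImP. Qed.

Lemma mcis (h : T -> R) : measurable_fun setT h ->
  measurable_fun setT (fun x => cis (h x)).
Proof.
move=> mh; apply: measurable_ReImP => /=.
  apply: (measurableT_comp _ mh); apply: continuous_measurable_fun.
  exact: continuous_cos.
apply: (measurableT_comp _ mh); apply: continuous_measurable_fun.
exact: continuous_sin.
Qed.

Lemma mDC f g : measurable_fun setT f -> measurable_fun setT g ->
  measurable_fun setT (fun x => f x + g x).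
Proof.
move=> mf mg; apply: measurable_ReImP.
  under eq_fun do rewrite raddfD.
  by apply: measurable_funD; exact: mReC.
under eq_fun do rewrite raddfD.
by apply: measurable_funD; exact: mImC.
Qed.

Lemma mMC f g : measurable_fun setT f -> measurable_fun setT g ->
  measurable_fun setT (fun x => f x * g x).
Proof.
move=> mf mg; apply: measurable_ReImP.
  rewrite (_ : (fun x => _) = (fun x => complex.Re (f x) * complex.Re (g x) -
     complex.Im (f x) * complex.Im (g x))).
    by apply: measurable_funB; apply: measurable_funM; first [exact: mReC|exact: mImC].
  by apply/funext => x; case: (f x) (g x) => a b [].
rewrite (_ : (fun x => _) = (fun x => complex.Re (f x) * complex.Im (g x) +
   complex.Im (f x) * complex.Re (g x))).
  by apply: measurable_funD; apply: measurable_funM; first [exact: mReC|exact: mImC].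
by apply/funext => x; case: (f x) (g x) => a b [].
Qed.

Lemma mNC f : measurable_fun setT f -> measurable_fun setT (fun x => - f x).
Proof.
move=> mf; under eq_fun do rewrite -mulN1r.
by apply: mMC.
Qed.

Lemma mXC f k : measurable_fun setT f -> measurable_fun setT (fun x => f x ^+ k).
Proof.
move=> mf; elim: k => [|k IH].
  by under eq_fun do rewrite expr0; exact: measurable_cst.
by under eq_fun do rewrite exprS; exact: mMC.
Qed.

Lemma mJC f : measurable_fun setT f -> measurable_fun setT (fun x => conjc (f x)).
Proof.
move=> mf; apply: measurable_ReImP.
  rewrite (_ : (fun x => _) = (fun x => complex.Re (f x))); first exact: mReC.
  by apply/funext => x; case: (f x).
rewrite (_ : (fun x => _) = (fun x => - complex.Im (f x))).
  by apply: measurableT_comp => //; exact: mImC.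
by apply/funext => x; case: (f x).
Qed.

Lemma mVR (h : T -> R) : measurable_fun setT h ->
  measurable_fun setT (fun x => (h x)^-1).
Proof.
move=> mh.
have mV : measurable_fun [set: R] (fun x : R => x^-1).
  rewrite -(setUv [set 0 : R]); apply/measurable_funU => //.
    exact: measurableC.
  split; first exact: measurable_fun_set1.
  apply: open_continuous_measurable_fun.
    exact/closed_openC/closed_eq.
  by move=> x /set_mem /eqP x0; exact: inv_continuous.
exact: (measurableT_comp mV mh).
Qed.

Lemma mVC f : measurable_fun setT f -> measurable_fun setT (fun x => (f x)^-1).
Proof.
move=> mf; rewrite (_ : (fun x => _) = (fun x =>
    conjc (f x) * ((normc (f x) ^+ 2)^-1)%:C)).
  apply: mMC; first exact: mJC.
  by apply/mrealC/mVR/measurable_funX/mnormC.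
apply/funext => x; rewrite sqr_normc_ReIm; case: (f x) => a b /=.
apply/eqP; rewrite eq_complex; apply/andP; split; apply/eqP => /=.
  by rewrite mulr0 subr0.
by rewrite mulr0 add0r mulNr.
Qed.

Lemma msumC I (r : seq I) (F : I -> T -> R[i]) :
  (forall i, measurable_fun setT (F i)) ->
  measurable_fun setT (fun x => \sum_(i <- r) F i x).
Proof.
move=> mF; elim: r => [|i r IH].
  by under eq_fun do rewrite big_nil; exact: measurable_cst.
by under eq_fun do rewrite big_cons; exact: mDC.
Qed.

Lemma mcarg f : measurable_fun setT f -> measurable_fun setT (fun x => carg (f x)).
Proof.
move=> mf; rewrite /carg; apply: measurable_funM => //.
apply: (measurableT_comp (f := @atan R)).
  by apply: continuous_measurable_fun => x; exact: continuous_atan.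
apply: measurable_funM; first exact: mImC.
by apply: mVR; apply: measurable_funD; [exact: mReC|exact: mnormC].
Qed.

End complex_measurability.

(** * Integration of complex-valued functions *)

Section cint_def.
Context {R : realType} d {T : measurableType d}.

Definition cint (m : {measure set T -> \bar R}) (f : T -> R[i]) : R[i] :=
  (\int[m]_x complex.Re (f x)) +i* (\int[m]_x complex.Im (f x)).

Definition cintegrable (m : {measure set T -> \bar R}) (f : T -> R[i]) : Prop :=
  measurable_fun setT f /\ (\int[m]_x (normc (f x))%:E < +oo)%E.

End cint_def.

Section ge0_extra.
Context {R : realType} d {T : measurableType d}.
Variable m : {measure set T -> \bar R}.
Local Open Scope ereal_scope.

(** The integral of a nonnegative function is a supremum over the simple
    functions below it, so that monotonicity holds without measurability. *)
Lemma ge0_le_integral_nonmeas (f g : T -> \bar R) :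
  (forall x, 0 <= f x) -> (forall x, f x <= g x) ->
  \int[m]_x f x <= \int[m]_x g x.
Proof.
move=> f0 fg; have g0 x : 0 <= g x by exact: le_trans (f0 x) (fg x).
rewrite !ge0_integralTE//; apply: le_ereal_sup => _ [h hf <-]; exists h => //.
by move=> x; exact: le_trans (hf x) (fg x).
Qed.

End ge0_extra.

Section cint_theory.
Context {R : realType} d {T : measurableType d}.
Variable m : {measure set T -> \bar R}.
Implicit Types f g : T -> R[i].

Lemma cintegrable_Re f : cintegrable m f ->
  m.-integrable setT (EFin \o (fun x => complex.Re (f x))).
Proof.
move=> [mf fi]; apply/integrableP; split.
  by apply/measurable_EFinP; exact: mReC.
apply: le_lt_trans fi; apply: ge0_le_integral_nonmeas => [x|x] //=.
by rewrite lee_fin normRe_le.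
Qed.

Lemma cintegrable_Im f : cintegrable m f ->
  m.-integrable setT (EFin \o (fun x => complex.Im (f x))).
Proof.
move=> [mf fi]; apply/integrableP; split.
  by apply/measurable_EFinP; exact: mImC.
apply: le_lt_trans fi; apply: ge0_le_integral_nonmeas => [x|x] //=.
by rewrite lee_fin normIm_le.
Qed.

Lemma le_cintegrable f (g : T -> R) : measurable_fun setT f ->
  (forall x, normc (f x) <= g x) -> (\int[m]_x (g x)%:E < +oo)%E ->
  cintegrable m f.
Proof.
move=> mf fg gi; split=> //; apply: le_lt_trans gi.
by apply: ge0_le_integral_nonmeas => x; rewrite lee_fin ?normc_ge0.
Qed.

Lemma eq_cint f g : f =1 g -> cint m f = cint m g.
Proof. by move=> /funext ->. Qed.

Lemma cintegrableZ c f : cintegrable m f -> cintegrable m (fun x => c * f x).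
Proof.
move=> [mf fi]; split; first exact: mMC.
under eq_integral do rewrite normcM EFinM.
rewrite ge0_integralZl_EFin ?normc_ge0//; last 2 first.
  by move=> x _; rewrite lee_fin normc_ge0.
  by apply/measurable_EFinP; exact: mnormC.
by rewrite lte_mul_pinfty// lee_fin normc_ge0.
Qed.

Lemma cintegrableD f g : cintegrable m f -> cintegrable m g ->
  cintegrable m (fun x => f x + g x).
Proof.
move=> [mf fi] [mg gi]; apply: (@le_cintegrable _ (fun x => normc (f x) + normc (g x))).
- exact: mDC.
- by move=> x; exact: le_normcD.
- under eq_integral do rewrite EFinD.
  rewrite ge0_integralD//; last 4 first.
    by move=> x _; rewrite lee_fin normc_ge0.
    by apply/measurable_EFinP; exact: mnormC.
    by move=> x _; rewrite lee_fin normc_ge0.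
    by apply/measurable_EFinP; exact: mnormC.
  exact: lte_add_pinfty.
Qed.

Lemma cintD f g : cintegrable m f -> cintegrable m g ->
  cint m (fun x => f x + g x) = cint m f + cint m g.
Proof.
move=> fi gi; apply/eqP; rewrite eq_complex; apply/andP; split; apply/eqP => /=.
  rewrite -RintegralD//; try exact: cintegrable_Re.
  by apply: eq_Rintegral => x _; rewrite raddfD.
rewrite -RintegralD//; try exact: cintegrable_Im.
by apply: eq_Rintegral => x _; rewrite raddfD.
Qed.

Lemma cintZ c f : cintegrable m f -> cint m (fun x => c * f x) = c * cint m f.
Proof.
move=> fi; have fR := cintegrable_Re fi; have fI := cintegrable_Im fi.
have ir (r : R) (h : T -> R) : m.-integrable setT (EFin \o h) ->
    m.-integrable setT (EFin \o (fun x => r * h x)).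
  by move=> hi; exact: (@integrableZl _ _ _ m setT measurableT r _ hi).
case: c => a b; apply/eqP; rewrite eq_complex; apply/andP; split; apply/eqP => /=.
  rewrite -!RintegralZl// -RintegralB//; try exact: ir.
  by apply: eq_Rintegral => x _; case: (f x).
rewrite -!RintegralZl// -RintegralD//; try exact: ir.
by apply: eq_Rintegral => x _; case: (f x).
Qed.

Lemma cint0 : cint m (fun=> 0) = 0.
Proof.
apply/eqP; rewrite eq_complex /=; apply/andP; split; apply/eqP;
  by rewrite /Rintegral integral0.
Qed.

(** Bounding the two components separately costs a factor 2, which is harmless
    since this only serves for error terms. *)
Lemma normc_cint_le f (b : R) : cintegrable m f ->
  (\int[m]_x (normc (f x))%:E <= b%:E)%E -> normc (cint m f) <= 2 * b.
Proof.
move=> fi fb; apply: (le_trans (normc_le_ReIm _)) => /=.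
have H (h : T -> R) : (forall x, `|h x| <= normc (f x)) ->
    m.-integrable setT (EFin \o h) -> `|\int[m]_x h x| <= b.
  move=> hf hi; rewrite -lee_fin EFin_normr_Rintegral//.
  apply: (le_trans (le_abse_integral _ measurableT _)).
    by case/integrableP: hi.
  apply: le_trans fb; apply: ge0_le_integral_nonmeas => x //=.
  by rewrite lee_fin.
rewrite mulr2n mulrDl mul1r lerD//; apply: H.
- by move=> x; exact: normRe_le.
- exact: cintegrable_Re.
- by move=> x; exact: normIm_le.
- exact: cintegrable_Im.
Qed.

End cint_theory.

(** * Changes of variables *)

Section chvar.
Context {R : realType} d d' {T : measurableType d} {T' : measurableType d'}.

(** [chvar m m' phi r] says that [m] is the image under [phi] of the measure
    [r m']; stating it through integrals of nonnegative functions lets iterated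
    integrals serve as proofs. *)
Definition chvar (m : {measure set T -> \bar R}) (m' : {measure set T' -> \bar R})
    (phi : T' -> T) (r : T' -> R) :=
  [/\ measurable_fun setT phi, measurable_fun setT r, (forall x, 0 <= r x) &
    forall h : T -> \bar R, measurable_fun setT h -> (forall x, 0 <= h x)%E ->
      (\int[m]_x h x = \int[m']_x ((r x)%:E * h (phi x)))%E].

Variables (m : {measure set T -> \bar R}) (m' : {measure set T' -> \bar R}).
Variables (phi : T' -> T) (r : T' -> R).

Lemma chvar_Rint (f : T -> R) : chvar m m' phi r ->
  m.-integrable setT (EFin \o f) ->
  \int[m]_x f x = \int[m']_x (r x * f (phi x)).
Proof.
move=> [mphi mr r0 E] fi; rewrite /Rintegral; congr fine.
have mf : measurable_fun setT f by case/integrableP: fi => /measurable_EFinP.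
rewrite integralE [RHS]integralE; congr (_ - _)%E.
  rewrite E//; last first.
    by apply: measurable_funepos; exact/measurable_EFinP.
  apply: eq_integral => x _; rewrite !funeposE/=.
  by rewrite maxe_pMr ?lee_fin// mule0 EFinM.
rewrite E//; last first.
  by apply: measurable_funeneg; exact/measurable_EFinP.
apply: eq_integral => x _; rewrite !funenegE/=.
by rewrite maxe_pMr ?lee_fin// mule0 -EFinM mulrN.
Qed.

Lemma chvar_cintegrable (f : T -> R[i]) : chvar m m' phi r ->
  cintegrable m f -> cintegrable m' (fun x => (r x)%:C * f (phi x)).
Proof.
move=> [mphi mr r0 E] [mf fi]; split.
  by apply: mMC; [exact: mrealC|exact: measurableT_comp].
move: fi; rewrite E//.
- by under eq_integral do rewrite -EFinM -(ger0_norm (r0 _)) -normcR -normcM.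
- by apply/measurable_EFinP; exact: mnormC.
- by move=> x; rewrite lee_fin normc_ge0.
Qed.

Lemma chvar_cint (f : T -> R[i]) : chvar m m' phi r -> cintegrable m f ->
  cint m f = cint m' (fun x => (r x)%:C * f (phi x)).
Proof.
move=> E fi; apply/eqP; rewrite eq_complex; apply/andP; split; apply/eqP => /=.
  rewrite (chvar_Rint E (cintegrable_Re fi)).
  by apply: eq_Rintegral => x _; case: (f _) => a b /=; rewrite mul0r subr0.
rewrite (chvar_Rint E (cintegrable_Im fi)).
by apply: eq_Rintegral => x _; case: (f _) => a b /=; rewrite mul0r addr0.
Qed.

End chvar.

Section chvar_ops.
Context {R : realType}.

Lemma chvar_transport d d' (T : measurableType d) (T' : measurableType d')
  (m : {sigma_finite_measure set T -> \bar R}) (f : T -> T') (g : T' -> T)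
  (mf : measurable_fun setT f) (mg : measurable_fun setT g) (fgK : cancel f g) :
  chvar (transport m mf mg fgK) m f (fun=> 1).
Proof.
split=> // h mh h0; rewrite (ge0_integral_transport _ _ _ _ mh h0).
by apply: eq_integral => x _; rewrite mul1e.
Qed.

Lemma chvar_comp d1 d2 d3 (T1 : measurableType d1) (T2 : measurableType d2)
  (T3 : measurableType d3) (m1 : {measure set T1 -> \bar R}) (m2 : {measure set T2 -> \bar R})
  (m3 : {measure set T3 -> \bar R}) (f : T2 -> T1) (g : T3 -> T2) r s :
  chvar m1 m2 f r -> chvar m2 m3 g s ->
  chvar m1 m3 (f \o g) (fun x => s x * r (g x)).
Proof.
move=> [mf mr r0 E1] [mg ms s0 E2]; split.
- exact: measurableT_comp.
- by apply: measurable_funM => //; exact: (measurableT_comp mr).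
- by move=> x; rewrite mulr_ge0.
- move=> h mh h0; rewrite E1// E2//.
  + by apply: eq_integral => x _; rewrite EFinM muleA.
  + apply: emeasurable_funM; first exact/measurable_EFinP.
    exact: measurableT_comp.
  + by move=> x; rewrite mule_ge0// lee_fin.
Qed.

(** The measures on C and on C^n are transported from products; this carries
    changes of variables over from the products. *)
Lemma chvar_conj d d' (T : measurableType d) (T' : measurableType d')
  (m : {sigma_finite_measure set T -> \bar R}) (f : T -> T') (g : T' -> T)
  (mf : measurable_fun setT f) (mg : measurable_fun setT g) (fgK : cancel f g)
  (phi : T -> T) (psi : T' -> T') (c : R) :
  0 <= c -> measurable_fun setT psi -> (forall x, psi (f x) = f (phi x)) ->
  chvar m m phi (fun=> c) ->
  chvar (transport m mf mg fgK) (transport m mf mg fgK) psi (fun=> c).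
Proof.
move=> c0 mpsi E [mphi mr _ H]; split=> // h mh h0.
have mh' : measurable_fun setT (h \o psi) by exact: measurableT_comp.
rewrite (ge0_integral_transport _ _ _ _ mh h0).
rewrite (H (h \o f) (measurableT_comp mh mf) (fun x => h0 _)).
rewrite (ge0_integral_transport m mf mg fgK)//.
- by apply: eq_integral => x _; rewrite /= E.
- by apply: emeasurable_funM.
- by move=> y; rewrite mule_ge0.
Qed.

Lemma ge0_integral_product d d' (T : measurableType d) (T' : measurableType d')
  (m : {sigma_finite_measure set T -> \bar R})
  (m' : {sigma_finite_measure set T' -> \bar R}) (h : T * T' -> \bar R) :
  measurable_fun setT h -> (forall x, 0 <= h x)%E ->
  (\int[product_measure m m']_x h x = \int[m]_x \int[m']_y h (x, y))%E.
Proof. by move=> mh h0; rewrite -(fubini_tonelli1 (m1 := m) (m2 := m')). Qed.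

Lemma ge0_integral_product2 d d' (T : measurableType d) (T' : measurableType d')
  (m : {sigma_finite_measure set T -> \bar R})
  (m' : {sigma_finite_measure set T' -> \bar R}) (h : T * T' -> \bar R) :
  measurable_fun setT h -> (forall x, 0 <= h x)%E ->
  (\int[product_measure m m']_x h x = \int[m']_y \int[m]_x h (x, y))%E.
Proof. by move=> mh h0; rewrite -(fubini_tonelli2 (m1 := m) (m2 := m')). Qed.

End chvar_ops.
Arguments chvar_conj {R d d' T T' m f g mf mg fgK} phi psi c.

Section cint_fubini.
Context {R : realType} d d' {T : measurableType d} {T' : measurableType d'}.
Variables (m : {sigma_finite_measure set T -> \bar R}).
Variables (m' : {sigma_finite_measure set T' -> \bar R}).

Lemma Rint_fubini1 (f : T * T' -> R) :
  (product_measure m m').-integrable setT (EFin \o f) ->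
  (forall x, m'.-integrable setT (EFin \o (fun y => f (x, y)))) ->
  \int[product_measure m m']_x f x = \int[m]_x \int[m']_y f (x, y).
Proof.
move=> fi si; rewrite /Rintegral; congr fine.
rewrite -(integral12_prod_meas1 (m1 := m) (m2 := m'))//.
by apply: eq_integral => x _; apply/esym/fineK/(integrable_fin_num measurableT (si x)).
Qed.

Lemma Rint_fubini2 (f : T * T' -> R) :
  (product_measure m m').-integrable setT (EFin \o f) ->
  (forall y, m.-integrable setT (EFin \o (fun x => f (x, y)))) ->
  \int[product_measure m m']_x f x = \int[m']_y \int[m]_x f (x, y).
Proof.
move=> fi si; rewrite /Rintegral; congr fine.
rewrite -(integral21_prod_meas1 (m1 := m) (m2 := m'))//.
by apply: eq_integral => x _; apply/esym/fineK/(integrable_fin_num measurableT (si x)).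
Qed.

Lemma cint_fubini1 (f : T * T' -> R[i]) :
  cintegrable (product_measure m m') f ->
  (forall x, cintegrable m' (fun y => f (x, y))) ->
  cint (product_measure m m') f = cint m (fun x => cint m' (fun y => f (x, y))).
Proof.
move=> fi si; apply/eqP; rewrite eq_complex; apply/andP; split; apply/eqP => /=.
  by apply: Rint_fubini1 => [|x]; [exact: cintegrable_Re|
    exact: (cintegrable_Re (si x))].
by apply: Rint_fubini1 => [|x]; [exact: cintegrable_Im|
  exact: (cintegrable_Im (si x))].
Qed.

Lemma cint_fubini2 (f : T * T' -> R[i]) :
  cintegrable (product_measure m m') f ->
  (forall y, cintegrable m (fun x => f (x, y))) ->
  cint (product_measure m m') f = cint m' (fun y => cint m (fun x => f (x, y))).
Proof.
move=> fi si; apply/eqP; rewrite eq_complex; apply/andP; split; apply/eqP => /=.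
  by apply: Rint_fubini2 => [|x]; [exact: cintegrable_Re|
    exact: (cintegrable_Re (si x))].
by apply: Rint_fubini2 => [|x]; [exact: cintegrable_Im|
  exact: (cintegrable_Im (si x))].
Qed.

End cint_fubini.

Lemma chvar_eq {R : realType} d d' {T : measurableType d}
  {T' : measurableType d'} (m0 : {measure set T -> \bar R}) (m1 : {measure set T' -> \bar R})
    (phi psi : T' -> T) (r s : T' -> R) :
  phi =1 psi -> r =1 s -> chvar m0 m1 phi r -> chvar m0 m1 psi s.
Proof. by move=> /funext -> /funext ->. Qed.

Section chvar_product.
Context {R : realType} d d' {T : measurableType d} {T' : measurableType d'}.
Variables (m : {sigma_finite_measure set T -> \bar R}).
Variables (m' : {sigma_finite_measure set T' -> \bar R}).

(** Skew maps: each fibre is transformed separately, and the fibre over which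
    it sits acts as a parameter. *)
Lemma chvar_skew1 (phi : T' -> T -> T) (r : T' -> T -> R) :
  measurable_fun setT (fun x : T * T' => phi x.2 x.1) ->
  measurable_fun setT (fun x : T * T' => r x.2 x.1) ->
  (forall y, chvar m m (phi y) (r y)) ->
  chvar (product_measure m m') (product_measure m m')
    (fun x => (phi x.2 x.1, x.2)) (fun x => r x.2 x.1).
Proof.
move=> mphi mr H.
have mP : measurable_fun setT (fun x : T * T' => (phi x.2 x.1, x.2)).
  by apply: measurable_fun_pair => //; exact: measurable_snd.
split=> //; first by move=> x; case: (H x.2) => _ _ + _; exact.
move=> h mh h0; rewrite !ge0_integral_product2//.
- apply: eq_integral => y _; have [_ _ _ ->//] := H y.
  by apply: (measurableT_comp mh); exact: measurable_pair2.
- apply: emeasurable_funM; first exact/measurable_EFinP.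
  exact: (measurableT_comp mh mP).
- by move=> x; rewrite mule_ge0// lee_fin; case: (H x.2) => _ _ + _; exact.
Qed.

Lemma chvar_skew2 (phi : T -> T' -> T') (r : T -> T' -> R) :
  measurable_fun setT (fun x : T * T' => phi x.1 x.2) ->
  measurable_fun setT (fun x : T * T' => r x.1 x.2) ->
  (forall y, chvar m' m' (phi y) (r y)) ->
  chvar (product_measure m m') (product_measure m m')
    (fun x => (x.1, phi x.1 x.2)) (fun x => r x.1 x.2).
Proof.
move=> mphi mr H.
have mP : measurable_fun setT (fun x : T * T' => (x.1, phi x.1 x.2)).
  by apply: measurable_fun_pair => //; exact: measurable_fst.
split=> //; first by move=> x; case: (H x.1) => _ _ + _; exact.
move=> h mh h0; rewrite !ge0_integral_product//.
- apply: eq_integral => y _; have [_ _ _ ->//] := H y.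
  by apply: (measurableT_comp mh); exact: measurable_pair1.
- apply: emeasurable_funM; first exact/measurable_EFinP.
  exact: (measurableT_comp mh mP).
- by move=> x; rewrite mule_ge0// lee_fin; case: (H x.1) => _ _ + _; exact.
Qed.

End chvar_product.
Arguments chvar_skew1 {R d d' T T' m m'} phi r.
Arguments chvar_skew2 {R d d' T T' m m'} phi r.

Lemma chvar_prod {R : realType} d d' {T : measurableType d}
  {T' : measurableType d'} (m : {sigma_finite_measure set T -> \bar R})
  (m' : {sigma_finite_measure set T' -> \bar R}) (f : T -> T) (g : T' -> T') (a b : R) :
  chvar m m f (fun=> a) -> chvar m' m' g (fun=> b) ->
  chvar (product_measure m m') (product_measure m m')
    (fun x => (f x.1, g x.2)) (fun=> a * b).
Proof.
move=> Hf Hg; have [mf _ _ _] := Hf; have [mg _ _ _] := Hg.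
apply: chvar_eq (chvar_comp
  (chvar_skew1 (fun _ => f) (fun _ _ => a) _ _ (fun=> Hf))
  (chvar_skew2 (fun _ => g) (fun _ _ => b) _ _ (fun=> Hg))) => //.
- by move=> x /=; rewrite mulrC.
- by apply: (measurableT_comp mf); exact: measurable_fst.
- by apply: (measurableT_comp mg); exact: measurable_snd.
Qed.

Section lebesgue_affine.
Context {R : realType}.
Let leb := (@lebesgue_measure R).

Lemma chvar_affine (a b : R) : 0 < a ->
  chvar leb leb (fun x => a * x + b) (fun=> a).
Proof.
move=> a0; pose phi : measurableTypeR R -> measurableTypeR R := fun x => a * x + b.
have mphi : measurable_fun setT phi.
  by apply: measurable_funD => //; exact: mulrl_measurable.
split=> //; first by move=> _; exact: ltW.
move=> h mh h0.
pose pm : {measure set (measurableTypeR R) -> \bar R} :=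
  measure_function_pushforward__canonical__measure_function_Measure leb mphi.
pose mu : {measure set (measurableTypeR R) -> \bar R} :=
  mscale (NngNum (ltW a0)) pm.
rewrite (@eq_measure_integral _ _ _ setT mu); last first.
  move=> A mA _; apply: lebesgue_measure_unique => //.
  move=> _ [[u v] _ <-].
  have -> : mu `]u, v]%classic = (a%:E * leb (phi @^-1` `]u, v]%classic))%E by [].
  rewrite (_ : phi @^-1` `]u, v] = `](u - b) / a, (v - b) / a]%classic).
    rewrite /leb !lebesgue_measure_itv/= !lte_fin ltr_pM2r ?invr_gt0// ltrD2r.
    case: ifPn => _; last by rewrite mule0.
    rewrite -!EFinB -EFinM; congr EFin.
    by rewrite -mulrBl mulrC divfK ?gt_eqF//; ring.
  apply/seteqP; split => x /=; rewrite !in_itv/= /phi.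
    by rewrite ltr_pdivrMr// ler_pdivlMr// ltrBlDr lerBrDr mulrC.
  by rewrite ltr_pdivrMr// ler_pdivlMr// ltrBlDr lerBrDr mulrC.
rewrite ge0_integral_mscale// /= ge0_integral_pushforward//.
rewrite preimage_setT; have mh' := measurableT_comp mh mphi.
rewrite [RHS](ge0_integralZl_EFin _ measurableT _ mh' (ltW a0))//.
by move=> x _; exact: h0.
Qed.

Lemma chvar_scale (a : R) : 0 < a -> chvar leb leb ( *%R a) (fun=> a).
Proof.
by move=> a0; apply: chvar_eq (chvar_affine 0 a0) => // x; rewrite addr0.
Qed.

Lemma chvar_translate (b : R) : chvar leb leb (fun x => x + b) (fun=> 1).
Proof.
by apply: chvar_eq (chvar_affine b ltr01) => // x; rewrite mul1r.
Qed.

End lebesgue_affine.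

Section lebesgue_complex.
Context {R : realType}.
Let leb := (@lebesgue_measure R).
Let leb2 := product_measure leb leb.

Let conjC := @chvar_conj R _ _ _ _ leb2 _ _ measurable_pair_complex
  measurable_complex_pair (@pair_complexK R).

Lemma chvar_scaleC (a : R) : 0 < a ->
  chvar (lebesgueC R) (lebesgueC R) (fun z => a%:C * z) (fun=> a ^+ 2).
Proof.
move=> a0; have H := chvar_scale a0.
apply: (conjC (phi := fun x => (a * x.1, a * x.2))).
- exact: sqr_ge0.
- by apply: mMC.
- by move=> [x y]; apply/eqP; rewrite eq_complex /= !mul0r subr0 addr0 !eqxx.
- exact: (chvar_prod H H).
Qed.

Let shear1 (t : R) : chvar leb2 leb2 (fun x => (x.1 + t * x.2, x.2)) (fun=> 1).
Proof.
apply: (@chvar_skew1 R _ _ _ _ leb leb (fun y x => x + t * y) (fun _ _ => 1)) => //.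
- apply: measurable_funD; first exact: measurable_fst.
  by apply: measurable_funM => //; exact: measurable_snd.
- by move=> y; exact: chvar_translate.
Qed.

Let shear2 (t : R) : chvar leb2 leb2 (fun x => (x.1, x.2 + t * x.1)) (fun=> 1).
Proof.
apply: (@chvar_skew2 R _ _ _ _ leb leb (fun y x => x + t * y) (fun _ _ => 1)) => //.
- apply: measurable_funD; first exact: measurable_snd.
  by apply: measurable_funM => //; exact: measurable_fst.
- by move=> y; exact: chvar_translate.
Qed.

(** A rotation is a product of three shears, each of which translates the fibres
    of a coordinate projection; [t] is minus the tangent of half the angle. *)
Lemma chvar_rotC (a : R) : sin a != 0 ->
  chvar (lebesgueC R) (lebesgueC R) (fun z => cis a * z) (fun=> 1).
Proof.
move=> sa; pose t := (cos a - 1) / sin a.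
apply: (conjC (phi := fun x => (cos a * x.1 - sin a * x.2, cos a * x.2 + sin a * x.1))).
- exact: ler01.
- by apply: mMC.
- by move=> [x y].
- apply: chvar_eq (chvar_comp (shear1 t) (chvar_comp (shear2 (sin a)) (shear1 t))) => /=.
  + have ts : t * sin a = cos a - 1 by rewrite /t divfK.
    have tc : t * (1 + cos a) = - sin a.
      have c2 := cos2Dsin2 a; rewrite /t mulrAC (_ : (_ - 1) * _ = - sin a ^+ 2).
        by field.
      by transitivity (cos a ^+ 2 - 1); [ring|rewrite -c2; ring].
    move=> [x y] /=; apply/esym; congr pair.
      rewrite -[sin a in LHS]opprK -tc; transitivity (x * (1 + t * sin a) +
        y * (t * (2 + t * sin a))); first by rewrite ts; ring.
      by ring.
    transitivity (y * (1 + t * sin a) + sin a * x); first by rewrite ts; ring.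
    by ring.
  + by move=> x; rewrite !mulr1.
Qed.

Lemma measurable_map_tuple d (T : measurableType d) n
    (f : T -> R[i]) (g : T -> n.-tuple R[i]) :
  measurable_fun setT f -> measurable_fun setT g ->
  measurable_fun setT (fun x => map_tuple ( *%R (f x)) (g x)).
Proof.
move=> mf mg; apply/measurable_fun_tnthP => i /=.
rewrite (_ : _ \o _ = fun x => f x * tnth (g x) i).
  apply: mMC => //.
  exact: (measurableT_comp (measurable_tnth i) mg).
by apply/funext => x /=; rewrite tnth_map.
Qed.

Lemma integral_lebesgueC0 (h : 0.-tuple R[i] -> \bar R) :
  measurable_fun setT h -> (\int[lebesgueCn R 0]_x h x = h [tuple])%E.
Proof.
move=> mh; have := @integral_dirac _ _ ([tuple] : 0.-tuple R[i]) R setT measurableT _ mh.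
by rewrite diracT mul1e.
Qed.

Lemma chvar_mapCn n (w : R[i]) (c : R) : 0 <= c ->
  chvar (lebesgueC R) (lebesgueC R) ( *%R w) (fun=> c) ->
  chvar (lebesgueCn R n) (lebesgueCn R n) (map_tuple ( *%R w)) (fun=> c ^+ n).
Proof.
move=> c0 H; elim: n => [|n IH].
  split=> //.
  - exact: (measurable_map_tuple (f := fun=> w) (g := id)).
  - move=> h mh h0; under [RHS]eq_integral do rewrite expr0 mul1e.
    rewrite !integral_lebesgueC0//; first by congr h; exact: val_inj.
    apply: (measurableT_comp mh).
    exact: (measurable_map_tuple (f := fun=> w) (g := id)).
rewrite exprS /=.
apply: (@chvar_conj R _ _ _ _ (product_measure (lebesgueC R) (lebesgueCn R n))
  _ _ (@measurable_tuple_join R n) (@measurable_tuple_split R n)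
  (@tuple_joinK R n) (fun x => (w * x.1, map_tuple ( *%R w) x.2))).
- by rewrite mulr_ge0// exprn_ge0.
- exact: (measurable_map_tuple (f := fun=> w) (g := id)).
- by move=> [z t]; exact: val_inj.
- exact: chvar_prod.
Qed.

End lebesgue_complex.

(** * Integration along the orbits of dilations *)

Section ppow.
Context {R : realType}.

Lemma powRD_gt0 (x r s : R) : 0 < x -> x `^ (r + s) = x `^ r * x `^ s.
Proof. by move=> x0; rewrite powRD// (gt_eqF x0) implybT. Qed.

(** The power function extended by [0] to the left half-line, so that integrals
    over the half-line are integrals over [R]. *)
Definition ppow (s a : R) : R := if 0 < s then s `^ a else 0.

Lemma ppow_ge0 s a : 0 <= ppow s a.
Proof. by rewrite /ppow; case: ifP => // _; exact: powR_ge0. Qed.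

Lemma ppow_gt0 s a : 0 < s -> ppow s a = s `^ a.
Proof. by rewrite /ppow => ->. Qed.

Lemma ppow_le0 s a : s <= 0 -> ppow s a = 0.
Proof. by rewrite /ppow ltNge => ->. Qed.

Lemma ppowM c s a : 0 < c -> ppow (c * s) a = c `^ a * ppow s a.
Proof.
move=> c0; rewrite /ppow pmulr_rgt0//; case: ifP => s0; last by rewrite mulr0.
by rewrite powRM// ltW.
Qed.

Lemma measurable_ppow a : measurable_fun setT (ppow ^~ a).
Proof.
apply: measurable_fun_if => //.
- exact: measurable_fun_ltr.
- by apply: measurable_funTS; exact: measurable_powR.
Qed.

Lemma mppow d (T : measurableType d) (h : T -> R) a : measurable_fun setT h ->
  measurable_fun setT (fun x => ppow (h x) a).
Proof. by move=> mh; exact: (measurableT_comp (measurable_ppow a) mh). Qed.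

Lemma ppowD s a b : ppow s (a + b) = ppow s a * ppow s b.
Proof.
rewrite /ppow; case: ifP => s0; last by rewrite mul0r.
exact: powRD_gt0.
Qed.

End ppow.

Lemma mifR {R : realType} d (T : measurableType d) (b : T -> bool) (f : T -> R) :
  measurable_fun setT b -> measurable_fun setT f ->
  measurable_fun setT (fun x => if b x then f x else 0).
Proof. by move=> mb mf; apply: measurable_fun_if => //; apply: measurable_funTS. Qed.

Section polar.
Context {R : realType} d {T : measurableType d}.
Variables (mu : {sigma_finite_measure set T -> \bar R}) (N : R).
Variables (dil : R -> T -> T) (rr : T -> R).
Hypothesis mdil : measurable_fun setT (fun x : T * R => dil x.2 x.1).
Hypothesis dilP : forall s, 0 < s -> chvar mu mu (dil s) (fun=> s `^ N).
Hypothesis mrr : measurable_fun setT rr.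
Hypothesis rr_ge0 : forall x, 0 <= rr x.
Hypothesis rr_dil : forall s x, 0 < s -> rr (dil s x) = s * rr x.
Hypothesis rr_neq0 : mu [set x | rr x = 0] = 0%E.

Let leb := (@lebesgue_measure R).

(** The cut at [1] is the condition [s <= rr (dil s x)] with [s] cancelled. *)
Definition polar_weight (x : T) : R := if 1 <= rr x then (rr x)^-1 else 0.

Let k (x : T) (s : R) : R := if (0 < s) && (s <= rr x) then (rr x)^-1 else 0.

Let k_ge0 x s : 0 <= k x s.
Proof. by rewrite /k; case: ifP => // _; rewrite invr_ge0. Qed.

Let mk : measurable_fun setT (fun x : T * R => k x.1 x.2).
Proof.
apply: mifR; last by apply: mVR; apply: (measurableT_comp mrr); exact: measurable_fst.
apply: measurable_and.
  by apply: measurable_fun_ltr => //; exact: measurable_snd.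
apply: measurable_fun_ler; first exact: measurable_snd.
by apply: (measurableT_comp mrr); exact: measurable_fst.
Qed.

Let int_k x : rr x != 0 -> (\int[leb]_s (k x s)%:E = 1)%E.
Proof.
move=> r0; have rp : 0 < rr x by rewrite lt0r r0 rr_ge0.
rewrite (_ : (fun s => (k x s)%:E) =
    (fun s => (rr x)^-1%:E * (\1_(`]0, rr x]%classic) s)%:E)%E); last first.
  apply/funext => s; rewrite /k indicE.
  have -> : (s \in `]0, rr x]%classic) = (0 < s) && (s <= rr x).
    by rewrite mem_setE in_itv.
  by case: ifP => _; rewrite -EFinM ?mulr1 ?mulr0.
rewrite ge0_integralZl_EFin ?invr_ge0//; last first.
  exact/measurable_EFinP/measurable_indic.
rewrite integral_indic//= setIT lebesgue_measure_itv/= lte_fin rp.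
by rewrite -EFinB -EFinM subr0 mulVf.
Qed.

Lemma measurable_polar_weight : measurable_fun setT polar_weight.
Proof.
apply: mifR; last exact: mVR.
exact: measurable_fun_ler.
Qed.

Lemma polar_weight_ge0 x : 0 <= polar_weight x.
Proof. by rewrite /polar_weight; case: ifP => // _; rewrite invr_ge0. Qed.

(** Insert [1 = rr(x)^-1 |{s | 0 < s <= rr x}|] under the integral, exchange
    the integrals, and move [x] back along its orbit by [dil s]. *)
Lemma chvar_polar : chvar mu (product_measure mu leb) (fun x => dil x.2 x.1)
  (fun x => ppow x.2 (N - 1) * polar_weight x.1).
Proof.
have mw : measurable_fun setT
    (fun x : T * R => ppow x.2 (N - 1) * polar_weight x.1).
  apply: measurable_funM; first by apply: mppow; exact: measurable_snd.
  by apply: (measurableT_comp measurable_polar_weight); exact: measurable_fst.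
split=> // [x|h mh h0]; first by rewrite mulr_ge0 ?ppow_ge0 ?polar_weight_ge0.
have mkh : measurable_fun setT (fun x : T * R => ((k x.1 x.2)%:E * h x.1)%E).
  apply: emeasurable_funM; first exact/measurable_EFinP.
  by apply: (measurableT_comp mh); exact: measurable_fst.
transitivity (\int[mu]_x \int[leb]_s ((k x s)%:E * h x))%E.
  apply: ge0_ae_eq_integral => //.
  - apply: (measurable_fun_fubini_tonelli_F (m2 := leb) _ mkh) => x.
    by rewrite mule_ge0// lee_fin.
  - by move=> x _; apply: integral_ge0 => s _; rewrite mule_ge0// lee_fin.
  - exists [set x | rr x = 0]; split => //.
      rewrite (_ : [set x | rr x = 0] = rr @^-1` [set 0])//.
      by rewrite -[X in measurable X]setTI; exact: mrr.
    move=> x /= H; apply: contrapT => /eqP r0; apply: H => _.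
    rewrite ge0_integralZr//.
    + by rewrite int_k// mul1e.
    + by apply/measurable_EFinP; exact: (measurableT_comp mk (measurable_pair1 x)).
    + by move=> s _; rewrite lee_fin.
rewrite -(ge0_integral_product mu leb mkh); last first.
  by move=> x; rewrite mule_ge0// lee_fin.
have mh' : measurable_fun setT (fun x : T * R => ((ppow x.2 (N - 1) *
    polar_weight x.1)%:E * h (dil x.2 x.1))%E).
  apply: emeasurable_funM; first exact/measurable_EFinP.
  exact: (measurableT_comp mh).
have h0' (x : T * R) : (0 <= (ppow x.2 (N - 1) * polar_weight x.1)%:E *
    h (dil x.2 x.1))%E.
  by rewrite mule_ge0// lee_fin mulr_ge0 ?ppow_ge0 ?polar_weight_ge0.
have k0' (x : T * R) : (0 <= (k x.1 x.2)%:E * h x.1)%E.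
  by rewrite mule_ge0// lee_fin.
rewrite (ge0_integral_product2 mu leb mkh k0').
rewrite (ge0_integral_product2 mu leb mh' h0').
apply: eq_integral => s _ /=; case: (ltrP 0 s) => s0; last first.
  rewrite !integral0_eq// => x _; last by rewrite /k ltNge s0 mul0e.
  by rewrite ppow_le0// mul0r mul0e.
have [_ _ _ ->] := dilP s0; last 2 first.
- apply: emeasurable_funM => //; apply/measurable_EFinP.
  exact: (measurableT_comp mk (measurable_pair2 s)).
- by move=> x; rewrite mule_ge0// lee_fin.
apply: eq_integral => x _; rewrite muleA -EFinM; congr (_%:E * _)%E.
rewrite /k s0/= rr_dil// ler_pMr// ppow_gt0// /polar_weight.
case: ifP => _; last by rewrite !mulr0.
by rewrite invfM mulrA powRD_gt0// powR_inv1// ltW.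
Qed.

Definition polar_mass : \bar R :=
  (\int[mu]_x (polar_weight x * (rr x) `^ (- N))%:E)%E.

Lemma polar_mass_ge0 : (0 <= polar_mass)%E.
Proof.
apply: integral_ge0 => x _.
by rewrite lee_fin mulr_ge0 ?powR_ge0 ?polar_weight_ge0.
Qed.

(** In the formula of [chvar_polar] the substitution r = s rr(x) on the orbit of
    [x] separates the integral over the orbit from [x]; no space of orbits has
    to be constructed. *)
Lemma ge0_integral_radial (phi : R -> \bar R) : measurable_fun setT phi ->
  (forall r, 0 <= phi r)%E ->
  (\int[mu]_x phi (rr x) =
   polar_mass * \int[leb]_r ((ppow r (N - 1))%:E * phi r))%E.
Proof.
move=> mphi phi0; have [_ mw w0 ->] := chvar_polar; last 2 first.
- exact: (measurableT_comp mphi).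
- by move=> x; exact: phi0.
have mP : measurable_fun setT (fun x : T * R => ((ppow x.2 (N - 1) *
    polar_weight x.1)%:E * phi (rr (dil x.2 x.1)))%E).
  apply: emeasurable_funM; first exact/measurable_EFinP.
  by apply: (measurableT_comp mphi); exact: (measurableT_comp mrr).
rewrite (ge0_integral_product mu leb mP); last first.
  by move=> x; rewrite mule_ge0// lee_fin.
have mJ : measurable_fun setT (fun r => (ppow r (N - 1))%:E * phi r)%E.
  by apply: emeasurable_funM => //; apply/measurable_EFinP; exact: measurable_ppow.
have J0 r : (0 <= (ppow r (N - 1))%:E * phi r)%E.
  by rewrite mule_ge0// lee_fin ppow_ge0.
rewrite /polar_mass -ge0_integralZr//; last 3 first.
- apply/measurable_EFinP; apply: measurable_funM.
    exact: measurable_polar_weight.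
  exact: (measurableT_comp (measurable_powR (- N)) mrr).
- by move=> x _; rewrite lee_fin mulr_ge0 ?powR_ge0 ?polar_weight_ge0.
- by apply: integral_ge0 => r _.
apply: eq_integral => x _ /=; rewrite /polar_weight; case: ifP => [r1|_]; last first.
  rewrite mul0r mul0e integral0_eq// => s _.
  by rewrite mulr0 mul0e.
have rp : 0 < rr x by exact: lt_le_trans r1.
have [_ _ _ cE] := chvar_scale rp; rewrite (cE _ mJ J0).
have mJ' : measurable_fun [set: measurableTypeR R] (fun s => (rr x)%:E *
    ((ppow (rr x * s)%R (N - 1))%:E * phi (rr x * s)%R))%E.
  by apply: emeasurable_funM => //; apply: (measurableT_comp mJ).
transitivity (\int[leb]_s (((rr x)^-1 * rr x `^ (- N))%:E * ((rr x)%:E *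
    ((ppow (rr x * s)%R (N - 1))%:E * phi (rr x * s)%R))))%E; last first.
  rewrite [LHS](ge0_integralZl_EFin _ measurableT _ mJ')//.
    by move=> s _; rewrite mule_ge0// lee_fin ltW.
  by rewrite mulr_ge0 ?invr_ge0 ?powR_ge0.
apply: eq_integral => s _; case: (ltrP 0 s) => s0; last first.
  by rewrite !ppow_le0 ?pmulr_rle0// mul0r !mul0e !mule0.
rewrite rr_dil// ppowM// !muleA -!EFinM [s * rr x]mulrC; congr (_%:E * _)%E.
have E : rr x `^ (- N) * (rr x * rr x `^ (N - 1)) = 1.
  transitivity (rr x `^ (- N) * (rr x `^ 1 * rr x `^ (N - 1))).
    by rewrite powRr1 ?ltW.
  rewrite -!powRD_gt0//; by rewrite (_ : - N + (1 + (N - 1)) = 0) ?powRr0//; ring.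
transitivity ((rr x)^-1 * (rr x `^ (- N) * (rr x * rr x `^ (N - 1))) *
  ppow s (N - 1)); first by rewrite E mulr1 mulrC.
by ring.
Qed.

End polar.

(** * The Gamma function *)

Section half_line.
Context {R : realType}.
Let leb := (@lebesgue_measure R).

Lemma chvar_opp : chvar leb leb (-%R : R -> R) (fun=> 1).
Proof.
have mN : measurable_fun setT (-%R : measurableTypeR R -> measurableTypeR R).
  exact: oppr_measurable.
split=> // h mh h0.
rewrite (@eq_measure_integral _ _ _ setT (pushforward leb (-%R : measurableTypeR R -> measurableTypeR R))); last first.
  by move=> A mA _; exact/esym/lebesgue_measureN.
rewrite ge0_integral_pushforward// preimage_setT.
by under [RHS]eq_integral do rewrite mul1e.
Qed.

Lemma ge0_integral_even (f : R -> R) : measurable_fun setT f ->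
  (forall x, 0 <= f x) ->
  (\int[leb]_x (f `|x|)%:E =
   2%:E * \int[leb]_x (if 0 < x then f x else 0)%:E)%E.
Proof.
move=> mf f0; pose g x := if 0 < x then f x else 0.
have g0 x : 0 <= g x by rewrite /g; case: ifP.
have mg : measurable_fun [set: measurableTypeR R] (EFin \o g).
  by apply/measurable_EFinP; apply: mifR => //; exact: measurable_fun_ltr.
have [_ _ _ E] := chvar_opp.
have mgN : measurable_fun [set: measurableTypeR R] (fun x => (g (- x))%:E).
  by apply: (measurableT_comp mg); exact: oppr_measurable.
transitivity (\int[leb]_x ((g x)%:E + (g (- x))%:E))%E.
  apply: ge0_ae_eq_integral => //.
  - by apply/measurable_EFinP; apply: (measurableT_comp mf); exact: normr_measurable.
  - exact: emeasurable_funD.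
  - by move=> x _; rewrite lee_fin.
  - by move=> x _; rewrite adde_ge0// lee_fin.
  - exists [set 0]; split => //; first exact: lebesgue_measure_set1.
    move=> x /= H; apply: contrapT => /eqP x0; apply: H => _.
    rewrite -EFinD /g oppr_gt0.
    case: (ltrgtP x 0) x0 => [x0|x0|->] //; rewrite ?eqxx// => _.
    + by rewrite add0r ltr0_norm.
    + by rewrite addr0 gtr0_norm.
rewrite ge0_integralD//; last 2 first.
- by move=> x _; rewrite lee_fin.
- by move=> x _; rewrite lee_fin.
rewrite [in RHS](_ : 2%:E = 1 + 1)%E ?ge0_muleDl ?mul1e//.
rewrite [X in _ = (_ + X)%E](E (EFin \o g) mg)//.
by under [in RHS]eq_integral do rewrite mul1e.
Qed.

Lemma integral_half_line (f : R -> R) : measurable_fun setT f ->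
  (\int[leb]_(x in `[0%R, +oo[) (f x)%:E =
   \int[leb]_x (if 0 < x then f x else 0)%:E)%E.
Proof.
move=> mf; rewrite -integral_itv_obnd_cbnd; last first.
  by apply: measurable_funTS; exact/measurable_EFinP.
rewrite integral_mkcond; apply: eq_integral => x _.
by rewrite patchE mem_setE in_itv/= andbT; case: ifP.
Qed.

Lemma derivable_continuous (f : R -> R) x : derivable f x 1 ->
  {for x, continuous f}.
Proof. by move=> /derivable1_diffP/differentiable_continuous. Qed.

Lemma integral_expRN : (\int[leb]_x (if (0 < x)%R then expR (- x) else 0)%:E = 1)%E.
Proof.
rewrite -integral_half_line; last first.
  apply: continuous_measurable_fun => x; apply: continuous_comp.
    exact: continuousN.
  exact: continuous_expR.
rewrite (@ge0_continuous_FTC2y _ (fun x => expR (- x)) (fun x => - expR (- x)) 0 0).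
- by rewrite oppr0 expR0 EFinN oppeK add0e.
- by move=> x _; exact: expR_ge0.
- apply: continuous_subspaceT => x; apply: continuous_comp.
    exact: continuousN.
  exact: continuous_expR.
- rewrite -oppr0; apply: cvgN; exact: cvgr_expR.
- by move=> x _; apply: ex_derive.
- apply: cvg_at_right_filter.
  by apply: (derivable_continuous (f := fun x => - expR (- x))); apply: ex_derive.
- by move=> x _; rewrite derive1E derive_val; rewrite /GRing.scale/=; ring.
Qed.

Lemma integral_x_gauss :
  (\int[leb]_x (if (0 < x)%R then x * expR (- x ^+ 2) else 0)%:E = (2^-1)%:E)%E.
Proof.
have d1 (x : R) : derivable (fun y : R => y * expR (- y ^+ 2)) x 1 by apply: ex_derive.
have d2 (x : R) : derivable (fun y : R => - 2^-1 * expR (- y ^+ 2)) x 1 by apply: ex_derive.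
rewrite -integral_half_line; last first.
  by apply: continuous_measurable_fun => x; exact: derivable_continuous.
rewrite (@ge0_continuous_FTC2y _ (fun x => x * expR (- x ^+ 2))
  (fun x => - 2^-1 * expR (- x ^+ 2)) 0 0).
- by rewrite expr0n oppr0 expR0 mulr1 EFinN oppeK add0e.
- by move=> x x0; rewrite mulr_ge0// expR_ge0.
- by apply: continuous_subspaceT => x; exact: derivable_continuous.
- rewrite -[X in _ --> X](mulr0 (- 2^-1)); exact: (cvgM (cvg_cst _) (@cvg_gauss_fun R)).
- by [].
- by apply: cvg_at_right_filter; exact: (derivable_continuous (d2 0)).
- by move=> x _; rewrite derive1E derive_val; rewrite /GRing.scale/=; field.
Qed.

Lemma integral_oneDsqrV_lty :
  (\int[leb]_x ((1 + `|x| ^+ 2)^-1)%:E < +oo)%E.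
Proof.
pose f (x : R) := (1 + x ^+ 2)^-1.
have f0 x : 0 <= f x by rewrite invr_ge0 addr_ge0// sqr_ge0.
have d1 (x : R) : derivable f x 1.
  apply: (@derivableV _ _ (fun y : R => 1 + y ^+ 2)).
    by rewrite gt_eqF// ltr_wpDr// sqr_ge0.
  by apply: ex_derive.
have mf : measurable_fun setT f.
  by apply: continuous_measurable_fun => x; exact: derivable_continuous.
have fin : (\int[leb]_x (if (0 < x)%R then f x else 0)%:E < +oo)%E.
  rewrite -integral_half_line// (@ge0_continuous_FTC2y _ f atan 0 (pi / 2)).
  - by rewrite -EFinB ltry.
  - by [].
  - by apply: continuous_subspaceT => x; exact: derivable_continuous.
  - exact: cvgy_atan.
  - by move=> x _; exact: derivable_atan.
  - by apply: cvg_at_right_filter; exact: continuous_atan.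
  - by move=> x _; rewrite derive1_atan.
rewrite (ge0_integral_even (f := f))//.
by rewrite lte_mul_pinfty.
Qed.

End half_line.

Section gamma.
Context {R : realType}.
Let leb := (@lebesgue_measure R).

(** The dilations [x |-> s^N x] of the line turn [|x|^(1/N)] into a homogeneous
    function; this is the substitution [r = |x|^(1/N)] up to a constant. *)
Lemma ge0_integral_power (N : R) : 0 < N ->
  exists2 A : \bar R, (0 < A)%E & forall phi : R -> \bar R,
    measurable_fun setT phi -> (forall r, 0 <= phi r)%E ->
    (\int[leb]_x phi (`|x| `^ N^-1)%R =
     A * \int[leb]_r ((ppow r (N - 1))%:E * phi r))%E.
Proof.
move=> N0.
pose rr (x : R) := `|x| `^ N^-1.
pose dil (s x : R) := s `^ N * x.
have mrr : measurable_fun [set: measurableTypeR R] rr.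
  apply: (measurableT_comp (measurable_powR _)).
  exact: normr_measurable.
have mdil : measurable_fun [set: measurableTypeR R * R] (fun x => dil x.2 x.1).
  apply: measurable_funM; last exact: measurable_fst.
  by apply: (measurableT_comp (measurable_powR _)); exact: measurable_snd.
have dilP s : 0 < s -> chvar leb leb (dil s) (fun=> s `^ N).
  by move=> s0; apply: chvar_scale; rewrite powR_gt0.
have rr0 x : 0 <= rr x by exact: powR_ge0.
have rrd s x : 0 < s -> rr (dil s x) = s * rr x.
  move=> s0; rewrite /rr /dil normrM powRM//.
  by rewrite ger0_norm ?powR_ge0// -powRrM mulfV ?gt_eqF// powRr1// ltW.
have rrn : leb [set x | rr x = 0] = 0%E.
  rewrite (_ : [set x | rr x = 0] = [set 0]); first exact: lebesgue_measure_set1.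
  apply/seteqP; split => x /=.
    by move/powR_eq0_eq0/eqP; rewrite normr_eq0 => /eqP.
  by move=> ->; rewrite /rr normr0 powR0// invr_eq0 gt_eqF.
have H := ge0_integral_radial mdil dilP mrr rr0 rrd rrn.
exists (polar_mass leb N rr) => //.
rewrite lt0e (polar_mass_ge0 leb N rr0) andbT; apply/negP => /eqP A0.
have := H (fun=> 1%E) (measurable_cst _) (fun=> lee01).
rewrite A0 mul0e integral_cst// mul1e => lT.
have : (leb `[0%R, 1%R]%classic <= 0)%E.
  by rewrite -lT; apply: le_measure; rewrite ?inE.
by rewrite /leb lebesgue_measure_itv/= lte01 sube0 leNgt lte01.
Qed.

Definition gamma_int (x : R) (t : R) : R := ppow t (x - 1) * expR (- t).

Lemma measurable_expRN : measurable_fun setT (fun t : R => expR (- t)).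
Proof. by apply: (measurableT_comp (@measurable_expR R)); exact: oppr_measurable. Qed.

Lemma measurable_gamma_int x : measurable_fun setT (gamma_int x).
Proof.
by apply: measurable_funM; [exact: measurable_ppow|exact: measurable_expRN].
Qed.

Lemma gamma_int_ge0 x t : 0 <= gamma_int x t.
Proof. by rewrite mulr_ge0 ?ppow_ge0 ?expR_ge0. Qed.

(** An integrable majorant, from e^(-u) <= k! / u^k with k at least 2N. *)
Let expRN_bound (N : R) : 0 < N -> exists C : R,
  0 <= C /\ forall x : R, expR (- (`|x| `^ N^-1)) <= C * (1 + `|x| ^+ 2)^-1.
Proof.
move=> N0; pose k := (Num.bound (2 * N)).+1.
have kN : 2 <= k%:R / N :> R.
  rewrite ler_pdivlMr// (le_trans (ltW (archi_boundP _)))// ?ler_nat//.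
  by rewrite mulr_ge0// ltW.
exists (2 * k`!%:R); split; first by rewrite mulr_ge0.
move=> x; have den : 0 < 1 + `|x| ^+ 2 by rewrite ltr_wpDr// sqr_ge0.
rewrite ler_pdivlMr//.
have k1 : 1 <= k`!%:R :> R by rewrite ler1n fact_gt0.
have e0 : 0 <= expR (- `|x| `^ N^-1) by exact: expR_ge0.
have [x1|x1] := leP `|x| 1.
  have E1 : expR (- `|x| `^ N^-1) <= 1 by rewrite expR_le1 oppr_le0 powR_ge0.
  have : `|x| ^+ 2 <= 1 by rewrite expr_le1.
  nra.
have Hk : `|x| ^+ 2 / k`!%:R <= expR (`|x| `^ N^-1).
  apply: le_trans (_ : 1 + (`|x| `^ N^-1) ^+ k / k`!%:R <= _); last first.
    exact: expR_ge1Dxn (powR_ge0 _ _).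
  rewrite -[X in 1 + X / _]powR_mulrn ?powR_ge0// -powRrM [N^-1 * _]mulrC.
  apply: (@le_trans _ _ (`|x| `^ (k%:R / N) / k`!%:R)); last by rewrite lerDr.
  by rewrite ler_wpM2r ?invr_ge0// -powR_mulrn// ler_powR// ltW.
have e1 : expR (- `|x| `^ N^-1) * expR (`|x| `^ N^-1) = 1.
  by rewrite -expRD addNr expR0.
have x2 : 1 <= `|x| ^+ 2 by rewrite exprn_ege1// ltW.
have Hk2 : `|x| ^+ 2 <= expR (`|x| `^ N^-1) * k`!%:R.
  by rewrite -ler_pdivrMr// (lt_le_trans ltr01).
nra.
Qed.

Lemma gamma_int_lty x : 0 < x -> (\int[leb]_t (gamma_int x t)%:E < +oo)%E.
Proof.
move=> x0; have [A A0 H] := ge0_integral_power x0.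
have [C [C0 Cb]] := expRN_bound x0.
have /(_ (fun t => (expR (- t))%:E)) E := H _.
have mE : measurable_fun [set: R] (fun t : R => (expR (- t))%:E).
  by apply/measurable_EFinP; exact: measurable_expRN.
have {}E := E mE (fun t => expR_ge0 (- t)).
have : (A * \int[leb]_t (gamma_int x t)%:E < +oo)%E.
  rewrite -E; apply: (@le_lt_trans _ _ (C%:E * \int[leb]_x ((1 + `|x| ^+ 2)^-1)%:E)%E).
    rewrite -ge0_integralZl_EFin//.
    - apply: ge0_le_integral_nonmeas => y; first by rewrite lee_fin expR_ge0.
      by rewrite -EFinM lee_fin.
    - apply/measurable_EFinP; apply: mVR; apply: measurable_funD => //.
      by apply: measurable_funX; exact: normr_measurable.
  by rewrite lte_mul_pinfty// integral_oneDsqrV_lty.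
case: (ltgtP (\int[leb]_t (gamma_int x t)%:E) +oo)%E => // [|->]; first by rewrite ltNge leey.
by rewrite gt0_muley.
Qed.

Lemma Gamma_ppow x : 0 < x -> (\int[leb]_t (gamma_int x t)%:E)%E = (Gamma x)%:E.
Proof.
move=> x0; rewrite /Gamma Rintegral_mkcond /Rintegral fineK.
  apply: eq_integral => t _; rewrite patchE mem_setE in_itv/= andbT.
  by rewrite /gamma_int /ppow; case: ifP; rewrite ?mul0r.
rewrite (_ : \int[_]_t _ = \int[leb]_t (gamma_int x t)%:E)%E.
  rewrite ge0_fin_numE ?gamma_int_lty//.
  by apply: integral_ge0 => t _; rewrite lee_fin gamma_int_ge0.
apply: eq_integral => t _; rewrite patchE mem_setE in_itv/= andbT.
by rewrite /gamma_int /ppow; case: ifP; rewrite ?mul0r.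
Qed.

Lemma Gamma_gt0 x : 0 < x -> 0 < Gamma x :> R.
Proof.
move=> x0; rewrite -lte_fin -Gamma_ppow// lt0e; apply/andP; split; last first.
  by apply: integral_ge0 => t _; rewrite lee_fin gamma_int_ge0.
apply/negP => /eqP G0.
have mg : measurable_fun [set: measurableTypeR R] (EFin \o gamma_int x).
  by apply/measurable_EFinP; exact: measurable_gamma_int.
have : (\int[leb]_t `|(gamma_int x t)%:E| = 0)%E.
  by under eq_integral do rewrite gee0_abs ?lee_fin ?gamma_int_ge0//.
move=> /(ae_eq_integral_abs leb measurableT mg)[Z [mZ Z0 sub]].
have S : `]0%R, 1%R]%classic `<=` Z.
  move=> t /=; rewrite in_itv/= => /andP[t0 _]; apply: sub => /= /(_ I)[].
  move/eqP; rewrite /gamma_int ppow_gt0// mulf_eq0 gt_eqF ?powR_gt0//.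
  by rewrite gt_eqF ?expR_gt0.
have : (leb `]0%R, 1%R]%classic <= 0)%E.
  by rewrite -Z0; apply: le_measure => //; rewrite inE.
by rewrite /leb lebesgue_measure_itv/= lte01 sube0 leNgt lte01.
Qed.

Lemma Gamma1 : Gamma 1 = 1 :> R.
Proof.
apply: EFin_inj; rewrite -Gamma_ppow// -[RHS](@integral_expRN R).
apply: eq_integral => t _; rewrite /gamma_int /ppow subrr powRr0.
by case: ifP; rewrite ?mul1r ?mul0r.
Qed.

End gamma.

(** * The Gamma integral along complex rays *)

Section gamma_ray.
Context {R : realType}.
Let leb := (@lebesgue_measure R).

Lemma gamma_scale (b m : R) : 0 < b -> 0 < m ->
  (\int[leb]_s (ppow s (b - 1) * expR (- (m * s)))%:E =
   (Gamma b * m `^ (- b))%:E)%E.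
Proof.
move=> b0 m0; have [_ _ _ E] := chvar_scale m0.
have mg : measurable_fun [set: measurableTypeR R] (EFin \o gamma_int b).
  by apply/measurable_EFinP; exact: measurable_gamma_int.
have g0 x : (0 <= (EFin \o gamma_int b) x)%E by rewrite lee_fin gamma_int_ge0.
have := E _ mg g0; rewrite Gamma_ppow// => {}E.
have mi : measurable_fun [set: measurableTypeR R]
    (fun s => (ppow s (b - 1) * expR (- (m * s)))%:E).
  apply/measurable_EFinP; apply: measurable_funM; first exact: measurable_ppow.
  by apply: (measurableT_comp (@measurable_expRN R)); exact: mulrl_measurable.
rewrite mulrC EFinM E -[RHS](ge0_integralZl_EFin _ measurableT); last 3 first.
- by move=> s _; rewrite mule_ge0// lee_fin// ltW.
- apply: emeasurable_funM => //; apply: (measurableT_comp mg).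
  exact: mulrl_measurable.
- exact: powR_ge0.
apply: eq_integral => s _; rewrite -!EFinM; congr EFin.
rewrite /gamma_int ppowM// !mulrA; congr (_ * _).
rewrite -[LHS]mul1r; congr (_ * _).
transitivity (m `^ (- b) * m `^ 1 * m `^ (b - 1)); last by rewrite powRr1 ?ltW.
by rewrite -!powRD_gt0// (_ : - b + 1 + (b - 1) = 0) ?powRr0//; ring.
Qed.

Lemma gamma_scale_integrable (b m : R) : 0 < b -> 0 < m ->
  leb.-integrable setT (EFin \o (fun s => ppow s (b - 1) * expR (- (m * s)))).
Proof.
move=> b0 m0; apply/integrableP; split.
  apply/measurable_EFinP; apply: measurable_funM; first exact: measurable_ppow.
  by apply: (measurableT_comp (@measurable_expRN R)); exact: mulrl_measurable.
under eq_integral do rewrite /= ger0_norm ?mulr_ge0 ?ppow_ge0 ?expR_ge0//.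
by rewrite gamma_scale// ltry.
Qed.

(** The real part of e^(-i th) s^(b-1) e^(-s(x + i y)); the phase [th] lets the
    imaginary part be treated by the same lemmas. *)
Definition ray_fun (b x y th s : R) : R :=
  ppow s (b - 1) * (expR (- (x * s)) * cos (y * s + th)).

Lemma measurable_ray_fun b x y th : measurable_fun setT (ray_fun b x y th).
Proof.
apply: measurable_funM; first exact: measurable_ppow.
apply: measurable_funM.
  by apply: (measurableT_comp (@measurable_expRN R)); exact: mulrl_measurable.
have mc : measurable_fun setT (@cos R).
  by apply: continuous_measurable_fun; exact: continuous_cos.
by apply: (measurableT_comp mc); apply: measurable_funD => //; exact: mulrl_measurable.
Qed.

Lemma ray_fun_integrable b x y th : 0 < b -> 0 < x ->
  leb.-integrable setT (EFin \o ray_fun b x y th).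
Proof.
move=> b0 x0; apply: le_integrable (gamma_scale_integrable b0 x0) => //.
  by apply/measurable_EFinP; exact: measurable_ray_fun.
move=> s _ /=; rewrite lee_fin /ray_fun normrM ger0_norm ?ppow_ge0//.
rewrite [leRHS]ger0_norm ?mulr_ge0 ?ppow_ge0 ?expR_ge0//.
rewrite ler_wpM2l ?ppow_ge0// normrM ger0_norm ?expR_ge0//.
by rewrite ler_piMr ?expR_ge0// cos_max.
Qed.

Lemma mulr_ray_fun b x y th s : s * ray_fun b x y th s = ray_fun (b + 1) x y th s.
Proof.
rewrite /ray_fun mulrA; congr (_ * _); case: (ltrP 0 s) => s0; last first.
  by rewrite !ppow_le0// mulr0.
rewrite !ppow_gt0// -[X in X * _]powRr1 ?ltW// -powRD_gt0//.
by congr (_ `^ _); ring.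
Qed.

Definition ray_int (b x y th : R) : R := \int[leb]_s ray_fun b x y th s.

(** Differentiation under the integral sign brings down the factor
    -s(x' + i y'): its [s] raises [b] by one, and its [i] turns the phase by a
    right angle. *)
Lemma is_derive_ray_int (b th u v a m M : R) (x y x' y' : R -> R) :
  0 < b -> u < a < v -> 0 < m ->
  (forall t, u < t < v -> is_derive t 1 x (x' t)) ->
  (forall t, u < t < v -> is_derive t 1 y (y' t)) ->
  (forall t, u < t < v -> m <= x t) ->
  (forall t, u < t < v -> `|x' t| + `|y' t| <= M) ->
  is_derive a 1 (fun t => ray_int b (x t) (y t) th)
    (- (x' a * ray_int (b + 1) (x a) (y a) th +
        y' a * ray_int (b + 1) (x a) (y a) (th - pi / 2))).
Proof.
move=> b0 Ia m0 dx dy xm xyM.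
have sinE z : sin (z : R) = cos (z - pi / 2).
  by rewrite -(sinDpihalf (z - pi / 2)) subrK.
have M0 : 0 <= M by apply: le_trans (xyM _ Ia); rewrite addr_ge0.
pose f (t s : R) : R := ray_fun b (x t) (y t) th s.
pose df (t s : R) : R := - s * (x' t * ray_fun b (x t) (y t) th s +
  y' t * ray_fun b (x t) (y t) (th - pi / 2) s).
have fd t s : u < t < v -> is_derive t 1 (f^~ s) (df t s).
  move=> It; have := dx t It; have := dy t It => dyt dxt.
  rewrite /f /ray_fun; apply: is_derive_eq.
  rewrite /df /ray_fun /GRing.scale /= addrA -sinE; ring.
pose G s : R := M * (ppow s (b + 1 - 1) * expR (- (m * s))).
have Ia' : `]u, v[%classic a by rewrite /= in_itv.
have b1 : 0 < b + 1 by rewrite addr_gt0.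
have iG : leb.-integrable setT (EFin \o G).
  exact: (integrableZl measurableT M (gamma_scale_integrable b1 m0)).
have G0 s : 0 <= G s by rewrite !mulr_ge0 ?ppow_ge0 ?expR_ge0.
have If t : `]u, v[%classic t -> leb.-integrable setT (EFin \o f t).
  rewrite /= in_itv/= => It; apply: ray_fun_integrable => //.
  exact: lt_le_trans (xm _ It).
have d1f t s : `]u, v[%classic t -> partial1of2 f t s = df t s.
  rewrite /= in_itv/= => It; rewrite partial1of2E.
  by have := fd t s It => ?; rewrite derive_val.
have Df t s : `]u, v[%classic t -> setT s -> derivable (f ^~ s) t 1.
  by rewrite /= in_itv/= => It _; have := fd t s It => -[].
have Gb t s : `]u, v[%classic t -> setT s -> `|partial1of2 f t s| <= G s.
  move=> It _; rewrite d1f//; move: It; rewrite /= in_itv/= => It.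
  rewrite /df /G; case: (ltrP 0 s) => s0; last first.
    by rewrite /ray_fun !ppow_le0// !mul0r !mulr0 addr0 mulr0 normr0.
  have rb (th' : R) : `|ray_fun b (x t) (y t) th' s| <= ppow s (b - 1) * expR (- (m * s)).
    rewrite /ray_fun normrM ger0_norm ?ppow_ge0// ler_wpM2l ?ppow_ge0//.
    rewrite normrM ger0_norm ?expR_ge0// (le_trans (ler_piMr _ (cos_max _))) ?expR_ge0//.
    by rewrite ler_expR lerN2; apply: ler_wpM2r (ltW s0) _ _ (xm t It).
  have -> : ppow s (b + 1 - 1) = s * ppow s (b - 1).
    rewrite !ppow_gt0// -[X in X * _]powRr1 ?ltW// -powRD_gt0//; congr (_ `^ _); ring.
  rewrite normrM normrN (gtr0_norm s0) -[s * ppow _ _ * _]mulrA [leRHS]mulrCA.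
  apply: (ler_wpM2l (ltW s0)).
  set P := ppow s (b - 1) * expR (- (m * s)) in rb *; have P0 : 0 <= P by rewrite mulr_ge0 ?ppow_ge0 ?expR_ge0.
  apply: (le_trans (ler_normD _ _)).
  rewrite (normrM (x' t)) (normrM (y' t)).
  apply: (@le_trans _ _ (`|x' t| * P + `|y' t| * P)).
    by apply: lerD; apply: ler_wpM2l => //; exact: rb.
  by rewrite -mulrDl; apply: (ler_wpM2r P0); exact: xyM.
apply: DeriveDef.
  exact: (derivable_under_integral measurableT Ia' If Df G0 iG Gb).
rewrite -derive1E; have -> := differentiation_under_integral measurableT Ia' If Df G0 iG Gb.
have xa : 0 < x a by exact: lt_le_trans (xm _ Ia).
transitivity (\int[leb]_s (- x' a * ray_fun (b + 1) (x a) (y a) th s +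
  - y' a * ray_fun (b + 1) (x a) (y a) (th - pi / 2) s)).
  by apply: eq_Rintegral => s _; rewrite d1f// /df -!mulr_ray_fun; ring.
rewrite RintegralD//; last 2 first.
- exact: (integrableZl measurableT _ (ray_fun_integrable _ _ b1 xa)).
- exact: (integrableZl measurableT _ (ray_fun_integrable _ _ b1 xa)).
rewrite !RintegralZl//; try exact: ray_fun_integrable.
by rewrite opprD !mulNr.
Qed.

Lemma ray_int_scale b x y th l : 0 < b -> 0 < x -> 0 < l ->
  ray_int b (l * x) (l * y) th = l `^ (- b) * ray_int b x y th.
Proof.
move=> b0 x0 l0; rewrite [in RHS]/ray_int (chvar_Rint (chvar_scale l0)); last first.
  exact: ray_fun_integrable.
rewrite (_ : \int[_]_s _ = \int[leb]_s (l `^ b * ray_fun b (l * x) (l * y) th s)).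
  rewrite RintegralZl//; last by apply: ray_fun_integrable; rewrite ?mulr_gt0.
  by rewrite mulrA -powRD_gt0// addNr powRr0 mul1r.
apply: eq_Rintegral => s _; rewrite /ray_fun ppowM//.
have -> : x * (l * s) = l * x * s by ring.
have -> : y * (l * s) = l * y * s by ring.
rewrite !mulrA; congr (_ * _ * _ * _).
by rewrite -[X in X * _](powRr1 (ltW l0)) -powRD_gt0//; congr (_ `^ _); ring.
Qed.

Lemma is_derive_powR_1 (b : R) :
  is_derive (1 : R) (1 : R) (fun l : R => l `^ b) b.
Proof.
apply: DeriveDef; first by apply: derivable_powR; rewrite in_itv/= ltr01.
by rewrite -derive1E powR_derive1 ?in_itv/= ?ltr01// powR1 mulr1.
Qed.

(** Homogeneity along a real ray, differentiated at [1], replaces an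
    integration by parts. *)
Lemma ray_int_radial b x y th : 0 < b -> 0 < x ->
  x * ray_int (b + 1) x y th + y * ray_int (b + 1) x y (th - pi / 2) =
  b * ray_int b x y th.
Proof.
move=> b0 x0.
have I1 : 2^-1 < (1 : R) < 2 by apply/andP; split; lra.
have m0 : 0 < 2^-1 * x by rewrite mulr_gt0.
have D := @is_derive_ray_int b th 2^-1 2 1 (2^-1 * x) (`|x| + `|y|)
  (fun l => l * x) (fun l => l * y) (fun=> x) (fun=> y) b0 I1 m0.
have dl (z t : R) : 2^-1 < t < 2 -> is_derive t 1 (fun l : R => l * z) z.
  by move=> _; apply: is_derive_eq; rewrite /GRing.scale/= mulr0 add0r mulr1.
have {}D := D (dl x) (dl y).
have {}D : is_derive (1 : R) 1 (fun t => ray_int b (t * x) (t * y) th)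
  (- (x * ray_int (b + 1) x y th + y * ray_int (b + 1) x y (th - pi / 2))).
  rewrite -[X in ray_int _ X _ th]mul1r -[X in ray_int _ _ X th]mul1r.
  rewrite -[X in ray_int _ X _ (_ - _)]mul1r -[X in ray_int _ _ X (_ - _)]mul1r.
  apply: D => // t /andP[t1 _].
  by rewrite ler_wpM2r// ltW.
have D2 : is_derive (1 : R) 1 (fun t => ray_int b (t * x) (t * y) th)
    (- b * ray_int b x y th).
  apply: (@near_eq_is_derive _ _ _ (fun t : R => t `^ (- b) * ray_int b x y th)).
    near=> t; rewrite ray_int_scale//.
    by near: t; exact: lt_nbhsr ltr01.
  have := is_derive_powR_1 (- b) => d1; apply: is_derive_eq.
  by rewrite /GRing.scale/= mulr0 add0r mulrC.
apply: oppr_inj; transitivity (- b * ray_int b x y th); last by rewrite mulNr.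
by have [_ <-] := D; have [_ <-] := D2.
Unshelve. all: by end_near. Qed.

Definition Rth b th (a : R) := ray_int b (cos a) (sin a) th.

Let cosDpihalfE (z : R) : cos (z + pi / 2) = - cos (z - pi / 2).
Proof. by rewrite cosDpihalf -(sinDpihalf (z - pi / 2)) subrK. Qed.

Let ray_int_shift b x y th : 0 < b -> 0 < x ->
  ray_int b x y (th + pi / 2) = - ray_int b x y (th - pi / 2).
Proof.
move=> b0 x0; rewrite -mulN1r /ray_int -RintegralZl//; last exact: ray_fun_integrable.
apply: eq_Rintegral => s _.
by rewrite /ray_fun !addrA cosDpihalfE mulN1r !mulrN.
Qed.

Let is_derive_Rth b th (a : R) : 0 < b -> `|a| < pi / 2 ->
  is_derive a 1 (Rth b th) (b * Rth b (th + pi / 2) a).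
Proof.
move=> b0 api; pose w := (`|a| + pi / 2) / 2.
have wa : `|a| < w by rewrite /w; lra.
have wp : w < pi / 2 by rewrite /w; lra.
have w0 : 0 <= w by apply: le_trans (ltW wa).
have Ia : - w < a < w by rewrite -ltr_norml.
have P := @pi_gt0 R.
have cw : 0 < cos w by apply: cos_gt0_pihalf; rewrite wp andbT; lra.
have cosw t : - w < t < w -> cos w <= cos t.
  rewrite -ltr_norml => tw; rewrite -(cos_norm t); apply: ltW.
  have i1 : w \in `[0, pi] by rewrite in_itv/=; apply/andP; split; lra.
  have i2 : `|t| \in `[0, pi] by rewrite in_itv/=; apply/andP; split => //; lra.
  by rewrite (ltr_cos i2 i1).
have ca : 0 < cos a by rewrite (lt_le_trans cw) ?cosw.
have D := @is_derive_ray_int b th (- w) w a (cos w) 2 cos sin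
  (fun t => - sin t) cos b0 Ia cw (fun t _ => is_derive_cos t)
  (fun t _ => is_derive_sin t) cosw.
have Mb t : - w < t < w -> `|- sin t| + `|cos t| <= 2 :> R.
  by move=> _; rewrite normrN; have := sin_max t; have := cos_max t; lra.
have {}D := D Mb; apply: (is_derive_eq D).
rewrite /Rth -ray_int_radial// ray_int_shift ?addr_gt0// addrK; ring.
Qed.

Lemma Rth0 b th : 0 < b -> Rth b th 0 = Gamma b * cos th.
Proof.
move=> b0; rewrite /Rth cos0 sin0 /ray_int.
have := gamma_scale b0 ltr01; rewrite powR1 mulr1 => H.
transitivity (\int[leb]_s (ppow s (b - 1) * expR (- (1 * s)) * cos th)).
  by apply: eq_Rintegral => s _; rewrite /ray_fun mul0r add0r mulrA.
by rewrite RintegralZr//; [rewrite /Rintegral H|exact: gamma_scale_integrable].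
Qed.

(** By [ray_int_radial], the integral E(a) along the ray of angle [a] satisfies
    E' = -i b E. Hence its real and imaginary parts, turned back by the angle
    [b * a], are constant: they are the functions [X] and [Y] of the proof. *)
Lemma Rth_polar b (a : R) : 0 < b -> `|a| < pi / 2 ->
  Rth b 0 a = Gamma b * cos (b * a) /\ Rth b (- (pi / 2)) a = Gamma b * sin (b * a).
Proof.
move=> b0 api.
pose c := Rth b 0; pose d := Rth b (- (pi / 2)).
have dc (t : R) : `|t| < pi / 2 -> is_derive t 1 c (- b * d t).
  move=> tpi; apply: (is_derive_eq (is_derive_Rth 0 b0 tpi)).
  rewrite /d /Rth ray_int_shift// ?add0r ?mulrN ?mulNr//.
  by apply: cos_gt0_pihalf; rewrite -ltr_norml.
have dd (t : R) : `|t| < pi / 2 -> is_derive t 1 d (b * c t).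
  move=> tpi; apply: (is_derive_eq (is_derive_Rth (- (pi / 2)) b0 tpi)).
  by rewrite addNr.
pose X t := c t * cos (b * t) + d t * sin (b * t).
pose Y t := d t * cos (b * t) - c t * sin (b * t).
have dX (t : R) : `|t| < pi / 2 -> is_derive t 1 X 0.
  move=> tpi; have := dc t tpi; have := dd t tpi => dt ct.
  by apply: is_derive_eq; rewrite /GRing.scale/=; ring.
have dY (t : R) : `|t| < pi / 2 -> is_derive t 1 Y 0.
  move=> tpi; have := dc t tpi; have := dd t tpi => dt ct.
  by apply: is_derive_eq; rewrite /GRing.scale/=; ring.
have cst (F : R -> R) : (forall t : R, `|t| < pi / 2 -> is_derive t 1 F 0) -> F a = F 0.
  move=> dF.
  have H u v : u <= v -> `|u| < pi / 2 -> `|v| < pi / 2 -> F v = F u.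
    move=> uv up vp; have inb t : t \in `[u, v] -> `|t| < pi / 2.
      rewrite in_itv/= => /andP[ut tv]; move: up vp; rewrite !ltr_norml.
      by move=> /andP[? ?] /andP[? ?]; apply/andP; split; lra.
    have dFi t : t \in `]u, v[ -> is_derive t 1 F 0.
      by move=> ti; apply: dF; apply: inb; exact: subset_itv_oo_cc ti.
    have cF : {within `[u, v], continuous F}.
      apply: derivable_within_continuous => t ti.
      by have [] := dF t (inb _ ti).
    have [z _] := @MVT_segment R F (fun=> 0) u v uv dFi cF.
    by rewrite mul0r => /eqP; rewrite subr_eq0 => /eqP.
  have P := @pi_gt0 R; have z0 : `|0 : R| < pi / 2 by rewrite normr0; lra.
  by case: (leP 0 a) => [/H|/ltW/H] ->.
have X0 := cst X dX; have Y0 := cst Y dY.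
rewrite /X /Y !mulr0 cos0 sin0 !mulr1 !mulr0 addr0 subr0 in X0 Y0.
have c0 : c 0 = Gamma b by rewrite /c Rth0// cos0 mulr1.
have d0 : d 0 = 0 by rewrite /d Rth0// cosN cos_pihalf mulr0.
rewrite -/c -/d; rewrite c0 in X0; rewrite d0 in Y0.
have cs := cos2Dsin2 (b * a); set C := cos (b * a) in X0 Y0 cs *; set S := sin (b * a) in X0 Y0 cs *.
split; rewrite -X0.
  transitivity (c a * (C ^+ 2 + S ^+ 2) + S * (d a * C - c a * S) - S * (d a * C - c a * S)).
    by rewrite cs; ring.
  by rewrite [X in _ - S * X]Y0; ring.
transitivity (d a * (C ^+ 2 + S ^+ 2) - C * (d a * C - c a * S) + C * (d a * C - c a * S)).
  by rewrite cs; ring.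
by rewrite [X in _ + C * X]Y0; ring.
Qed.

End gamma_ray.

Section gamma_ray2.
Context {R : realType}.
Let leb := (@lebesgue_measure R).

Definition cexpN (s : R) (w : R[i]) : R[i] :=
  (expR (- (s * complex.Re w)))%:C * cis (- (s * complex.Im w)).

Lemma normc_cexpN s w : normc (cexpN s w) = expR (- (s * complex.Re w)).
Proof. by rewrite normcM normc_cis mulr1 normcR ger0_norm// expR_ge0. Qed.

Lemma cexpND s w z : cexpN s (w + z) = cexpN s w * cexpN s z.
Proof.
case: w z => [x y] [x' y']; rewrite /cexpN /= !mulrDr !opprD.
by rewrite cisD expRD rmorphM mulrACA.
Qed.

Lemma cexpNM s t w : cexpN s (t%:C * w) = cexpN (s * t) w.
Proof.
by case: w => x y; rewrite /cexpN /= !mul0r subr0 addr0 !mulrA.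
Qed.

Lemma gamma_ray_integrable b (w : R[i]) : 0 < b -> 0 < complex.Re w ->
  cintegrable leb (fun s => (ppow s (b - 1))%:C * cexpN s w).
Proof.
move=> b0 w0.
apply: (@le_cintegrable R _ (measurableTypeR R) leb _ (fun s => ppow s (b - 1) * expR (- (complex.Re w * s)))).
- apply: mMC; first by apply: mrealC; exact: measurable_ppow.
  apply: mMC.
    apply: mrealC; apply: (measurableT_comp (@measurable_expRN R)).
    exact: mulrr_measurable.
  apply: mcis; apply: measurableT_comp => //; exact: mulrr_measurable.
- move=> s; rewrite normcM normcR normc_cexpN ger0_norm ?ppow_ge0//.
  by rewrite [s * _]mulrC.
- by rewrite gamma_scale// ltry.
Qed.

(** The integral of s^(b-1) e^(-sw) is Gamma(b) w^(-b), with the principal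
    power spelled out in polar coordinates. *)
Lemma gamma_ray b r a : 0 < b -> 0 < r -> `|a| < pi / 2 ->
  cint leb (fun s => (ppow s (b - 1))%:C * cexpN s (r%:C * cis a)) =
  (Gamma b * r `^ (- b))%:C * cis (- (b * a)).
Proof.
move=> b0 r0 api.
have ca : 0 < cos a by apply: cos_gt0_pihalf; rewrite -ltr_norml.
have [E1 E2] := Rth_polar b0 api.
apply/eqP; rewrite eq_complex /= !mul0r subr0 addr0 cosN sinN.
apply/andP; split; apply/eqP.
  transitivity (ray_int b (r * cos a) (r * sin a) 0).
    apply: eq_Rintegral => s _; rewrite /ray_fun /= !mul0r !subr0 !addr0 cosN.
    by rewrite ![s * _]mulrC.
  by rewrite ray_int_scale// -/(Rth _ _ _) E1; ring.
transitivity (\int[leb]_s (- 1 * ray_fun b (r * cos a) (r * sin a) (- (pi / 2)) s)).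
  apply: eq_Rintegral => s _; rewrite /ray_fun /= !mul0r !addr0 sinN.
  have -> : cos (r * sin a * s - pi / 2) = sin (r * sin a * s).
    by rewrite -[in RHS](subrK (pi / 2) (r * sin a * s)) sinDpihalf.
  by rewrite ![s * _]mulrC; ring.
rewrite RintegralZl//; last by apply: ray_fun_integrable; rewrite ?mulr_gt0.
by rewrite -/(ray_int _ _ _ _) ray_int_scale// -/(Rth _ _ _) E2; ring.
Qed.

(** The radial identity on the positive half-line. *)
Lemma GammaS (b : R) : 0 < b -> Gamma (b + 1) = b * Gamma b.
Proof.
move=> b0; have := @ray_int_radial R b 1 0 0 b0 ltr01.
rewrite mul1r mul0r addr0; have E c : ray_int c 1 0 0 = Rth c 0 0 :> R.
  by rewrite /Rth cos0 sin0.
by rewrite !E !Rth0 ?addr_gt0// cos0 !mulr1.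
Qed.

End gamma_ray2.

#[local] Opaque Gamma.

(** * The Beta integral along complex rays *)

Section beta_ray.
Context {R : realType}.
Let leb := (@lebesgue_measure R).

Lemma le_invX (a b : R) k : 0 < a -> a <= b -> b ^- k <= a ^- k.
Proof.
move=> a0 ab; have b0 := lt_le_trans a0 ab.
by rewrite lef_pV2 ?posrE ?exprn_gt0// lerXn2r// nnegrE ltW.
Qed.

Lemma Gamma_nat (n : nat) : Gamma n.+1%:R = n`!%:R :> R.
Proof.
elim: n => [|n IH]; first by rewrite Gamma1.
by rewrite -natr1 GammaS ?ltr0n// IH factS natrM.
Qed.

Lemma cis_carg_pow (w : R[i]) (k : nat) : 0 < complex.Re w ->
  (normc w `^ (- k%:R))%:C * cis (- (k%:R * carg w)) = w ^- k.
Proof.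
move=> w0; have wn0 : w != 0 by apply: contraTneq w0 => ->; rewrite ltxx.
rewrite {3}(polar_form (ltW w0) wn0) exprMn invfM cisN mulrC [k%:R * _]mulrC cisM_nat.
rewrite [RHS]mulrC; congr (_ * _).
by rewrite powRN powR_mulrn ?normc_ge0// rmorphV ?rmorphXn//= unitfE expf_eq0 normc_eq0 (negbTE wn0) andbF.
Qed.

Lemma gamma_ray_nat (k : nat) (w : R[i]) : 0 < complex.Re w ->
  cint leb (fun s => (ppow s (k.+1%:R - 1))%:C * cexpN s w) =
  (Gamma k.+1%:R)%:C * w ^- k.+1.
Proof.
move=> w0; have wn0 : w != 0 by apply: contraTneq w0 => ->; rewrite ltxx.
have r0 := normc_gt0 wn0; have ca := carg_lt w0.
rewrite {1}(polar_form (ltW w0) wn0) gamma_ray ?ltr0n//.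
by rewrite rmorphM -mulrA cis_carg_pow.
Qed.

Variables (N : nat) (al be : R).
Hypotheses (al0 : 0 < al) (be0 : 0 < be) (NE : al + be = N.+1%:R).

Let alE1 : al - 1 = N.+1%:R - 1 - be.
Proof. by rewrite -NE addrAC addrK. Qed.

Definition beta_const : R := Gamma al * Gamma be / Gamma N.+1%:R.

(** Integrated over its second variable first, [K] gives the Beta integral;
    integrated over its first variable first, it gives a product of two Gamma
    integrals. *)
Let K (x y : R) (u : R * R) : R :=
  ppow u.1 (be - 1) * (ppow u.2 (N.+1%:R - 1) * expR (- ((u.1 * x + y) * u.2))).

Let mK x y : measurable_fun setT (K x y).
Proof.
apply: measurable_funM; first by apply: mppow; exact: measurable_fst.
apply: measurable_funM; first by apply: mppow; exact: measurable_snd.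
apply: (measurableT_comp (@measurable_expRN R)).
apply: measurable_funM; last exact: measurable_snd.
by apply: measurable_funD => //; apply: measurable_funM => //; exact: measurable_fst.
Qed.

Let K_ge0 x y u : 0 <= K x y u.
Proof. by rewrite /K !mulr_ge0 ?ppow_ge0 ?expR_ge0. Qed.

Let mK1 x y v : measurable_fun [set: measurableTypeR R]
  (fun s => (ppow s (N.+1%:R - 1) * expR (- ((v * x + y) * s)))%:E).
Proof.
apply/measurable_EFinP; apply: measurable_funM; first exact: measurable_ppow.
apply: (measurableT_comp (@measurable_expRN R)); exact: mulrl_measurable.
Qed.

Let int_K1 x y : 0 < x -> 0 < y -> (\int[product_measure leb leb]_u (K x y u)%:E =
  \int[leb]_v (Gamma N.+1%:R * (ppow v (be - 1) * (v * x + y) ^- N.+1))%:E)%E.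
Proof.
move=> x0 y0; rewrite (ge0_integral_product leb leb); last 2 first.
- by apply/measurable_EFinP; exact: mK.
- by move=> u; rewrite lee_fin K_ge0.
apply: eq_integral => v _; rewrite /K /=.
under eq_integral do rewrite EFinM.
rewrite (ge0_integralZl_EFin _ measurableT _ (mK1 x y v) (ppow_ge0 _ _)); last first.
  by move=> s _; rewrite lee_fin mulr_ge0 ?ppow_ge0 ?expR_ge0.
case: (ltrP 0 v) => v0; last by rewrite ppow_le0// mul0r mul0e mulr0.
have vxy : 0 < v * x + y by rewrite addr_gt0// mulr_gt0.
rewrite gamma_scale ?ltr0n// -EFinM; congr EFin.
by rewrite powR_invn ?ltW//; ring.
Qed.

Let int_K2 x y : 0 < x -> 0 < y -> (\int[product_measure leb leb]_u (K x y u)%:E =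
  (Gamma al * Gamma be * x `^ (- be) * y `^ (- al))%:E)%E.
Proof.
move=> x0 y0; rewrite (ge0_integral_product2 leb leb); last 2 first.
- by apply/measurable_EFinP; exact: mK.
- by move=> u; rewrite lee_fin K_ge0.
pose c := Gamma be * x `^ (- be).
have c0 : 0 <= c by rewrite mulr_ge0 ?powR_ge0// ltW// Gamma_gt0.
have mal : measurable_fun [set: measurableTypeR R]
    (fun s => (ppow s (al - 1) * expR (- (y * s)))%:E).
  apply/measurable_EFinP; apply: measurable_funM; first exact: measurable_ppow.
  apply: (measurableT_comp (@measurable_expRN R)); exact: mulrl_measurable.
transitivity (\int[leb]_s (c%:E * (ppow s (al - 1) * expR (- (y * s)))%:E))%E; last first.
  rewrite (ge0_integralZl_EFin _ measurableT _ mal c0); last first.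
    by move=> s _; rewrite lee_fin mulr_ge0 ?ppow_ge0 ?expR_ge0.
  by rewrite gamma_scale// -EFinM /c; congr EFin; move: (Gamma al) (Gamma be) => g h; ring.
apply: eq_integral => s _; rewrite /K /=.
case: (ltrP 0 s) => s0; last first.
  rewrite !ppow_le0// !mul0r mule0 integral0_eq// => v _.
  by rewrite mul0r mulr0.
have sx : 0 < s * x by rewrite mulr_gt0.
have mbe : measurable_fun [set: measurableTypeR R]
    (fun v => (ppow v (be - 1) * expR (- (s * x * v)))%:E).
  apply/measurable_EFinP; apply: measurable_funM; first exact: measurable_ppow.
  apply: (measurableT_comp (@measurable_expRN R)); exact: mulrl_measurable.
have e0 : 0 <= ppow s (N.+1%:R - 1) * expR (- (y * s)).
  by rewrite mulr_ge0 ?ppow_ge0 ?expR_ge0.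
transitivity (\int[leb]_v ((ppow s (N.+1%:R - 1) * expR (- (y * s)))%:E *
  (ppow v (be - 1) * expR (- (s * x * v)))%:E))%E.
  apply: eq_integral => v _; rewrite -EFinM; congr EFin.
  rewrite (_ : - ((v * x + y) * s) = - (y * s) + - (s * x * v)); last by ring.
  by rewrite expRD; ring.
rewrite (ge0_integralZl_EFin _ measurableT _ mbe e0); last first.
  by move=> v _; rewrite lee_fin mulr_ge0 ?ppow_ge0 ?expR_ge0.
rewrite gamma_scale// -!EFinM; congr EFin; rewrite /c !ppow_gt0//.
rewrite powRM ?ltW// alE1.
by rewrite (powRD_gt0 _ (- be) s0); ring.
Qed.

Lemma beta_ge0_scale x y : 0 < x -> 0 < y ->
  (\int[leb]_v (ppow v (be - 1) * (v * x + y) ^- N.+1)%:E =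
   (beta_const * x `^ (- be) * y `^ (- al))%:E)%E.
Proof.
move=> x0 y0; have G0 : 0 < Gamma N.+1%:R :> R by rewrite Gamma_gt0 ?ltr0n.
have := int_K1 x0 y0; rewrite int_K2// => E.
transitivity ((Gamma N.+1%:R)^-1%:E * (Gamma al * Gamma be * x `^ (- be) * y `^ (- al))%:E)%E.
  have mv : measurable_fun [set: measurableTypeR R]
      (fun v => (Gamma N.+1%:R * (ppow v (be - 1) * (v * x + y) ^- N.+1))%:E).
    apply/measurable_EFinP; apply: measurable_funM => //.
    apply: measurable_funM; first exact: measurable_ppow.
    apply: mVR; apply: measurable_funX; apply: measurable_funD => //.
    exact: mulrr_measurable.
  rewrite E -(ge0_integralZl_EFin _ measurableT _ mv) ?invr_ge0 ?ltW//; last first.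
    move=> v _; rewrite lee_fin; apply: mulr_ge0; first exact: ltW.
    case: (ltrP 0 v) => v0; last by rewrite ppow_le0// mul0r.
    apply: mulr_ge0; first exact: ppow_ge0.
    rewrite invr_ge0; apply: exprn_ge0.
    by apply: addr_ge0; [apply: mulr_ge0|]; exact: ltW.
  by apply: eq_integral => v _; rewrite -EFinM mulKf// gt_eqF.
rewrite -EFinM /beta_const; congr EFin.
by move: (Gamma al) (Gamma be) (Gamma _) => g h k; ring.
Qed.

(** The same double integral in the open right half-plane, where it converges
    absolutely by the real case. *)
Let KC (w z : R[i]) (u : R * R) : R[i] :=
  (ppow u.1 (be - 1))%:C * ((ppow u.2 (N.+1%:R - 1))%:C * cexpN u.2 ((u.1)%:C * w + z)).

Let normKC w z u : normc (KC w z u) = K (complex.Re w) (complex.Re z) u.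
Proof.
rewrite /KC /K normcM [normc (_ * cexpN _ _)]normcM normc_cexpN !normcR.
rewrite !ger0_norm ?ppow_ge0//.
case: w z => [x y] [x' y'] /=; do 2 congr (_ * _); congr expR.
by rewrite mul0r subr0 mulrC.
Qed.

Let Re_halfplane (w z : R[i]) v : 0 < complex.Re w -> 0 < complex.Re z -> 0 < v ->
  0 < complex.Re (v%:C * w + z).
Proof.
move=> Rew Rez v0; have : 0 < v * complex.Re w by rewrite mulr_gt0.
move: Rez; case: (w) (z) => [x y] [x' y'] /= *; rewrite mul0r subr0; lra.
Qed.

Let beta_halfplane_integrable (w z : R[i]) : 0 < complex.Re w -> 0 < complex.Re z ->
  cintegrable leb (fun v => (ppow v (be - 1))%:C * (v%:C * w + z) ^- N.+1).
Proof.
move=> Rew Rez.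
apply: (@le_cintegrable R _ (measurableTypeR R) leb _ (fun v => ppow v (be - 1) *
  (v * complex.Re w + complex.Re z) ^- N.+1)).
- apply: mMC; first by apply: mrealC; exact: measurable_ppow.
  apply: mVC; apply: mXC.
  exact: (mDC (mMC (mrealC (@measurable_id _ _ _)) (measurable_cst _)) (measurable_cst _)).
- move=> v; rewrite normcM normcR (ger0_norm (ppow_ge0 _ _)).
  case: (ltrP 0 v) => v0; last by rewrite (ppow_le0 _ v0) [leLHS]mul0r [leRHS]mul0r.
  have E0 : v * complex.Re w + complex.Re z = complex.Re (v%:C * w + z).
    by case: (w) (z) => [x y] [x' y'] /=; rewrite mul0r subr0.
  have R0 := Re_halfplane Rew Rez v0; have n0 := lt_le_trans R0 (Re_le_normc _).
  apply: (ler_wpM2l (ppow_ge0 _ _)); rewrite normcV normcX E0.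
  exact: (le_invX _ R0 (Re_le_normc _)).
- by rewrite (beta_ge0_scale Rew Rez) ltry.
Qed.

Let beta_ray_halfplane r1 r2 a1 a2 : 0 < r1 -> 0 < r2 ->
  `|a1| < pi / 2 -> `|a2| < pi / 2 ->
  cint leb (fun v => (ppow v (be - 1))%:C * (v%:C * (r1%:C * cis a1) + r2%:C * cis a2) ^- N.+1) =
  (beta_const * r1 `^ (- be) * r2 `^ (- al))%:C * cis (- (be * a1 + al * a2)).
Proof.
move=> r10 r20 a1pi a2pi; set w := r1%:C * cis a1; set z := r2%:C * cis a2.
have Rew : 0 < complex.Re w.
  by rewrite /= mul0r subr0 mulr_gt0// cos_gt0_pihalf// -ltr_norml.
have Rez : 0 < complex.Re z.
  by rewrite /= mul0r subr0 mulr_gt0// cos_gt0_pihalf// -ltr_norml.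
have G0 : 0 < Gamma N.+1%:R :> R by rewrite Gamma_gt0 ?ltr0n.
have iK : cintegrable (product_measure leb leb) (KC w z).
  split; last first.
    by under eq_integral do rewrite normKC; rewrite int_K2// ltry.
  apply: mMC; first by apply: mrealC; apply: mppow; exact: measurable_fst.
  apply: mMC; first by apply: mrealC; apply: mppow; exact: measurable_snd.
  have m1 : measurable_fun setT (fun u : R * R => u.1%:C * w + z).
    apply: mDC => //; apply: mMC => //; apply: mrealC; exact: measurable_fst.
  apply: mMC.
    apply: mrealC; apply: (measurableT_comp (@measurable_expRN R)).
    by apply: measurable_funM; [exact: measurable_snd|exact: mReC].
  apply: mcis; apply: measurableT_comp => //.
  by apply: measurable_funM; [exact: measurable_snd|exact: mImC].
have i0 : cintegrable leb (fun=> 0 : R[i]).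
  split => //; under eq_integral do rewrite normc0.
  by rewrite integral0.
have Revwz v : 0 < v -> 0 < complex.Re (v%:C * w + z) by exact: Re_halfplane.
have s1 v : cintegrable leb (fun s => KC w z (v, s)).
  rewrite /KC /=; case: (ltrP 0 v) => v0; last first.
    by under eq_fun do rewrite ppow_le0// mul0r.
  apply: cintegrableZ; apply: gamma_ray_integrable; rewrite ?ltr0n//.
  exact: Revwz.
have KCE v s : KC w z (v, s) = ((ppow s (N.+1%:R - 1))%:C * cexpN s z) *
    ((ppow v (be - 1))%:C * cexpN v (s%:C * w)).
  by rewrite /KC /= cexpND !cexpNM [v * s]mulrC; ring.
have Resw s : 0 < s -> 0 < complex.Re (s%:C * w).
  by move: Rew; case: (w) => [x y] /= *; rewrite mul0r subr0 mulr_gt0.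
have s2 s : cintegrable leb (fun v => KC w z (v, s)).
  under eq_fun do rewrite KCE.
  case: (ltrP 0 s) => s0; last first.
    by under eq_fun do rewrite ppow_le0// !mul0r.
  by apply: cintegrableZ; apply: gamma_ray_integrable => //; exact: Resw.
have := cint_fubini1 iK s1; rewrite (cint_fubini2 iK s2) => E.
pose g v := (ppow v (be - 1))%:C * (v%:C * w + z) ^- N.+1.
have Np : 0 < N.+1%:R :> R by rewrite ltr0n.
have E1 v : cint leb (fun s => KC w z (v, s)) = (Gamma N.+1%:R)%:C * g v.
  rewrite /KC /g /=; case: (ltrP 0 v) => v0; last first.
    have p0 : ppow v (be - 1) = 0 by exact: ppow_le0.
    transitivity (0 : R[i]); last by rewrite p0 mul0r mulr0.
    by rewrite -[RHS](cint0 leb); apply: eq_cint => s; rewrite p0 mul0r.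
  have gi := gamma_ray_integrable Np (Revwz v v0).
  by rewrite (cintZ _ gi) (gamma_ray_nat N (Revwz v v0)) mulrCA.
have E2 s : cint leb (fun v => KC w z (v, s)) =
    ((Gamma be * r1 `^ (- be))%:C * cis (- (be * a1))) * ((ppow s (al - 1))%:C * cexpN s z).
  under eq_fun do rewrite KCE.
  case: (ltrP 0 s) => s0; last first.
    transitivity (0 : R[i]); last first.
      by rewrite (ppow_le0 (al - 1) s0) [0%:C * _]mul0r mulr0.
    rewrite -[RHS](cint0 leb); apply: eq_cint => v.
    by rewrite (ppow_le0 (N.+1%:R - 1) s0) [0%:C * _]mul0r mul0r.
  rewrite (cintZ _ (gamma_ray_integrable be0 (Resw s s0))).
  have swE : s%:C * w = (s * r1)%:C * cis a1 by rewrite /w mulrA rmorphM.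
  rewrite swE (gamma_ray be0 (mulr_gt0 s0 r10) a1pi).
  have pE : ppow s (al - 1) = ppow s (N.+1%:R - 1) * s `^ (- be).
    rewrite (ppow_gt0 _ s0) (ppow_gt0 _ s0) -(powRD_gt0 _ _ s0).
    by rewrite alE1.
  rewrite (powRM _ (ltW s0) (ltW r10)) pE !(rmorphM (real_complex R)).
  by move: (Gamma be) => gb; ring.
have ig : cintegrable leb g by exact: beta_halfplane_integrable.
have EL : cint leb (fun s => cint leb (fun v => KC w z (v, s))) =
    (Gamma be * r1 `^ (- be))%:C * cis (- (be * a1)) *
    ((Gamma al * r2 `^ (- al))%:C * cis (- (al * a2))).
  under eq_cint do rewrite E2.
  by rewrite (cintZ _ (gamma_ray_integrable al0 Rez)) gamma_ray.
have ER : cint leb (fun v => cint leb (fun s => KC w z (v, s))) =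
    (Gamma N.+1%:R)%:C * cint leb g.
  by under eq_cint do rewrite E1; rewrite (cintZ _ ig).
rewrite EL ER in E; rewrite -/(g) -[LHS](@mulKf _ (Gamma N.+1%:R)%:C).
  rewrite -E opprD cisD /beta_const -rmorphV ?unitfE ?gt_eqF// !rmorphM; ring.
by rewrite -normc_eq0 normcR normr_eq0 gt_eqF.
Qed.

Section rotated.
Variables (w z : R[i]).
Hypotheses (w0 : 0 <= complex.Re w) (wn0 : w != 0) (z0 : 0 < complex.Re z).

Let zn0 : z != 0.
Proof. by apply: contraTneq z0 => ->; rewrite ltxx. Qed.

Let a1 := carg w.
Let a2 := carg z.
Let m := (a1 + a2) / 2.
Let e := (a1 - a2) / 2.

Let half_angle : `|e| < pi / 2 /\ `|- e| < pi / 2.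
Proof.
have := carg_le w0; have := carg_lt z0; rewrite -/a1 -/a2 normrN.
suff : `|e| <= (`|a1| + `|a2|) / 2 by move=> *; split; lra.
by rewrite /e normrM (ger0_norm (_ : 0 <= 2^-1))// ler_wpM2r// ler_normB.
Qed.

Let rotE v : (ppow v (be - 1))%:C * (v%:C * w + z) ^- N.+1 =
  (cis m ^- N.+1) * ((ppow v (be - 1))%:C *
    (v%:C * ((normc w)%:C * cis e) + (normc z)%:C * cis (- e)) ^- N.+1).
Proof.
rewrite [RHS]mulrCA -invfM -exprMn; congr (_ * (_ ^+ _)^-1).
rewrite {1}(polar_form w0 wn0) {1}(polar_form (ltW z0) zn0) -/a1 -/a2.
have -> : a1 = m + e by rewrite /m /e; lra.
have -> : a2 = m - e by rewrite /m /e; lra.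
by rewrite !cisD; ring.
Qed.

Let Re_polar (r a : R) : 0 < r -> `|a| < pi / 2 -> 0 < complex.Re (r%:C * cis a).
Proof.
by move=> r0 ap; rewrite /= mul0r subr0 mulr_gt0// cos_gt0_pihalf// -ltr_norml.
Qed.

Lemma beta_ray_integrable :
  cintegrable leb (fun v => (ppow v (be - 1))%:C * (v%:C * w + z) ^- N.+1).
Proof.
have [h1 h2] := half_angle.
under eq_fun do rewrite rotE.
apply: cintegrableZ.
exact: beta_halfplane_integrable (Re_polar (normc_gt0 wn0) h1)
  (Re_polar (normc_gt0 zn0) h2).
Qed.

(** Both sides only depend on the angle between [w] and [z]; turning by minus
    the mean angle moves both into the open half-plane, and there the formula
    is Fubini for two Gamma integrals. *)
Lemma beta_ray :
  cint leb (fun v => (ppow v (be - 1))%:C * (v%:C * w + z) ^- N.+1) =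
  (beta_const * normc w `^ (- be) * normc z `^ (- al))%:C *
    cis (- (be * carg w + al * carg z)).
Proof.
have [h1 h2] := half_angle.
under eq_cint do rewrite rotE.
rewrite (cintZ _ (beta_halfplane_integrable (Re_polar (normc_gt0 wn0) h1)
  (Re_polar (normc_gt0 zn0) h2))).
rewrite (beta_ray_halfplane (normc_gt0 wn0) (normc_gt0 zn0) h1 h2).
rewrite mulrCA; congr (_ * _); rewrite -cisM_nat -cisN -cisD; congr cis.
rewrite -/a1 -/a2 -NE /m /e; lra.
Qed.

End rotated.

End beta_ray.

(** * Gaussian integrals and the duplication formula *)

Section gauss.
Context {R : realType}.
Let leb := (@lebesgue_measure R).

Lemma measurable_gauss : measurable_fun setT (fun x : R => expR (- x ^+ 2)).
Proof.
apply: (measurableT_comp (@measurable_expRN R)); exact: exprn_measurable.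
Qed.

Let powR_sq (x : R) : `|x| `^ (2^-1)^-1 = x ^+ 2.
Proof. by rewrite invrK powR_mulrn// -normrX ger0_norm// sqr_ge0. Qed.

(** The constant of the substitution [r = x^2] is found by integrating
    [|x| exp(-x^2)]. *)
Lemma ge0_integral_sqr (phi : R -> \bar R) : measurable_fun setT phi ->
  (forall r, 0 <= phi r)%E ->
  (\int[leb]_x phi (x ^+ 2)%R =
   \int[leb]_r ((ppow r (2^-1 - 1))%:E * phi r))%E.
Proof.
have h0 : 0 < 2^-1 :> R by rewrite invr_gt0.
have [A A0 H] := ge0_integral_power h0.
suff A1 : A = 1%E.
  move=> mphi phi0; have := H _ mphi phi0; rewrite A1 mul1e => <-.
  by apply: eq_integral => x _; rewrite powR_sq.
pose f (r : R) := ppow r 2^-1 * expR (- r).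
have mf : measurable_fun setT f.
  by apply: measurable_funM; [exact: measurable_ppow|exact: measurable_expRN].
have f0 r : 0 <= f r by rewrite mulr_ge0 ?ppow_ge0 ?expR_ge0.
have mEf : measurable_fun setT (EFin \o f) by exact/measurable_EFinP.
have := H _ mEf (fun r => f0 r).
have -> : (\int[leb]_r ((ppow r (2^-1 - 1))%:E * (EFin \o f) r) = 1)%E.
  rewrite -(@integral_expRN R); apply: eq_integral => r _.
  rewrite -EFinM /f mulrA -ppowD /ppow; case: ifP => _; last by rewrite mul0r.
  by rewrite (_ : 2^-1 - 1 + 2^-1 = 0) ?powRr0 ?mul1r//; lra.
rewrite mule1 => <-.
pose g (x : R) := x * expR (- x ^+ 2).
have mg : measurable_fun setT (fun x => `|g x|).
  apply: (measurableT_comp (@normr_measurable _ _)).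
  by apply: measurable_funM => //; exact: measurable_gauss.
transitivity (\int[leb]_x (`|g `|x| |)%:E)%E.
  apply: eq_integral => x _; rewrite /= powR_sq /f /g; congr EFin.
  rewrite [RHS]normrM normr_id (ger0_norm (expR_ge0 _)) real_normK ?num_real//.
  congr (_ * _); rewrite /ppow exprn_even_gt0//=; case: ifPn => [_|].
    by rewrite powR12_sqrt ?sqr_ge0// sqrtr_sqr.
  by rewrite negbK => /eqP ->; rewrite normr0.
rewrite (ge0_integral_even (f := fun x => `|g x|))//.
rewrite (_ : 1%E = 2%:E * (2^-1)%:E)%E; last by rewrite -EFinM mulfV.
congr (_ * _)%E; rewrite -(@integral_x_gauss R); apply: eq_integral => x _.
by congr EFin; case: ifP => // x0; rewrite ger0_norm// mulr_ge0 ?expR_ge0// ltW.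
Qed.

Lemma Gamma_half : Gamma 2^-1 = Num.sqrt pi :> R.
Proof.
apply: EFin_inj; rewrite -Gamma_ppow ?invr_gt0// -(@integralT_gauss R).
have mE : measurable_fun [set: R] (fun r : R => (expR (- r))%:E).
  by apply/measurable_EFinP; exact: measurable_expRN.
have -> := ge0_integral_sqr mE (fun r => expR_ge0 (- r)).
by apply: eq_integral => r _; rewrite -EFinM.
Qed.

Lemma gauss_moment (s : R) : 0 < s ->
  (\int[leb]_r (ppow r (s - 1) * expR (- r ^+ 2))%:E = (Gamma (s / 2) / 2)%:E)%E.
Proof.
move=> s0; pose f (r : R) := ppow r ((s - 1) / 2) * expR (- r).
have mf : measurable_fun setT f.
  by apply: measurable_funM; [exact: measurable_ppow|exact: measurable_expRN].
have f0 r : 0 <= f r by rewrite mulr_ge0 ?ppow_ge0 ?expR_ge0.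
have mEf : measurable_fun setT (EFin \o f) by exact/measurable_EFinP.
have := ge0_integral_sqr mEf (fun r => f0 r).
have -> : (\int[leb]_r ((ppow r (2^-1 - 1))%:E * (EFin \o f) r) = (Gamma (s / 2))%:E)%E.
  rewrite -Gamma_ppow ?divr_gt0//; apply: eq_integral => r _.
  rewrite -EFinM /f mulrA -ppowD /gamma_int; congr ((ppow _ _ * _)%:E); lra.
pose g (x : R) := f (x ^+ 2).
have mg : measurable_fun setT g.
  by apply: (measurableT_comp mf); exact: exprn_measurable.
have -> : (\int[leb]_x (EFin \o f) (x ^+ 2)%R = \int[leb]_x (g `|x|)%:E)%E.
  by apply: eq_integral => x _; rewrite /g -normrX ger0_norm ?sqr_ge0.
rewrite (ge0_integral_even mg (fun x => f0 (x ^+ 2))) => E.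
have -> : (Gamma (s / 2) / 2)%:E = (2^-1%:E * (Gamma (s / 2))%:E)%E.
  by rewrite -EFinM mulrC.
rewrite -E muleA -EFinM mulVf// mul1e; apply: eq_integral => x _; congr EFin.
rewrite /g /f; case: (ltrP 0 x) => x0; last by rewrite ppow_le0// mul0r.
rewrite !ppow_gt0 ?exprn_gt0//; congr (_ * _).
by rewrite -powR_mulrn ?ltW// -powRrM; congr (_ `^ _); lra.
Qed.

(** At half-integers the duplication formula follows from the functional equation
    and the value at 1/2. *)
Lemma Gamma_duplication (n : nat) :
  Gamma (n.+1%:R / 2) * Gamma (n.+2%:R / 2) =
  2 ^- n * Num.sqrt pi * Gamma n.+1%:R :> R.
Proof.
elim: n => [|n IH].
  by rewrite mul1r divff// Gamma1 Gamma_half expr0 invr1 mul1r mulr1.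
have -> : n.+3%:R / 2 = n.+1%:R / 2 + 1 :> R by rewrite -addn2 natrD; field.
have n0 : 0 < n.+1%:R :> R by rewrite ltr0n.
rewrite (GammaS (divr_gt0 n0 _))// -[n.+2%:R in RHS]natr1 (GammaS n0).
rewrite mulrCA [Gamma _ * Gamma (_ / 2)]mulrC IH exprS.
move: (Gamma n.+1%:R) => g.
by field; rewrite expf_neq0.
Qed.

End gauss.

(** * Radial integrals on the complex space and on the boundary *)

Section polar_null.
Context {R : realType} d {T : measurableType d}.
Variable mu : {measure set T -> \bar R}.

(** A set of finite measure that a dilation maps to itself while multiplying its
    measure is negligible. *)
Lemma invariant_null (phi : T -> T) (c : R) (S : set T) : measurable S ->
  1 < c -> chvar mu mu phi (fun=> c) -> phi @^-1` S = S -> (mu S < +oo)%E ->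
  mu S = 0%E.
Proof.
move=> mS c1 [mphi _ _ E] pS Sfin.
have mI : measurable_fun setT (fun x => (\1_S x)%:E : \bar R).
  exact/measurable_EFinP/measurable_indic.
have I0 x : (0 <= (\1_S x)%:E :> \bar R)%E by rewrite lee_fin.
have := E _ mI I0; rewrite integral_indic// setIT.
have -> : (\int[mu]_x (c%:E * (\1_S (phi x))%:E) = c%:E * mu S)%E.
  have -> : (fun x => c%:E * (\1_S (phi x))%:E)%E = (fun x => c%:E * (\1_S x)%:E)%E.
    apply/funext => x; rewrite !indicE; congr (_ * (_ : bool)%:R%:E)%E.
    apply/idP/idP => /set_mem h; apply/mem_set; first by rewrite -pS.
    by rewrite -pS in h.
  rewrite (ge0_integralZl_EFin _ measurableT _ mI); last 2 first.
  - by move=> x _; rewrite lee_fin.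
  - by rewrite ltW// (lt_trans ltr01).
  by rewrite integral_indic// setIT.
have : (0 <= mu S)%E by [].
case: (mu S) Sfin => [r _ r0 [H]|//|//]; congr EFin.
by nra.
Qed.

End polar_null.

Section Cn.
Context {R : realType}.
Let leb := (@lebesgue_measure R).

Lemma sqnorm_ge0 n (u : n.-tuple R[i]) : 0 <= sqnorm u.
Proof. by apply: sumr_ge0 => j _; rewrite sqr_ge0. Qed.

Lemma sqnorm_map n (w : R[i]) (u : n.-tuple R[i]) :
  sqnorm (map_tuple ( *%R w) u) = normc w ^+ 2 * sqnorm u.
Proof.
rewrite /sqnorm mulr_sumr; apply: eq_bigr => j _.
by rewrite tnth_map normcM exprMn.
Qed.

Lemma sqnorm_join n (z : R[i]) (u : n.-tuple R[i]) :
  sqnorm (tuple_join (z, u)) = normc z ^+ 2 + sqnorm u.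
Proof.
rewrite /sqnorm big_ord_recl tnth0; congr (_ + _).
by apply: eq_bigr => j _; rewrite tnthS.
Qed.

Lemma sqnorm0 (u : 0.-tuple R[i]) : sqnorm u = 0.
Proof. by rewrite /sqnorm big_ord0. Qed.

Lemma integral_lebesgueCnS n (h : n.+1.-tuple R[i] -> \bar R) :
  measurable_fun setT h -> (forall x, 0 <= h x)%E ->
  (\int[lebesgueCn R n.+1]_x h x =
   \int[lebesgueC R]_z \int[lebesgueCn R n]_u h (tuple_join (z, u)))%E.
Proof.
move=> mh h0; rewrite [LHS](ge0_integral_transport
  (product_measure (lebesgueC R) (lebesgueCn R n)) (@measurable_tuple_join R n)
  (@measurable_tuple_split R n) (@tuple_joinK R n) mh h0).
rewrite (ge0_integral_product (lebesgueC R) (lebesgueCn R n))//.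
by apply: (measurableT_comp mh); exact: measurable_tuple_join.
Qed.

Lemma integral_lebesgueC (h : R[i] -> \bar R) :
  measurable_fun setT h -> (forall x, 0 <= h x)%E ->
  (\int[lebesgueC R]_z h z = \int[leb]_x \int[leb]_y h (x +i* y))%E.
Proof.
move=> mh h0; rewrite [LHS](ge0_integral_transport
  (product_measure leb leb) (@measurable_pair_complex R)
  (@measurable_complex_pair R) (@pair_complexK R) mh h0).
rewrite (ge0_integral_product leb leb)//.
by apply: (measurableT_comp mh); exact: measurable_pair_complex.
Qed.

Let gauss_fin : (\int[leb]_x (expR (- x ^+ 2))%:E = (Num.sqrt pi)%:E)%E.
Proof. exact: (@integralT_gauss R). Qed.

Let mgauss : measurable_fun [set: measurableTypeR R]
  (fun x => (expR (- x ^+ 2))%:E).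
Proof. by apply/measurable_EFinP; exact: measurable_gauss. Qed.

Lemma gauss_C : (\int[lebesgueC R]_z (expR (- normc z ^+ 2))%:E = pi%:E)%E.
Proof.
have mg : measurable_fun setT (fun z : R[i] => (expR (- normc z ^+ 2))%:E).
  apply/measurable_EFinP; apply: (measurableT_comp (@measurable_expRN R)).
  exact: measurable_sqr_normc.
rewrite (integral_lebesgueC mg (fun z => expR_ge0 (- normc z ^+ 2))).
transitivity (\int[leb]_x ((Num.sqrt pi)%:E * (expR (- x ^+ 2))%:E))%E.
  apply: eq_integral => x _.
  transitivity (\int[leb]_y ((expR (- x ^+ 2))%:E * (expR (- y ^+ 2))%:E))%E.
    apply: eq_integral => y _; rewrite sqr_normc_ReIm/= opprD expRD.
    by rewrite EFinM.
  rewrite (ge0_integralZl_EFin _ measurableT _ mgauss (expR_ge0 _)).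
    by rewrite gauss_fin muleC.
  by move=> y _; rewrite lee_fin expR_ge0.
rewrite (ge0_integralZl_EFin _ measurableT _ mgauss (sqrtr_ge0 _)).
  by rewrite gauss_fin -EFinM -expr2 sqr_sqrtr// pi_ge0.
by move=> y _; rewrite lee_fin expR_ge0.
Qed.

Lemma gauss_Cn n :
  (\int[lebesgueCn R n]_u (expR (- sqnorm u))%:E = (pi ^+ n)%:E)%E.
Proof.
have mg k : measurable_fun setT (fun u : k.-tuple R[i] => (expR (- sqnorm u))%:E).
  apply/measurable_EFinP; apply: (measurableT_comp (@measurable_expRN R)).
  exact: measurable_sqnorm.
elim: n => [|n IH].
  by rewrite (integral_lebesgueC0 (mg 0%N)) sqnorm0 oppr0 expR0 expr0.
rewrite (integral_lebesgueCnS (mg n.+1) (fun u => expR_ge0 (- sqnorm u))).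
have mgC : measurable_fun setT (fun z : R[i] => (expR (- normc z ^+ 2))%:E).
  apply/measurable_EFinP; apply: (measurableT_comp (@measurable_expRN R)).
  exact: measurable_sqr_normc.
have pn : 0 <= pi ^+ n :> R by rewrite exprn_ge0// pi_ge0.
transitivity (\int[lebesgueC R]_z ((pi ^+ n)%:E * (expR (- normc z ^+ 2))%:E))%E.
  apply: eq_integral => z _.
  transitivity (\int[lebesgueCn R n]_u ((expR (- normc z ^+ 2))%:E * (expR (- sqnorm u))%:E))%E.
    apply: eq_integral => u _; rewrite sqnorm_join opprD expRD.
    by rewrite EFinM.
  rewrite (ge0_integralZl_EFin _ measurableT _ (mg n) (expR_ge0 _)).
    by rewrite IH muleC.
  by move=> u _; rewrite lee_fin expR_ge0.
rewrite (ge0_integralZl_EFin _ measurableT _ mgC pn).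
  by rewrite gauss_C -EFinM exprSr.
by move=> z _; rewrite lee_fin expR_ge0.
Qed.

Definition dilCn n (s : R) (u : n.-tuple R[i]) : n.-tuple R[i] :=
  map_tuple ( *%R (Num.sqrt s)%:C) u.

Lemma mdilCn n d (T : measurableType d) (s : T -> R) (g : T -> n.-tuple R[i]) :
  measurable_fun setT s -> measurable_fun setT g ->
  measurable_fun setT (fun x => dilCn (s x) (g x)).
Proof.
move=> ms mg; apply: measurable_map_tuple => //; apply: mrealC.
rewrite (_ : (fun x => _) = fun x => if 0 < s x then (s x) `^ 2^-1 else 0).
  apply: mifR; first exact: measurable_fun_ltr.
  exact: (measurableT_comp (measurable_powR _) ms).
apply/funext => x; case: ltrP => s0; first by rewrite powR12_sqrt ?ltW.
by apply/eqP; rewrite sqrtr_eq0.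
Qed.

Lemma chvar_dilCn n (s : R) : 0 < s ->
  chvar (lebesgueCn R n) (lebesgueCn R n) (dilCn s) (fun=> s `^ n%:R).
Proof.
move=> s0; have q0 : 0 < Num.sqrt s by rewrite sqrtr_gt0.
have := chvar_mapCn n (sqr_ge0 _) (chvar_scaleC q0).
by apply: chvar_eq => // u; rewrite sqr_sqrtr ?ltW// powR_mulrn// ltW.
Qed.

Lemma sqnorm_dil n (s : R) (u : n.-tuple R[i]) : 0 < s ->
  sqnorm (dilCn s u) = s * sqnorm u.
Proof.
move=> s0; rewrite sqnorm_map normcR ger0_norm ?sqrtr_ge0//.
by rewrite sqr_sqrtr// ltW.
Qed.

(** The integral over C^n of exp(-|u|^4), in a form that is also correct for
    n = 0, where Gamma(n) would not be defined. *)
Definition quartic_gauss n : R := 2 ^- n * pi ^+ n * Num.sqrt pi / Gamma (n.+1%:R / 2).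

Let quartic_measurable n : measurable_fun setT
  (fun u : n.-tuple R[i] => (expR (- sqnorm u ^+ 2))%:E).
Proof.
apply/measurable_EFinP; apply: (measurableT_comp measurable_gauss).
exact: measurable_sqnorm.
Qed.

(** The Gaussian integral determines the mass of the spheres of |u|^2, hence all
    integrals of functions of |u|^2. *)
Lemma integral_quartic_gauss n :
  (\int[lebesgueCn R n]_u (expR (- sqnorm u ^+ 2))%:E = (quartic_gauss n)%:E)%E.
Proof.
have sp0 : 0 < Num.sqrt pi :> R by rewrite sqrtr_gt0 pi_gt0.
case: n => [|n].
  rewrite (integral_lebesgueC0 (@quartic_measurable 0%N)) sqnorm0.
  rewrite expr0n oppr0 expR0 /quartic_gauss mul1r Gamma_half !expr0 invr1 !mul1r.
  by rewrite divff// gt_eqF.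
pose N : R := n.+1%:R; have N0 : 0 < N by rewrite ltr0n.
have mS : measurable [set u : n.+1.-tuple R[i] | sqnorm u = 0].
  rewrite (_ : [set u | _] = (@sqnorm R n.+1) @^-1` [set 0])//.
  by rewrite -[X in measurable X]setTI; exact: measurable_sqnorm.
have Snull : lebesgueCn R n.+1 [set u | sqnorm u = 0] = 0%E.
  have c2 : 1 < (2 : R) `^ n.+1%:R.
    by rewrite powR_mulrn// exprn_egt1// ltr1n.
  apply: (invariant_null mS c2 (chvar_dilCn n.+1 (ltr0n R 2))).
    apply/seteqP; split => u /=; rewrite sqnorm_dil//.
      by move/eqP; rewrite mulf_eq0 pnatr_eq0 /= => /eqP.
    by move=> ->; rewrite mulr0.
  apply: (@le_lt_trans _ _ (pi ^+ n.+1)%:E); last exact: ltry.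
  rewrite -gauss_Cn -[X in (X <= _)%E]mul1e -[X in (_ * lebesgueCn R n.+1 X)%E]setIT.
  rewrite mul1e -integral_indic//; apply: ge0_le_integral_nonmeas => u.
    by rewrite lee_fin.
  rewrite lee_fin indicE; case: (boolP (u \in _)) => [/set_mem /= ->|_].
    by rewrite oppr0 expR0.
  exact: expR_ge0.
have H := @ge0_integral_radial R _ _ (lebesgueCn R n.+1) N (@dilCn n.+1)
  (@sqnorm R n.+1) (mdilCn measurable_snd measurable_fst) (chvar_dilCn n.+1)
  (@measurable_sqnorm R n.+1) (@sqnorm_ge0 n.+1) (@sqnorm_dil n.+1) Snull.
have mE : measurable_fun [set: R] (fun r : R => (expR (- r))%:E).
  by apply/measurable_EFinP; exact: measurable_expRN.
have := H _ mE (fun r => expR_ge0 (- r)).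
have E1 : (\int[leb]_r ((ppow r (N - 1))%:E * (expR (- r))%:E) = (Gamma N)%:E)%E.
  by rewrite -(Gamma_ppow N0); apply: eq_integral => r _; rewrite -EFinM.
rewrite gauss_Cn E1.
have G0 := Gamma_gt0 N0.
set A := polar_mass _ _ _ => AE.
have {}AE : A = (pi ^+ n.+1 / Gamma N)%:E.
  have : (A * (Gamma N)%:E * (Gamma N)^-1%:E = A)%E.
    by rewrite -muleA -EFinM divff ?mule1// gt_eqF.
  by rewrite -AE -EFinM => <-.
have mG : measurable_fun [set: R] (fun r : R => (expR (- r ^+ 2))%:E).
  by apply/measurable_EFinP; exact: measurable_gauss.
have := H _ mG (fun r => expR_ge0 (- r ^+ 2)).
have E2 : (\int[leb]_r ((ppow r (N - 1))%:E * (expR (- r ^+ 2))%:E) =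
    (Gamma (N / 2) / 2)%:E)%E.
  by rewrite -(gauss_moment N0); apply: eq_integral => r _; rewrite -EFinM.
rewrite E2.
rewrite -/A AE => ->; rewrite -EFinM /quartic_gauss; congr EFin.
have D := @Gamma_duplication R n; rewrite -/N in D.
have g1 : Gamma N != 0 by rewrite gt_eqF.
have g2 : Gamma (n.+2%:R / 2) != 0 :> R by rewrite gt_eqF// Gamma_gt0// divr_gt0// ltr0n.
have -> : Gamma (N / 2) = 2 ^- n * Num.sqrt pi * Gamma N / Gamma (n.+2%:R / 2).
  by rewrite -D mulfK.
move: (Gamma N) (Gamma (n.+2%:R / 2)) g1 g2 => g h g1 g2.
by rewrite [2 ^+ n.+1]exprS; field; rewrite g2 g1 expf_neq0.
Qed.

End Cn.

(** * The boundary in coordinates *)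

Section boundary.
Context {R : realType} (n : nat).
Let leb := (@lebesgue_measure R).

Definition bmu := product_measure (lebesgueCn R n) (@lebesgue_measure R).

(** On the boundary [bW] is i conj(u_(n+1)); it is homogeneous of degree
    one under the dilations [dilb]. *)
Definition bW (x : n.-tuple R[i] * measurableTypeR R) : R[i] :=
  sqnorm x.1 +i* x.2.

Definition brad (x : n.-tuple R[i] * measurableTypeR R) : R := normc (bW x).

Definition dilb (s : R) (x : n.-tuple R[i] * measurableTypeR R) :
  n.-tuple R[i] * measurableTypeR R := (dilCn s x.1, s * x.2).

(** The mass of the space of orbits of the dilations, see [bmassE]. *)
Definition bmass : R := 2 * 2 ^- n * pi ^+ n.+1 / Gamma (n.+1%:R / 2) ^+ 2.

Lemma measurable_bW : measurable_fun setT bW.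
Proof.
apply: measurable_ReImP => /=.
  by apply: (measurableT_comp (@measurable_sqnorm R n)); exact: measurable_fst.
exact: measurable_snd.
Qed.

Lemma measurable_brad : measurable_fun setT brad.
Proof. by apply: mnormC; exact: measurable_bW. Qed.

Lemma brad_ge0 x : 0 <= brad x.
Proof. exact: normc_ge0. Qed.

Lemma bW_dil s x : 0 < s -> bW (dilb s x) = s%:C * bW x.
Proof.
move=> s0; rewrite /bW /dilb /= sqnorm_dil//.
by apply/eqP; rewrite eq_complex /= !mul0r subr0 addr0 !eqxx.
Qed.

Lemma brad_dil s x : 0 < s -> brad (dilb s x) = s * brad x.
Proof. by move=> s0; rewrite /brad bW_dil// normcM normcR gtr0_norm. Qed.

Lemma chvar_dilb s : 0 < s -> chvar bmu bmu (dilb s) (fun=> s `^ n.+1%:R).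
Proof.
move=> s0.
have := @chvar_prod R _ _ _ _ (lebesgueCn R n) leb _ _ _ _
  (chvar_dilCn n s0) (chvar_scale s0).
apply: chvar_eq => // x; rewrite -{2}(powRr1 (ltW s0)) -powRD_gt0//.
by rewrite natr1.
Qed.

Lemma mdilb : measurable_fun setT
  (fun x : (n.-tuple R[i] * measurableTypeR R) * R => dilb x.2 x.1).
Proof.
apply: measurable_fun_pair.
  apply: mdilCn; first exact: measurable_snd.
  by apply: (measurableT_comp measurable_fst); exact: measurable_fst.
apply: measurable_funM; first exact: measurable_snd.
by apply: (measurableT_comp measurable_snd); exact: measurable_fst.
Qed.

Let mgauss : measurable_fun [set: measurableTypeR R]
  (fun x => (expR (- x ^+ 2))%:E).
Proof. by apply/measurable_EFinP; exact: measurable_gauss. Qed.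

Let quartic_ge0 : 0 <= quartic_gauss n :> R.
Proof.
rewrite -lee_fin -integral_quartic_gauss; apply: integral_ge0 => u _.
by rewrite lee_fin expR_ge0.
Qed.

Lemma gauss_boundary :
  (\int[bmu]_x (expR (- brad x ^+ 2))%:E = (quartic_gauss n * Num.sqrt pi)%:E)%E.
Proof.
have mg : measurable_fun setT (fun x => (expR (- brad x ^+ 2))%:E).
  apply/measurable_EFinP; apply: (measurableT_comp measurable_gauss).
  exact: measurable_brad.
rewrite (ge0_integral_product2 (lebesgueCn R n) leb mg (fun x => expR_ge0 (- brad x ^+ 2))).
have mq : measurable_fun setT (fun u : n.-tuple R[i] => (expR (- sqnorm u ^+ 2))%:E).
  apply/measurable_EFinP; apply: (measurableT_comp measurable_gauss).
  exact: measurable_sqnorm.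
transitivity (\int[leb]_t ((quartic_gauss n)%:E * (expR (- t ^+ 2))%:E))%E.
  apply: eq_integral => t _.
  transitivity (\int[lebesgueCn R n]_u ((expR (- t ^+ 2))%:E *
     (expR (- sqnorm u ^+ 2))%:E))%E.
    apply: eq_integral => u _; rewrite /brad sqr_normc_ReIm /= opprD expRD.
    by rewrite mulrC EFinM.
  rewrite (ge0_integralZl_EFin _ measurableT _ mq (expR_ge0 _)).
    by rewrite integral_quartic_gauss muleC.
  by move=> u _; rewrite lee_fin expR_ge0.
rewrite (ge0_integralZl_EFin _ measurableT _ mgauss quartic_ge0).
  by rewrite (@integralT_gauss R).
by move=> t _; rewrite lee_fin expR_ge0.
Qed.

Lemma brad_null : bmu [set x | brad x = 0] = 0%E.
Proof.
have mS : measurable [set x | brad x = 0].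
  rewrite (_ : [set x | _] = brad @^-1` [set 0])//.
  by rewrite -[X in measurable X]setTI; exact: measurable_brad.
have c2 : 1 < (2 : R) `^ n.+1%:R by rewrite powR_mulrn// exprn_egt1// ltr1n.
apply: (invariant_null mS c2 (chvar_dilb (ltr0n R 2))).
  apply/seteqP; split => u /=; rewrite brad_dil//.
    by move/eqP; rewrite mulf_eq0 pnatr_eq0 /= => /eqP.
  by move=> ->; rewrite mulr0.
have : (\int[bmu]_x (\1_[set x | brad x = 0] x)%:E < +oo)%E.
  apply: (@le_lt_trans _ _ (quartic_gauss n * Num.sqrt pi)%:E); last exact: ltry.
  rewrite -gauss_boundary; apply: ge0_le_integral_nonmeas => u; first by rewrite lee_fin.
  rewrite lee_fin indicE; case: (boolP (u \in _)) => [/set_mem /= ->|_].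
    by rewrite expr0n oppr0 expR0.
  exact: expR_ge0.
by rewrite integral_indic// setIT.
Qed.

Let N0 : 0 < n.+1%:R :> R. Proof. by rewrite ltr0n. Qed.

(** The radial formula is compared with the integral of exp(-|W|^2), a product of
    a Gaussian integral in t and a quartic one in u. *)
Lemma bmassE : polar_mass bmu n.+1%:R brad = bmass%:E.
Proof.
have H := @ge0_integral_radial R _ _ bmu n.+1%:R dilb brad mdilb chvar_dilb
  measurable_brad brad_ge0 brad_dil brad_null.
have mG : measurable_fun [set: R] (fun r : R => (expR (- r ^+ 2))%:E).
  by apply/measurable_EFinP; exact: measurable_gauss.
have := H _ mG (fun r => expR_ge0 (- r ^+ 2)).
have E2 : (\int[leb]_r ((ppow r (n.+1%:R - 1))%:E * (expR (- r ^+ 2))%:E) =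
    (Gamma (n.+1%:R / 2) / 2)%:E)%E.
  by rewrite -(gauss_moment N0); apply: eq_integral => r _; rewrite -EFinM.
rewrite gauss_boundary E2.
have g0 : 0 < Gamma (n.+1%:R / 2) :> R by rewrite Gamma_gt0// divr_gt0.
set A := polar_mass _ _ _ => AE.
have -> : A = (A * (Gamma (n.+1%:R / 2) / 2)%:E * (2 / Gamma (n.+1%:R / 2))%:E)%E.
  rewrite -muleA -EFinM (_ : Gamma _ / 2 * _ = 1) ?mule1//.
  by move: (Gamma _) (gt_eqF g0) => g /negbT gn; field.
rewrite -AE -EFinM /bmass /quartic_gauss; congr EFin.
transitivity (2 * 2 ^- n * (pi ^+ n * Num.sqrt pi ^+ 2) / Gamma (n.+1%:R / 2) ^+ 2 : R).
  move: (Gamma _) (gt_eqF g0) => g /negbT gn; field.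
  by rewrite gn expf_neq0.
by rewrite (sqr_sqrtr (pi_ge0 R)) -exprSr.
Qed.

Lemma bmass_gt0 : 0 < bmass.
Proof.
have g0 : 0 < Gamma (n.+1%:R / 2) :> R by rewrite Gamma_gt0// divr_gt0.
by rewrite /bmass divr_gt0 ?exprn_gt0// !mulr_gt0 ?invr_gt0 ?exprn_gt0 ?pi_gt0.
Qed.

(** The volume of the spheres of [brad] grows like r^n. *)
Lemma ge0_integral_brad (phi : R -> \bar R) : measurable_fun setT phi ->
  (forall r, 0 <= phi r)%E ->
  (\int[bmu]_x phi (brad x) =
   bmass%:E * \int[leb]_r ((ppow r (n.+1%:R - 1))%:E * phi r))%E.
Proof.
move=> mphi phi0; rewrite -bmassE.
exact: (ge0_integral_radial mdilb chvar_dilb measurable_brad brad_ge0 brad_dil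
  brad_null mphi phi0).
Qed.

End boundary.

(** * The Cauchy integral of a homogeneous function *)

Section homogeneous.
Context {R : realType} (n : nat).
Let leb := (@lebesgue_measure R).
Variables (al be : R).
Hypotheses (al0 : 0 < al) (be0 : 0 < be) (NE : al + be = n.+1%:R).

(** The test function is homogeneous of degree [-al] and has the phase of [w^be],
    which is the one that makes the integrals of its product with
    [(w + z)^-(n+1)] along rays all point in the same direction. *)
Definition hom_test (w : R[i]) : R[i] :=
  (normc w `^ (- al))%:C * cis (be * carg w).

Lemma normc_hom_test w : normc (hom_test w) = normc w `^ (- al).
Proof. by rewrite normcM normc_cis mulr1 normcR ger0_norm// powR_ge0. Qed.

Lemma measurable_hom_test d (T : measurableType d) (f : T -> R[i]) :
  measurable_fun setT f -> measurable_fun setT (fun x => hom_test (f x)).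
Proof.
move=> mf; apply: mMC.
  apply: mrealC; apply: (measurableT_comp (measurable_powR (- al))).
  exact: mnormC.
by apply: mcis; apply: measurable_funM => //; exact: mcarg.
Qed.

Lemma hom_test_dil s w : 0 < s -> hom_test (s%:C * w) = (s `^ (- al))%:C * hom_test w.
Proof.
move=> s0; rewrite /hom_test cargZ// normcM normcR gtr0_norm//.
by rewrite powRM ?normc_ge0 ?ltW// rmorphM mulrA.
Qed.

(** A common majorant, up to constants, of the test function multiplied by the
    kernels of all points above the boundary. *)
Definition dom_fun (x : n.-tuple R[i] * measurableTypeR R) : R :=
  (1 + brad x) ^- n.+1 * brad x `^ (- al).

Lemma dom_fun_ge0 x : 0 <= dom_fun x.
Proof.
by rewrite mulr_ge0 ?powR_ge0// invr_ge0 exprn_ge0// addr_ge0// brad_ge0.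
Qed.

Lemma measurable_dom_fun : measurable_fun setT dom_fun.
Proof.
apply: measurable_funM.
  by apply: mVR; apply: measurable_funX; apply: measurable_funD => //; exact: measurable_brad.
by apply: (measurableT_comp (measurable_powR (- al))); exact: measurable_brad.
Qed.

(** The radial integral is the one of [beta_ge0_scale] at the point (1, 1). *)
Lemma dom_fun_lty : (\int[bmu n]_x (dom_fun x)%:E < +oo)%E.
Proof.
pose phi (r : R) := `|(1 + r) ^- n.+1| * r `^ (- al).
have mphi : measurable_fun setT (fun r => (phi r)%:E).
  apply/measurable_EFinP; apply: measurable_funM; last exact: measurable_powR.
  apply: (measurableT_comp (@normr_measurable _ _)).
  by apply: mVR; apply: measurable_funX; exact: measurable_funD.
have phi0 r : (0 <= (phi r)%:E)%E by rewrite lee_fin mulr_ge0 ?powR_ge0.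
rewrite (_ : (fun x => (dom_fun x)%:E) = (fun x => (phi (brad x))%:E)); last first.
  apply/funext => x; congr EFin; rewrite /phi ger0_norm//.
  by rewrite invr_ge0 exprn_ge0// addr_ge0// brad_ge0.
rewrite (ge0_integral_brad n mphi phi0).
rewrite (_ : \int[_]_r _ = \int[leb]_v (ppow v (be - 1) * (v * 1 + 1) ^- n.+1)%:E)%E.
  by rewrite (beta_ge0_scale al0 be0 NE ltr01 ltr01) -EFinM ltry.
apply: eq_integral => r _; rewrite -EFinM; congr EFin.
case: (ltrP 0 r) => r0; last by rewrite !ppow_le0// !mul0r.
rewrite (_ : be - 1 = n.+1%:R - 1 + - al); last by rewrite -NE; lra.
rewrite (ppowD r (n.+1%:R - 1) (- al)) ![ppow r _]ppow_gt0// /phi mulr1 [r + 1]addrC ger0_norm; first by ring.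
by rewrite invr_ge0 exprn_ge0// addr_ge0// ltW.
Qed.

Lemma dom_cintegrable (f : n.-tuple R[i] * measurableTypeR R -> R[i]) (C : R) :
  0 <= C -> measurable_fun setT f -> (forall x, normc (f x) <= C * dom_fun x) ->
  cintegrable (bmu n) f.
Proof.
move=> C0 mf fd; apply: (le_cintegrable mf fd).
have md : measurable_fun setT (fun x => (dom_fun x)%:E).
  by apply/measurable_EFinP; exact: measurable_dom_fun.
rewrite (ge0_integralZl_EFin _ measurableT _ md C0).
  by rewrite lte_mul_pinfty// ?dom_fun_lty// lee_fin.
by move=> x _; rewrite lee_fin dom_fun_ge0.
Qed.

Lemma bW_neq0 (x : n.-tuple R[i] * measurableTypeR R) : 0 < brad x -> bW x != 0.
Proof. by move=> r0; rewrite -normc_eq0 gt_eqF. Qed.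

Lemma Re_bW_ge0 (x : n.-tuple R[i] * measurableTypeR R) : 0 <= complex.Re (bW x).
Proof. exact: sqnorm_ge0. Qed.

Section one_point.
Variables (z : R[i]) (c : R).
Hypotheses (z0 : 0 < complex.Re z) (c0 : 0 < c).
Hypothesis lower : forall x : n.-tuple R[i] * measurableTypeR R,
  c * (1 + brad x) <= normc (bW x + z).

Let F (x : n.-tuple R[i] * measurableTypeR R) : R[i] :=
  (bW x + z) ^- n.+1 * hom_test (bW x).

Lemma hom_kernel_cintegrable : cintegrable (bmu n) F.
Proof.
apply: (@dom_cintegrable _ (c ^- n.+1)).
- by rewrite invr_ge0 exprn_ge0// ltW.
- apply: mMC; last by apply: measurable_hom_test; exact: measurable_bW.
  by apply: mVC; apply: mXC; apply: mDC => //; exact: measurable_bW.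
- move=> x; rewrite normcM normc_hom_test /dom_fun mulrA.
  apply: ler_wpM2r; first exact: powR_ge0.
  rewrite normcV normcX -invfM -exprMn; apply: le_invX; last exact: lower.
  by rewrite mulr_gt0// ltr_wpDr// brad_ge0.
Qed.

Let coef (x : n.-tuple R[i] * measurableTypeR R) : R[i] :=
  (polar_weight (@brad R n) x)%:C * hom_test (bW x).

Let FE x s : (ppow s (n.+1%:R - 1) * polar_weight (@brad R n) x)%:C * F (dilb s x) =
  coef x * ((ppow s (be - 1))%:C * (s%:C * bW x + z) ^- n.+1).
Proof.
case: (ltrP 0 s) => s0; last first.
  by rewrite (ppow_le0 _ s0) (ppow_le0 _ s0) mul0r [0%:C * _]mul0r [0%:C * _]mul0r mulr0.
rewrite /F bW_dil// hom_test_dil//.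
rewrite (_ : be - 1 = n.+1%:R - 1 + - al); last by rewrite -NE; lra.
rewrite (ppowD s (n.+1%:R - 1) (- al)) [ppow s (- al)]ppow_gt0// !(rmorphM (real_complex R)) /coef.
by rewrite /=; ring.
Qed.

Let sec_integrable x : cintegrable leb
  (fun s => coef x * ((ppow s (be - 1))%:C * (s%:C * bW x + z) ^- n.+1)).
Proof.
rewrite /coef /polar_weight; case: ifP => [r1|_].
  apply: cintegrableZ; apply: (beta_ray_integrable al0 be0 NE) => //.
  - exact: Re_bW_ge0.
  - exact: bW_neq0 (lt_le_trans ltr01 r1).
rewrite [0%:C * _]mul0r; under eq_fun do rewrite mul0r.
by split => //; under eq_integral do rewrite normc0; rewrite integral0.
Qed.

(** Along every orbit of the dilations the integrand has the same phase, so that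
    the integral reduces to the total mass of the space of orbits. *)
Lemma cint_hom_kernel : cint (bmu n) F =
  (bmass n * beta_const n al be * normc z `^ (- al))%:C * cis (- (al * carg z)).
Proof.
have P := chvar_polar (mdilb (R := R) (n := n)) (@chvar_dilb R n)
  (@measurable_brad R n) (@brad_ge0 R n) (@brad_dil R n) (@brad_null R n).
rewrite (chvar_cint P hom_kernel_cintegrable).
have iP := chvar_cintegrable P hom_kernel_cintegrable.
have sec x : cintegrable leb (fun s => (ppow (x, s).2 (n.+1%:R - 1) *
    polar_weight (@brad R n) (x, s).1)%:C * F (dilb (x, s).2 (x, s).1)).
  by under eq_fun do rewrite FE; exact: sec_integrable.
rewrite (cint_fubini1 iP sec).
pose C0 := (beta_const n al be * normc z `^ (- al))%:C * cis (- (al * carg z)).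
pose wt x := polar_weight (@brad R n) x * brad x `^ (- n.+1%:R).
have inner x : cint leb (fun s => coef x * ((ppow s (be - 1))%:C *
    (s%:C * bW x + z) ^- n.+1)) = C0 * (wt x)%:C.
  rewrite /wt /coef /polar_weight; case: ifP => [r1|_]; last first.
    transitivity (0 : R[i]); last by rewrite [0 * _ `^ _]mul0r mulr0.
    rewrite -[RHS](cint0 leb); apply: eq_cint => s.
    by rewrite [0%:C * hom_test _]mul0r mul0r.
  have rp := lt_le_trans ltr01 r1; have wn0 := bW_neq0 rp.
  have bi := beta_ray_integrable al0 be0 NE (Re_bW_ge0 x) wn0 z0.
  rewrite (cintZ _ bi) (beta_ray al0 be0 NE (Re_bW_ge0 x) wn0 z0).
  rewrite /hom_test /C0 -/(brad x) opprD cisD -NE opprD powRD_gt0//.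
  have cc : cis (be * carg (bW x)) * cis (- (be * carg (bW x))) = 1.
    by rewrite -cisD subrr cis0.
  rewrite !(rmorphM (real_complex R)).
  rewrite -[RHS]mul1r -cc; ring.
transitivity (cint (bmu n) (fun x => C0 * (wt x)%:C)).
  by apply: eq_cint => x; rewrite -inner; apply: eq_cint => s; exact: FE.
have mw : measurable_fun setT wt.
  apply: measurable_funM; first exact: measurable_polar_weight (@measurable_brad R n).
  by apply: (measurableT_comp (measurable_powR (- n.+1%:R))); exact: measurable_brad.
have w0 x : 0 <= wt x.
  by rewrite mulr_ge0 ?powR_ge0// polar_weight_ge0// => y; exact: brad_ge0.
have wE : (\int[bmu n]_x (wt x)%:E = (bmass n)%:E)%E by rewrite -bmassE.
have iw : cintegrable (bmu n) (fun x => (wt x)%:C).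
  split; first exact: mrealC.
  under eq_integral do rewrite normcR ger0_norm//.
  by rewrite wE ltry.
rewrite (cintZ _ iw).
have -> : cint (bmu n) (fun x => (wt x)%:C) = (bmass n)%:C.
  apply/eqP; rewrite eq_complex /= /Rintegral wE integral0 /=.
  by rewrite !eqxx.
by rewrite /C0 mulrC mulrA -rmorphM mulrA.
Qed.

End one_point.

End homogeneous.

(** * The mean value property of the kernel *)

Section cint_limit.
Context {R : realType} d {T : measurableType d}.
Variable m : {measure set T -> \bar R}.

Let Rint_limit (f_ : nat -> T -> R) (f G : T -> R) (a : R) :
  (forall k, measurable_fun setT (f_ k)) -> measurable_fun setT f ->
  (forall k x, `|f_ k x| <= G x) -> measurable_fun setT G ->
  (\int[m]_x (G x)%:E < +oo)%E ->
  (forall x, f_ ^~ x @ \oo --> f x) -> (forall k, \int[m]_x f_ k x = a) ->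
  \int[m]_x f x = a.
Proof.
move=> mf_ mf fG mG Gfin cv fa.
have iG : m.-integrable setT (EFin \o G).
  apply/integrableP; split; first exact/measurable_EFinP.
  apply: le_lt_trans Gfin; apply: ge0_le_integral_nonmeas => x //=.
  by rewrite lee_fin ger0_norm// (le_trans _ (fG 0%N x)).
have mEf_ k : measurable_fun setT (EFin \o f_ k) by exact/measurable_EFinP.
have mEf : measurable_fun setT (EFin \o f) by exact/measurable_EFinP.
have cvE : {ae m, forall x, [set: T] x ->
    (fun k => (EFin \o f_ k) x) @ \oo --> (EFin \o f) x}.
  by apply: aeW => x _; apply: cvg_EFin; [exact: nearW|exact: cv].
have dom : {ae m, forall x k, [set: T] x -> (`|(EFin \o f_ k) x| <= (EFin \o G) x)%E}.
  by apply: aeW => x k _ /=; rewrite lee_fin.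
have [ifi _ lim] := @dominated_convergence _ _ _ m setT measurableT
  (fun k => EFin \o f_ k) (EFin \o f) (EFin \o G) mEf_ mEf cvE iG dom.
have E k : (\int[m]_x (EFin \o f_ k) x = a%:E)%E.
  rewrite -(fa k) /Rintegral fineK//; apply: (integrable_fin_num measurableT).
  apply: (le_integrable measurableT (mEf_ k) _ iG) => x _ /=.
  by rewrite lee_fin (le_trans (fG k x))// ler_norm.
rewrite /Rintegral; have -> : (\int[m]_x (f x)%:E = a%:E)%E; last by [].
have lim' : (fun k => (\int[m]_x (EFin \o f_ k) x)%E) @ \oo --> a%:E.
  have -> : (fun k => (\int[m]_x (EFin \o f_ k) x)%E) = (fun=> a%:E).
    by apply/funext => k; rewrite E.
  exact: cvg_cst.
exact: (cvg_unique _ lim lim').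
Qed.

Lemma cint_limit (F_ : nat -> T -> R[i]) (F : T -> R[i]) (G : T -> R) (a : R[i]) :
  (forall k, measurable_fun setT (F_ k)) -> measurable_fun setT F ->
  (forall k x, normc (F_ k x) <= G x) -> measurable_fun setT G ->
  (\int[m]_x (G x)%:E < +oo)%E ->
  (forall x, (fun k => normc (F_ k x - F x)) @ \oo --> (0 : R)) ->
  (forall k, cint m (F_ k) = a) -> cint m F = a.
Proof.
move=> mF_ mF FG mG Gfin cv Fa.
have sq (p : R[i] -> R) : (forall u v, p u - p v = p (u - v)) ->
    (forall u, `|p u| <= normc u) -> forall x, (fun k => p (F_ k x)) @ \oo --> p (F x).
  move=> pB pn x.
  apply: (squeeze_cvgr (f := fun k => p (F x) - normc (F_ k x - F x))
    (h := fun k => p (F x) + normc (F_ k x - F x))).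
  - near=> k; have := le_trans (pn (F_ k x - F x)) (lexx _).
    rewrite -pB ler_distlC => /andP[h1 h2]; apply/andP; split.
      by rewrite lerBlDr.
    by rewrite -lerBlDr.
  - have h : (fun k => p (F x) - normc (F_ k x - F x)) @ \oo --> p (F x) - 0.
      by apply: cvgB; [exact: cvg_cst|exact: cv].
    by rewrite subr0 in h.
  - have h : (fun k => p (F x) + normc (F_ k x - F x)) @ \oo --> p (F x) + 0.
      by apply: cvgD; [exact: cvg_cst|exact: cv].
    by rewrite addr0 in h.
have EC (u v : R[i]) : complex.Re u = complex.Re v -> complex.Im u = complex.Im v -> u = v.
  by case: u v => x y [x' y'] /= -> ->.
apply: EC.
  apply: (Rint_limit (f_ := fun k x => complex.Re (F_ k x)) _ _ _ mG Gfin).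
  - by move=> k; exact: mReC.
  - exact: mReC.
  - by move=> k x; exact: le_trans (normRe_le _) (FG k x).
  - by apply: sq; [move=> u v; rewrite raddfB|exact: normRe_le].
  - by move=> k; rewrite -(Fa k).
apply: (Rint_limit (f_ := fun k x => complex.Im (F_ k x)) _ _ _ mG Gfin).
- by move=> k; exact: mImC.
- exact: mImC.
- by move=> k x; exact: le_trans (normIm_le _) (FG k x).
- by apply: sq; [move=> u v; rewrite raddfB|exact: normIm_le].
- by move=> k; rewrite -(Fa k).
Unshelve. all: by end_near. Qed.

End cint_limit.

Section geometric.
Context {R : realType}.
Implicit Types q a b : R[i].

Lemma normc_subX a b (m : R) k : 1 <= m -> normc a <= m -> normc b <= m ->
  normc (a ^+ k - b ^+ k) <= k%:R * m ^+ k * normc (a - b).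
Proof.
move=> m1 am bm; elim: k => [|k IH]; first by rewrite subrr normc0 !mul0r.
have m0 : 0 <= m by exact: le_trans m1.
have -> : a ^+ k.+1 - b ^+ k.+1 = a * (a ^+ k - b ^+ k) + (a - b) * b ^+ k.
  by rewrite !exprS; ring.
apply: (le_trans (le_normcD _ _)); rewrite !normcM normcX.
have bk : normc b ^+ k <= m ^+ k.+1.
  apply: (@le_trans _ _ (m ^+ k)); first by rewrite lerXn2r ?nnegrE ?normc_ge0.
  by rewrite exprS ler_peMl// exprn_ge0.
have D0 := normc_ge0 (a - b).
have h1 : normc a * normc (a ^+ k - b ^+ k) <= m * (k%:R * m ^+ k * normc (a - b)).
  by apply: ler_pM => //; exact: normc_ge0.
have h2 : normc (a - b) * normc b ^+ k <= normc (a - b) * m ^+ k.+1.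
  exact: ler_wpM2l.
apply: (le_trans (lerD h1 h2)); rewrite -natr1 exprS.
by rewrite le_eqVlt; apply/orP; left; apply/eqP; ring.
Qed.

Definition geo q (k : nat) : R[i] := \sum_(i < k) q ^+ i.

Lemma geo_mul q k : (1 - q) * geo q k = 1 - q ^+ k.
Proof.
elim: k => [|k IH]; first by rewrite /geo big_ord0 mulr0 expr0 subrr.
by rewrite /geo big_ord_recr /= -/(geo q k) mulrDr IH exprS; ring.
Qed.

Lemma one_sub_neq0 q : normc q < 1 -> 1 - q != 0.
Proof.
move=> q1; rewrite subr_eq0; apply/eqP => q1E; move: q1.
by rewrite -q1E normc1 ltxx.
Qed.

Lemma normc_geo_le q k : normc q < 1 -> normc (geo q k) <= (1 - normc q)^-1.
Proof.
move=> q1; have d0 : 0 < 1 - normc q by rewrite subr_gt0.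
rewrite /geo; apply: (le_trans (normc_sum _ _)).
under eq_bigr do rewrite normcX.
elim: k => [|k IH]; first by rewrite big_ord0 invr_ge0 ltW.
rewrite big_ord_recl expr0.
under eq_bigr do rewrite exprS.
rewrite -mulr_sumr.
have -> : (1 - normc q)^-1 = 1 + normc q * (1 - normc q)^-1.
  by field; rewrite lt0r_neq0.
by rewrite lerD2l ler_wpM2l ?normc_ge0.
Qed.

Lemma normc_inv_one_sub_le q : normc q < 1 -> normc (1 - q)^-1 <= (1 - normc q)^-1.
Proof.
move=> q1; have d0 : 0 < 1 - normc q by rewrite subr_gt0.
have h : 1 - normc q <= normc (1 - q).
  by have := le_normcB 1 (- q); rewrite normc1 normcN.
by rewrite normcV lef_pV2 ?posrE// (lt_le_trans d0).
Qed.

Lemma geo_cvg q (N : nat) : normc q < 1 ->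
  (fun k => normc (geo q k ^+ N - (1 - q) ^- N)) @ \oo --> (0 : R).
Proof.
move=> q1; have d0 : 0 < 1 - normc q by rewrite subr_gt0.
have n0 := one_sub_neq0 q1.
pose m := (1 - normc q)^-1.
have m1 : 1 <= m by rewrite /m invf_ge1// lerBlDr lerDl normc_ge0.
pose C := N%:R * m ^+ N * m.
have m0 : 0 <= m by exact: le_trans m1.
apply: (squeeze_cvgr (f := fun=> 0) (h := fun k => C * normc q ^+ k)).
- near=> k; rewrite normc_ge0 /= -exprVn.
  apply: (le_trans (normc_subX N m1 (normc_geo_le k q1) (normc_inv_one_sub_le q1))).
  have -> : geo q k - (1 - q)^-1 = - (q ^+ k * (1 - q)^-1).
    apply: (mulfI n0); rewrite mulrBr geo_mul divff// mulrN mulrCA divff// mulr1.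
    by ring.
  rewrite normcN normcM normcX /C -!mulrA; do 2 (apply: ler_wpM2l; first by rewrite ?exprn_ge0).
  rewrite mulrC; apply: ler_wpM2r; first by rewrite exprn_ge0 ?normc_ge0.
  exact: normc_inv_one_sub_le.
- exact: cvg_cst.
- rewrite -(mulr0 C); apply: cvgM; first exact: cvg_cst.
  by apply: cvg_expr; rewrite ger0_norm ?normc_ge0.
Unshelve. all: by end_near. Qed.

End geometric.

Section mean_value.
Context {R : realType} (n : nat).
Let leb := (@lebesgue_measure R).
Let X := (n.-tuple R[i] * measurableTypeR R)%type.

Definition rotb (a : R) (x : X) : X := (map_tuple ( *%R (cis a)) x.1, x.2).

Lemma bW_rot a x : bW (rotb a x) = bW x.
Proof. by rewrite /bW /rotb /= sqnorm_map normc_cis expr1n mul1r. Qed.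

Lemma hdot_rot a (v : n.-tuple R[i]) x :
  hdot v (rotb a x).1 = cis (- a) * hdot v x.1.
Proof.
rewrite /hdot mulr_sumr; apply: eq_bigr => j _.
by rewrite tnth_map rmorphM /= -conj_cis mulrCA.
Qed.

Lemma chvar_rotb a : sin a != 0 -> chvar (bmu n) (bmu n) (rotb a) (fun=> 1).
Proof.
move=> sa; have i1 : chvar leb leb id (fun=> 1).
  by apply: chvar_eq (chvar_translate 0) => // x; rewrite addr0.
have := @chvar_prod R _ _ _ _ (lebesgueCn R n) leb _ _ _ _
  (chvar_mapCn n ler01 (chvar_rotC sa)) i1.
by apply: chvar_eq => // x; rewrite expr1n mulr1.
Qed.

Lemma measurable_hdot (v : n.-tuple R[i]) : measurable_fun setT (hdot v).
Proof.
rewrite /hdot; apply: msumC => j; apply: mMC; first exact: measurable_cst.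
by apply: mJC; exact: measurable_tnth.
Qed.

Lemma cint_sum m' (I : Type) (r : seq I) (F : I -> X -> R[i]) :
  (forall i, cintegrable m' (F i)) ->
  cintegrable m' (fun x => \sum_(i <- r) F i x) /\
  cint m' (fun x => \sum_(i <- r) F i x) = \sum_(i <- r) cint m' (F i).
Proof.
move=> iF; elim: r => [|i r [ir er]].
  under eq_fun do rewrite big_nil; rewrite big_nil; split; last exact: cint0.
  by split => //; under eq_integral do rewrite normc0; rewrite integral0.
have -> : (fun x => \sum_(j <- i :: r) F j x) = (fun x => F i x + \sum_(j <- r) F j x).
  by apply/funext => x; rewrite big_cons.
split; first exact: cintegrableD.
by rewrite cintD// er big_cons.
Qed.

Variables (al be : R).
Hypotheses (al0 : 0 < al) (be0 : 0 < be) (NE : al + be = n.+1%:R).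
Variables (v : n.-tuple R[i]) (z : R[i]) (c : R).
Hypotheses (c0 : 0 < c).
Hypothesis lower : forall x : X,
  c * (1 + brad x) <= normc (bW x + z) - 2 * normc (hdot v x.1).

Let D (x : X) : R[i] := bW x + z.
Let h (x : X) : R[i] := 2%:R * hdot v x.1.
Let q (x : X) : R[i] := h x / D x.
Let g (x : X) : R[i] := D x ^- n.+1 * hom_test al be (bW x).

Let low_pos (x : X) : 0 < c * (1 + brad x).
Proof. by rewrite mulr_gt0// ltr_wpDr// brad_ge0. Qed.

Let normch x : normc (h x) = 2 * normc (hdot v x.1).
Proof. by rewrite normcM -(rmorph_nat (real_complex R)) normcR normr_nat. Qed.

Let D_gt x : normc (h x) < normc (D x).
Proof. by have := low_pos x; have := lower x; rewrite -normch; rewrite /D; lra. Qed.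

Let D_pos x : 0 < normc (D x).
Proof. exact: le_lt_trans (normc_ge0 _) (D_gt x). Qed.

Let D_neq0 x : D x != 0.
Proof. by rewrite -normc_eq0 gt_eqF. Qed.

Let normcq x : normc (q x) = normc (h x) / normc (D x).
Proof. by rewrite normcM normcV. Qed.

Let q_lt1 x : normc (q x) < 1.
Proof. by rewrite normcq ltr_pdivrMr// mul1r D_gt. Qed.

Let low_D x : c * (1 + brad x) <= normc (D x).
Proof.
by apply: le_trans (lower x) _; rewrite lerBlDr lerDl -normch normc_ge0.
Qed.

Let ig : cintegrable (bmu n) g.
Proof. exact: (hom_kernel_cintegrable al0 be0 NE c0 low_D). Qed.

Let mD : measurable_fun setT D.
Proof. by apply: mDC; [exact: measurable_bW|exact: measurable_cst]. Qed.

Let mq : measurable_fun setT q.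
Proof.
apply: mMC; last exact: mVC.
apply: mMC; first exact: measurable_cst.
exact: (measurableT_comp (measurable_hdot v) measurable_fst).
Qed.

Let mg : measurable_fun setT g. Proof. by case: ig. Qed.

Let igq k : cintegrable (bmu n) (fun x => g x * q x ^+ k).
Proof.
case: ig => _ gfin; split; first by apply: mMC => //; exact: mXC.
apply: le_lt_trans gfin; apply: ge0_le_integral_nonmeas => x.
  by rewrite lee_fin normc_ge0.
rewrite lee_fin normcM ler_piMr ?normc_ge0// normcX.
by rewrite exprn_ile1 ?normc_ge0// ltW.
Qed.

(** Rotating [x.1] by pi / (2(k+1)) preserves the measure and multiplies the
    integrand by -i. *)
Let cint_gq k : cint (bmu n) (fun x => g x * q x ^+ k.+1) = 0.
Proof.
pose a : R := pi / (2 * k.+1%:R).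
have k0 : 0 < k.+1%:R :> R by rewrite ltr0n.
have k1 : 1 <= k.+1%:R :> R by rewrite ler1n.
have P := @pi_gt0 R.
have a0 : 0 < a by rewrite divr_gt0// mulr_gt0.
have api : a < pi by rewrite /a ltr_pdivrMr ?mulr_gt0//; nra.
have sa : sin a != 0 by rewrite gt_eqF// sin_gt0_pi// a0.
have E := chvar_cint (chvar_rotb sa) (igq k.+1).
have ak : - a * k.+1%:R = - (pi / 2).
  by rewrite /a; field; rewrite gt_eqF.
have F x : (1 : R)%:C * (g (rotb a x) * q (rotb a x) ^+ k.+1) =
    cis (- (pi / 2)) * (g x * q x ^+ k.+1).
  rewrite /g /q /h /D bW_rot hdot_rot mul1r -ak cisM_nat.
  set t := cis (- a); set hh := hdot v x.1; set dd := (bW x + z)^-1.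
  have -> : 2%:R * (t * hh) * dd = t * (2%:R * hh * dd) by ring.
  by rewrite exprMn; ring.
move: E; under [X in _ = X -> _]eq_cint do rewrite F.
rewrite (cintZ _ (igq k.+1)); set I := cint _ _ => E.
have : (1 - cis (- (pi / 2))) * I = 0 by rewrite mulrBl mul1r -E subrr.
move/eqP; rewrite mulf_eq0 => /orP[|/eqP//].
rewrite subr_eq0 eq_complex /= cosN cos_pihalf => /andP[/eqP o1 _].
by move: (oner_neq0 R); rewrite o1 eqxx.
Qed.

Let cint_gpoly (p : {poly R[i]}) : cintegrable (bmu n) (fun x => g x * p.[q x]) /\
  cint (bmu n) (fun x => g x * p.[q x]) = p`_0 * cint (bmu n) g.
Proof.
have -> : (fun x => g x * p.[q x]) =
    (fun x => \sum_(i < size p) p`_i * (g x * q x ^+ i)).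
  apply/funext => x; rewrite horner_coef mulr_sumr; apply: eq_bigr => i _.
  by rewrite mulrCA.
have [|H1 H2] := @cint_sum (bmu n) _ (index_enum 'I_(size p))
    (fun i x => p`_i * (g x * q x ^+ i)).
  by move=> i; apply: cintegrableZ; exact: igq.
split=> //; rewrite H2 (eq_bigr (fun i : 'I_(size p) =>
    p`_i * cint (bmu n) (fun x => g x * q x ^+ i))); last first.
  by move=> i _; rewrite (cintZ _ (igq i)).
have [s0|s0] := posnP (size p).
  have -> : p = 0 by apply/eqP; rewrite -size_poly_eq0 s0.
  by rewrite size_poly0 big_ord0 coef0 mul0r.
rewrite (bigD1 (Ordinal s0))//= big1 ?addr0.
  by congr (_ * _); apply: eq_cint => x; rewrite expr0 mulr1.
move=> [[|i] hi] /eqP ne; first by case: ne; exact: val_inj.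
by rewrite /= cint_gq mulr0.
Qed.

(** Averaged over the rotations of [x.1], the kernel only keeps the constant term
    of its expansion in [hdot v x.1]. The N-th powers of the partial sums of the
    geometric series serve as approximating polynomials, because they are
    dominated by the N-th power of the sum of the moduli. *)
Lemma cint_mean_value :
  cintegrable (bmu n) (fun x => (D x - h x) ^- n.+1 * hom_test al be (bW x)) /\
  cint (bmu n) (fun x => (D x - h x) ^- n.+1 * hom_test al be (bW x)) =
  cint (bmu n) g.
Proof.
have KE x : (D x - h x) ^- n.+1 * hom_test al be (bW x) = g x * (1 - q x) ^- n.+1.
  have -> : D x - h x = D x * (1 - q x).
    by rewrite mulrBr mulr1 /q mulrCA divff ?mulr1// D_neq0.
  by rewrite exprMn invfM /g; ring.
have -> : (fun x => (D x - h x) ^- n.+1 * hom_test al be (bW x)) =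
    (fun x => g x * (1 - q x) ^- n.+1) by apply/funext.
pose G (x : X) : R := c ^- n.+1 * dom_fun al x.
have qD x : 1 - normc (q x) = (normc (D x) - normc (h x)) / normc (D x).
  by rewrite normcq mulrBl divff// gt_eqF.
have GB x : normc (g x) * (1 - normc (q x)) ^- n.+1 <= G x.
  rewrite /g normcM normc_hom_test normcV normcX /G /dom_fun mulrA.
  rewrite mulrAC; apply: ler_wpM2r; first exact: powR_ge0.
  rewrite qD -!invfM -!exprMn mulrCA divff ?mulr1 ?gt_eqF//.
  by apply: le_invX => //; rewrite normch; exact: lower.
have mG : measurable_fun setT G.
  by apply: measurable_funM => //; exact: measurable_dom_fun.
have mK : measurable_fun setT (fun x => g x * (1 - q x) ^- n.+1).
  apply: mMC => //; apply: mVC; apply: mXC; apply: mDC; first exact: measurable_cst.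
  exact: mNC.
have KG x : normc (g x * (1 - q x) ^- n.+1) <= G x.
  apply: le_trans (GB x); rewrite normcM; apply: ler_wpM2l; first exact: normc_ge0.
  rewrite -!exprVn normcX; apply: lerXn2r; rewrite ?nnegrE ?normc_ge0//.
    by rewrite invr_ge0 subr_ge0 ltW.
  exact: normc_inv_one_sub_le.
have cc0 : 0 <= c ^- n.+1 by rewrite invr_ge0 exprn_ge0// ltW.
have iK := dom_cintegrable al0 be0 NE cc0 mK KG.
split=> //.
have Gfin : (\int[bmu n]_x (G x)%:E < +oo)%E.
  have md : measurable_fun setT (fun x => (@dom_fun R n al x)%:E).
    by apply/measurable_EFinP; exact: measurable_dom_fun.
  rewrite (ge0_integralZl_EFin _ measurableT _ md cc0).
    by rewrite lte_mul_pinfty// ?(dom_fun_lty al0 be0 NE)// lee_fin.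
  by move=> x _; rewrite lee_fin dom_fun_ge0.
have geoP k : exists2 p : {poly R[i]}, p`_0 = 1 &
    forall w, p.[w] = geo w k.+1 ^+ n.+1.
  exists ((\sum_(i < k.+1) 'X^i) ^+ n.+1).
    rewrite -horner_coef0 horner_exp horner_sum big_ord_recl expr0 hornerC.
    rewrite big1 ?addr0 ?expr1n// => i _.
    by rewrite hornerXn expr0n.
  move=> w; rewrite horner_exp horner_sum /geo; congr (_ ^+ _).
  by apply: eq_bigr => i _; rewrite hornerXn.
apply: (@cint_limit R _ _ (bmu n) (fun k x => g x * geo (q x) k.+1 ^+ n.+1) _ G).
- move=> k; apply: mMC => //; apply: mXC; rewrite /geo.
  by apply: msumC => i; exact: mXC.
- exact: mK.
- move=> k x; apply: le_trans (GB x); rewrite normcM; apply: ler_wpM2l.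
    exact: normc_ge0.
  rewrite normcX -exprVn; apply: lerXn2r; rewrite ?nnegrE ?normc_ge0//.
    by rewrite invr_ge0 subr_ge0 ltW.
  exact: normc_geo_le.
- exact: mG.
- exact: Gfin.
- move=> x; have cv := @geo_cvg R (q x) n.+1 (q_lt1 x).
  have -> : (fun k => normc (g x * geo (q x) k.+1 ^+ n.+1 - g x * (1 - q x) ^- n.+1)) =
     (fun k => normc (g x) * normc (geo (q x) k.+1 ^+ n.+1 - (1 - q x) ^- n.+1)).
    by apply/funext => k; rewrite -mulrBr normcM.
  rewrite -(mulr0 (normc (g x))); apply: cvgM; first exact: cvg_cst.
  by have := cv; rewrite -(cvg_shiftS).
- move=> k; have [p p0 pE] := geoP k; have [_ e] := cint_gpoly p.
  rewrite -[RHS]mul1r -p0 -e; apply: eq_cint => x.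
  by rewrite pE.
Qed.

End mean_value.

(** * The kernel at height one above the boundary *)

Section kernel.
Context {R : realType} (n : nat).
Let X := (n.-tuple R[i] * measurableTypeR R)%type.

(** This is -i z_(n+1); on the boundary it is the conjugate of [bW]. *)
Definition cZ (z : Defs.cpoint R n) : R[i] := complex.Im z.2 +i* (- complex.Re z.2).

Lemma rho_param (z : Defs.cpoint R n) (x : X) :
  rho z (bsiegel_param x) = (bW x + cZ z - 2%:R * hdot z.1 x.1) / 2%:R.
Proof.
rewrite /rho; set H := hdot _ _.
have -> : bW x + cZ z = (0 +i* 1) * (conjc (bsiegel_param x).2 - z.2).
  rewrite /bW /cZ /bsiegel_param /=; case: z.2 => a b; apply/eqP.
  by rewrite eq_complex /=; apply/andP; split; apply/eqP; ring.
have n2 : (2%:R : R[i]) != 0 by rewrite pnatr_eq0.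
rewrite mulrBl [2%:R * hdot _ _ / _]mulrAC divff// mul1r mulrAC.
by congr (_ - _).
Qed.

(** The weight [e] will be chosen according to which of the two points is farther
    from the origin. *)
Lemma hdot_le (e : R) (a b : n.-tuple R[i]) : 0 < e ->
  2 * normc (hdot a b) <= e * sqnorm a + e^-1 * sqnorm b.
Proof.
move=> e0; rewrite /hdot /sqnorm !mulr_sumr -big_split /=.
apply: (@le_trans _ _ (\sum_(j < n) 2 * (normc (tnth a j) * normc (tnth b j)))).
  rewrite -mulr_sumr ler_wpM2l//; apply: (le_trans (normc_sum _ _)).
  by apply: ler_sum => j _; rewrite normcM normc_conjc.
apply: ler_sum => j _; set s := normc _; set t := normc _.
have -> : e * s ^+ 2 + e^-1 * t ^+ 2 = e^-1 * (e * s - t) ^+ 2 + 2 * (s * t).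
  by field; rewrite gt_eqF.
by rewrite lerDr mulr_ge0 ?invr_ge0 ?sqr_ge0// ltW.
Qed.

(** The Hardy norm is a supremum over heights, and height one is enough for a
    lower bound. *)
Definition lift1 (y : X) : Defs.cpoint R n := vshift 1 (bsiegel_param y).

Lemma cZ_lift1 (y : X) : cZ (lift1 y) = (sqnorm y.1 + 1) +i* (- y.2).
Proof. by rewrite /cZ /lift1 /vshift /= addr0. Qed.

Let Zn (y : X) : R := normc (cZ (lift1 y)).

Lemma brad_le_Zn (y : X) : brad y <= Zn y.
Proof.
rewrite /Zn cZ_lift1 /brad /bW /= ler_wsqrtr// sqrrN lerD2r.
by rewrite lerXn2r ?nnegrE ?addr_ge0 ?sqnorm_ge0// lerDl.
Qed.

Lemma Zn_le (y : X) : Zn y <= brad y + 1.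
Proof.
have -> : Zn y = normc (conjc (bW y) + 1).
  rewrite /Zn cZ_lift1; congr normc.
  by apply/eqP; rewrite eq_complex /= addr0 !eqxx.
by apply: (le_trans (le_normcD _ _)); rewrite normc_conjc normc1.
Qed.

Lemma Re_cZ_lift1 (y : X) : complex.Re (cZ (lift1 y)) = sqnorm y.1 + 1.
Proof. by rewrite cZ_lift1. Qed.

Let gap (y x : X) : R :=
  normc (bW x + cZ (lift1 y)) - 2 * normc (hdot y.1 x.1).

Let Re_bW (x : X) : complex.Re (bW x) = sqnorm x.1. Proof. by []. Qed.

Let sq_x (x : X) : sqnorm x.1 <= brad x.
Proof. by rewrite -Re_bW; exact: Re_le_normc. Qed.

Let sq_y (y : X) : sqnorm y.1 <= Zn y.
Proof.
by apply: le_trans (Re_le_normc _); rewrite Re_cZ_lift1 lerDl.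
Qed.

Lemma gap_ge1 (y x : X) : 1 <= gap y x.
Proof.
have h := hdot_le y.1 x.1 ltr01; rewrite invr1 !mul1r in h.
have h2 := Re_le_normc (bW x + cZ (lift1 y)).
have e : complex.Re (bW x + cZ (lift1 y)) = sqnorm x.1 + (sqnorm y.1 + 1).
  by rewrite cZ_lift1.
by rewrite e in h2; rewrite /gap; lra.
Qed.

(** With the weight 6, the terms of [hdot_le] are at most 1/6 and 6/36 of the
    dominant modulus; together with the other modulus, at most 1/36 of it, they
    leave more than a half. *)
Lemma gap_near (y x : X) : 36 * brad x <= Zn y -> Zn y / 2 <= gap y x.
Proof.
move=> h; have h1 := @hdot_le 6^-1 y.1 x.1 ltac:(by rewrite invr_gt0).
rewrite invrK in h1.
have h2 := le_normcB (cZ (lift1 y)) (bW x); rewrite [cZ _ + _]addrC -/(Zn y) -/(brad x) in h2.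
have := sq_x x; have := sq_y y; have := brad_ge0 x; rewrite /gap => *; lra.
Qed.

Lemma gap_far (y x : X) : 36 * Zn y <= brad x -> brad x / 2 <= gap y x.
Proof.
move=> h; have h1 := @hdot_le 6 y.1 x.1 ltac:(by []).
have h2 := le_normcB (bW x) (cZ (lift1 y)); rewrite -/(Zn y) -/(brad x) in h2.
have := sq_x x; have := sq_y y; have := brad_ge0 x; rewrite /gap => *; lra.
Qed.

(** This keeps [rho] away from zero with the right growth, which is what the
    integrability of the kernel requires. *)
Lemma gap_lower (y : X) : exists2 c, 0 < c &
  forall x, c * (1 + brad x) <= gap y x.
Proof.
have Z0 : 0 <= Zn y by exact: normc_ge0.
exists (3 * (1 + 36 * Zn y))^-1; first by rewrite invr_gt0; nra.
move=> x; have g1 := gap_ge1 y x; have b0 := brad_ge0 x.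
rewrite mulrC ler_pdivrMr; last by nra.
case: (lerP (36 * Zn y) (brad x)) => h; last by nra.
have := gap_far h; nra.
Qed.

End kernel.

(** * Mass near the origin and near infinity *)

Section truncated.
Context {R : realType} (n : nat).
Let X := (n.-tuple R[i] * measurableTypeR R)%type.
Variables (al be : R).
Hypotheses (al0 : 0 < al) (be0 : 0 < be) (NE : al + be = n.+1%:R).

Definition dom_mass : R := fine (\int[bmu n]_x (@dom_fun R n al x)%:E).

Lemma dom_massE : (\int[bmu n]_x (@dom_fun R n al x)%:E = dom_mass%:E)%E.
Proof.
rewrite /dom_mass fineK// ge0_fin_numE; first exact: (dom_fun_lty al0 be0 NE).
by apply: integral_ge0 => x _; rewrite lee_fin dom_fun_ge0.
Qed.

Lemma dom_mass_ge0 : 0 <= dom_mass.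
Proof.
rewrite fine_ge0//; apply: integral_ge0 => x _; rewrite lee_fin.
exact: dom_fun_ge0.
Qed.

Let measurable_dom : measurable_fun setT (fun x => (@dom_fun R n al x)%:E).
Proof. by apply/measurable_EFinP; exact: measurable_dom_fun. Qed.

Lemma ge0_integral_le_dom (f : X -> R) (C : R) : 0 <= C ->
  (forall x, 0 <= f x <= C * dom_fun al x) ->
  (\int[bmu n]_x (f x)%:E <= (C * dom_mass)%:E)%E.
Proof.
move=> C0 fC; rewrite EFinM -dom_massE -(ge0_integralZl_EFin _ measurableT _ measurable_dom C0).
  apply: ge0_le_integral_nonmeas => x; rewrite lee_fin; by case/andP: (fC x).
by move=> x _; rewrite lee_fin dom_fun_ge0.
Qed.

Lemma inner_mass :
  (\int[bmu n]_x (if brad x < 1 then brad x `^ (- al) else 0)%:E <=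
   (2 ^+ n.+1 * dom_mass)%:E)%E.
Proof.
apply: ge0_integral_le_dom => [|x]; first exact: exprn_ge0.
case: ifP => r1; last first.
  by rewrite lexx mulr_ge0 ?exprn_ge0 ?dom_fun_ge0.
rewrite powR_ge0/= /dom_fun mulrA ler_peMl ?powR_ge0//.
rewrite -[X in X <= _](mulfV (x := 2 ^+ n.+1)) ?expf_neq0//.
rewrite ler_pM2l ?exprn_gt0// le_invX//; last by lra.
by rewrite ltr_wpDr ?brad_ge0.
Qed.

(** Dilating by [M] leads to M = 1, and on that domain [brad] and [1 + brad] are
    comparable. *)
Lemma outer_mass (M : R) : 0 < M ->
  (\int[bmu n]_x (if M <= brad x then brad x ^- n.+1 * brad x `^ (- al) else 0)%:E <=
   (M `^ (- al) * (2 ^+ n.+1 * dom_mass))%:E)%E.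
Proof.
move=> M0; have [_ _ _ ->] := chvar_dilb n M0; first last.
- move=> x; rewrite lee_fin; case: ifP => // _.
  by rewrite mulr_ge0 ?powR_ge0// invr_ge0 exprn_ge0// brad_ge0.
- apply/measurable_EFinP; apply: mifR.
    by apply: measurable_fun_ler => //; exact: measurable_brad.
  apply: measurable_funM; last first.
    by apply: (measurableT_comp (measurable_powR (- al))); exact: measurable_brad.
  by apply: mVR; apply: measurable_funX; exact: measurable_brad.
rewrite mulrA; under eq_integral do rewrite -EFinM.
apply: ge0_integral_le_dom => [|x]; first by rewrite mulr_ge0 ?powR_ge0 ?exprn_ge0.
rewrite brad_dil// ler_pMr//; have := brad_ge0 x; case: ifP => r1 r0; last first.
  rewrite mulr0 lexx/=; apply: mulr_ge0; last exact: dom_fun_ge0.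
  by rewrite mulr_ge0 ?exprn_ge0 ?powR_ge0.
rewrite /dom_fun (powRM _ (ltW M0) r0) (powR_mulrn _ (ltW M0)) exprMn invfM.
apply/andP; split.
  by rewrite !mulr_ge0 ?invr_ge0 ?exprn_ge0 ?powR_ge0 ?ltW// (lt_le_trans ltr01).
have MN : M ^+ n.+1 * M ^- n.+1 = 1 by rewrite mulfV// expf_neq0// gt_eqF.
rewrite 2!mulrA [M ^+ _ * _]mulrA MN mul1r [_ * M `^ _]mulrC -!mulrA.
rewrite ler_wpM2l ?powR_ge0// [X in _ <= X]mulrA ler_wpM2r ?powR_ge0//.
have rp : 0 < brad x by rewrite (lt_le_trans ltr01).
rewrite -[2 ^+ _]invrK -invfM -(exprVn 2) -exprMn le_invX//; lra.
Qed.

End truncated.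

Section small_lemmas.
Context {R : realType} d (T : measurableType d) (m : {measure set T -> \bar R}).
Implicit Types f : T -> R[i].

Lemma le_powRN (a x y : R) : 0 <= a -> 0 < x -> x <= y -> y `^ (- a) <= x `^ (- a).
Proof.
move=> a0 x0 xy; have y0 := lt_le_trans x0 xy.
by rewrite !powRN lef_pV2 ?posrE ?powR_gt0// ge0_ler_powR// nnegrE ltW.
Qed.

Lemma mifC (b : T -> bool) f : measurable_fun setT b ->
  measurable_fun setT f -> measurable_fun setT (fun x => if b x then f x else 0).
Proof. by move=> mb mf; apply: measurable_fun_if => //; apply: measurable_funTS. Qed.

Lemma cintegrable_if (b : T -> bool) f : measurable_fun setT b ->
  cintegrable m f -> cintegrable m (fun x => if b x then f x else 0).
Proof.
move=> mb [mf fi]; split; first exact: mifC.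
apply: le_lt_trans fi; apply: ge0_le_integral_nonmeas => x; rewrite lee_fin.
  exact: normc_ge0.
by case: ifP => // _; rewrite normc0 normc_ge0.
Qed.

Lemma normc_cint_leM f (g : T -> R) (C I : R) : cintegrable m f ->
  measurable_fun setT g -> 0 <= C -> (forall x, 0 <= g x) ->
  (forall x, normc (f x) <= C * g x) -> (\int[m]_x (g x)%:E <= I%:E)%E ->
  normc (cint m f) <= 2 * (C * I).
Proof.
move=> fi mg C0 g0 fg gI; apply: normc_cint_le => //.
have mg' : measurable_fun setT (fun x => (g x)%:E) by exact/measurable_EFinP.
apply: (@le_trans _ _ (\int[m]_x (C * g x)%:E)%E).
  by apply: ge0_le_integral_nonmeas => x; rewrite lee_fin ?normc_ge0.
under eq_integral do rewrite EFinM.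
rewrite (ge0_integralZl_EFin _ measurableT _ mg' C0) ?EFinM ?lee_wpmul2l//.
by move=> x _; rewrite lee_fin.
Qed.

End small_lemmas.

(** * The kernel integrated over a shell *)

Section lower_bound.
Context {R : realType} (n : nat).
Let X := (n.-tuple R[i] * measurableTypeR R)%type.
Variables (al be : R).
Hypotheses (al0 : 0 < al) (be0 : 0 < be) (NE : al + be = n.+1%:R).

Let mbrad : measurable_fun setT (@brad R n). Proof. exact: measurable_brad. Qed.

Section one_point.
Variables (M K : R) (y : X).
Hypotheses (K72 : 72 <= K) (Ky : K <= brad y) (yM : K * brad y <= M).

Let z := cZ (lift1 y).
Let Z := normc z.
Let r := brad y.
Let D (x : X) : R[i] := bW x + z - 2%:R * hdot y.1 x.1.
Let F (x : X) : R[i] := D x ^- n.+1 * hom_test al be (bW x).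
Let E := dom_mass n al.

Let K0 : 0 < K. Proof. by move: K72; lra. Qed.
Let r0 : 0 < r. Proof. exact: lt_le_trans Ky. Qed.
Let rZ : r <= Z. Proof. exact: brad_le_Zn. Qed.
Let Zr : Z <= r * (1 + K^-1).
Proof.
apply: (le_trans (Zn_le y)); rewrite mulrDr mulr1 lerD2l.
by rewrite ler_pdivlMr ?mul1r.
Qed.
Let Z0 : 0 < Z. Proof. exact: lt_le_trans rZ. Qed.
Let Z36 : 36 <= Z. Proof. move: K72 Ky rZ; rewrite -/r; lra. Qed.
Let ZM : 36 * Z <= M.
Proof.
have h : K^-1 <= 1 by rewrite invf_le1//; move: K72; lra.
have K1 : 0 < K^-1 by rewrite invr_gt0.
move: K72 yM Zr r0; rewrite -/r; nra.
Qed.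

Let D_ge x : normc (bW x + z) - 2 * normc (hdot y.1 x.1) <= normc (D x).
Proof.
have := le_normcB (bW x + z) (- (2%:R * hdot y.1 x.1)).
by rewrite normcN normcM -(rmorph_nat (real_complex R)) normcR normr_nat rmorph_nat.
Qed.

Let D_inner x : brad x < 1 -> Z / 2 <= normc (D x).
Proof.
move=> x1; apply: le_trans (D_ge x); apply: gap_near; rewrite -/z -/Z.
move: Z36; lra.
Qed.

Let D_outer x : M <= brad x -> brad x / 2 <= normc (D x).
Proof. by move=> x1; apply: le_trans (D_ge x); apply: gap_far; exact: le_trans x1. Qed.

Let intF : cintegrable (bmu n) F /\
  normc (cint (bmu n) F) = bmass n * beta_const n al be * Z `^ (- al).
Proof.
have [c c0 low] := gap_lower y.
have [iF ->] := cint_mean_value al0 be0 NE c0 low; split=> //.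
have low' (x : X) : c * (1 + brad x) <= normc (bW x + z).
  by apply: (le_trans (low x)); rewrite gerBl mulr_ge0 ?normc_ge0.
have Rez : 0 < complex.Re z.
  by rewrite /z cZ_lift1 /= ltr_wpDl ?sqnorm_ge0.
rewrite (cint_hom_kernel al0 be0 NE Rez c0 low').
rewrite normcM normc_cis mulr1 normcR ger0_norm//.
rewrite mulr_ge0 ?powR_ge0// mulr_ge0 ?(ltW (bmass_gt0 _))//.
by rewrite /beta_const divr_ge0 ?mulr_ge0// ltW// Gamma_gt0// ltr0n.
Qed.

Let ifF (b : X -> bool) : measurable_fun setT b ->
  cintegrable (bmu n) (fun x => if b x then F x else 0).
Proof. by move=> mb; apply: cintegrable_if => //; case: intF. Qed.

Let mlt1 : measurable_fun setT (fun x : X => brad x < 1).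
Proof. exact: measurable_fun_ltr. Qed.
Let mge1 : measurable_fun setT (fun x : X => 1 <= brad x).
Proof. exact: measurable_fun_ler. Qed.
Let mltM : measurable_fun setT (fun x : X => brad x < M).
Proof. exact: measurable_fun_ltr. Qed.
Let mgeM : measurable_fun setT (fun x : X => M <= brad x).
Proof. exact: measurable_fun_ler. Qed.

Let mbpow : measurable_fun setT (fun x : X => brad x `^ (- al)).
Proof. exact: (measurableT_comp (measurable_powR (- al)) mbrad). Qed.

Let inner : normc (cint (bmu n) (fun x => if brad x < 1 then F x else 0)) <=
  2 * ((Z / 2) ^- n.+1 * (2 ^+ n.+1 * E)).
Proof.
apply: (normc_cint_leM (g := fun x => if brad x < 1 then brad x `^ (- al) else 0)
  (ifF mlt1)); first exact: (mifR mlt1 mbpow).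
- by rewrite invr_ge0 exprn_ge0// divr_ge0// ltW.
- by move=> x; case: ifP => // _; exact: powR_ge0.
- move=> x; case: ifP => x1; last by rewrite normc0 mulr0.
  rewrite /F normcM normc_hom_test normcV normcX ler_wpM2r ?powR_ge0// le_invX ?divr_gt0//.
  exact: D_inner.
- exact: (inner_mass al0 be0 NE).
Qed.

Let outer : normc (cint (bmu n) (fun x => if M <= brad x then F x else 0)) <=
  2 * (2 ^+ n.+1 * (M `^ (- al) * (2 ^+ n.+1 * E))).
Proof.
have M0 : 0 < M by apply: lt_le_trans ZM; rewrite mulr_gt0.
apply: (normc_cint_leM (g := fun x =>
  if M <= brad x then brad x ^- n.+1 * brad x `^ (- al) else 0) (ifF mgeM)).
- apply: (mifR mgeM); apply: measurable_funM => //.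
  by apply: mVR; apply: measurable_funX.
- exact: exprn_ge0.
- move=> x; case: ifP => // _.
  by rewrite mulr_ge0 ?powR_ge0// invr_ge0 exprn_ge0// brad_ge0.
- move=> x; case: ifP => x1; last by rewrite normc0 mulr0.
  have b0 : 0 < brad x by exact: lt_le_trans x1.
  rewrite /F normcM normc_hom_test normcV normcX mulrA ler_wpM2r ?powR_ge0//.
  rewrite -[2 ^+ _]invrK -invfM -(exprVn 2) -exprMn le_invX ?mulr_gt0 ?invr_gt0//.
  by rewrite mulrC; exact: D_outer.
- exact: (outer_mass al0 be0 NE M0).
Qed.

Let split_annulus : normc (cint (bmu n) F) -
    normc (cint (bmu n) (fun x => if brad x < 1 then F x else 0)) -
    normc (cint (bmu n) (fun x => if M <= brad x then F x else 0)) <=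
  normc (cint (bmu n) (fun x => if (1 <= brad x) && (brad x < M) then F x else 0)).
Proof.
have i1 := ifF mlt1; have i2 := ifF mgeM.
have i3 := ifF (measurable_and mge1 mltM).
have M1 : 1 < M by move: ZM Z36; lra.
have -> : cint (bmu n) F = cint (bmu n) (fun x =>
    ((if brad x < 1 then F x else 0) + (if M <= brad x then F x else 0)) +
    (if (1 <= brad x) && (brad x < M) then F x else 0)).
  apply: eq_cint => x; case: (ltP (brad x) 1) => x1.
    by rewrite [M <= _]leNgt (lt_trans x1 M1) !addr0.
  by case: leP => x2; rewrite /= ?addr0 ?add0r.
rewrite cintD//; last exact: cintegrableD.
rewrite cintD// -addrA -opprD lerBlDl; apply: (le_trans (le_normcD _ _)).
by rewrite lerD2r le_normcD.
Qed.

(** The modulus of the integral over the whole boundary is known exactly. Inside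
    the shell the kernel has size |Z|^(-N), outside it |W|^(-N), and a safety
    factor [K] from both edges makes the corresponding errors small compared with
    |W(y)|^(-al). The value 72 is twice the ratio required by [gap_near] and
    [gap_far], because |Z| may be twice |W(y)|. *)
Lemma annulus_lower :
  r `^ (- al) * (bmass n * beta_const n al be * (1 + K^-1) `^ (- al) -
    2 * 4 ^+ n.+1 * E * (K `^ (- be) + K `^ (- al))) <=
  normc (cint (bmu n) (fun x => if (1 <= brad x) && (brad x < M) then F x else 0)).
Proof.
apply: le_trans split_annulus; have [_ ->] := intF.
apply: (@le_trans _ _ (bmass n * beta_const n al be * Z `^ (- al) -
  2 * ((Z / 2) ^- n.+1 * (2 ^+ n.+1 * E)) -
  2 * (2 ^+ n.+1 * (M `^ (- al) * (2 ^+ n.+1 * E))))); last first.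
  by rewrite lerB// lerB.
have E0 : 0 <= E by exact: dom_mass_ge0.
have e1 : r `^ (- al) * (1 + K^-1) `^ (- al) <= Z `^ (- al).
  rewrite -powRM ?(ltW r0)//; last by rewrite addr_ge0// invr_ge0 ltW.
  by apply: le_powRN; rewrite ?(ltW al0).
have e2 : M `^ (- al) <= r `^ (- al) * K `^ (- al).
  rewrite -powRM ?(ltW r0) ?(ltW K0)//; apply: le_powRN => //; first exact: ltW.
    by rewrite mulr_gt0.
  by rewrite mulrC.
have e3 : Z ^- n.+1 <= r `^ (- al) * K `^ (- be).
  apply: (@le_trans _ _ (r ^- n.+1)); first exact: le_invX.
  rewrite -powR_mulrn ?(ltW r0)// -powRN -NE opprD powRD_gt0//.
  by rewrite ler_wpM2l ?powR_ge0// le_powRN// ltW.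
have B0 : 0 <= bmass n * beta_const n al be.
  rewrite mulr_ge0 ?(ltW (bmass_gt0 _))//.
  by rewrite /beta_const divr_ge0 ?mulr_ge0// ltW// Gamma_gt0// ltr0n.
rewrite exprMn exprVn invfM invrK (_ : 4 = 2 * 2 :> R); last by rewrite -natrM.
rewrite exprMn.
have F0 : 0 <= (2 * (2 ^+ n.+1 * 2 ^+ n.+1) * E :> R).
  by rewrite !mulr_ge0 ?exprn_ge0.
move: (ler_wpM2l B0 e1) (ler_wpM2l F0 e2) (ler_wpM2l F0 e3).
move: (bmass n * _) (2 ^+ n.+1) (r `^ _) (K `^ _) (K `^ _) (M `^ _) (Z `^ _).
move: (Z ^- n.+1) ((1 + _) `^ _) => t s b c a v w u l h1 h2 h3.
lra.
Qed.

End one_point.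
End lower_bound.

(** * The projection of a truncated test function *)

Section trial.
Context {R : realType} (n : nat).
Let X := (n.-tuple R[i] * measurableTypeR R)%type.
Variables (al be : R).
Hypotheses (al0 : 0 < al) (be0 : 0 < be) (NE : al + be = n.+1%:R).

(** An extension of [bW] from the boundary to the whole space. *)
Definition bV (u : Defs.cpoint R n) : R[i] := sqnorm u.1 +i* complex.Re u.2.

Definition trial (M : R) (u : Defs.cpoint R n) : R[i] :=
  if (1 <= normc (bV u)) && (normc (bV u) < M) then hom_test al be (bV u) else 0.

Lemma measurable_bV : measurable_fun setT bV.
Proof.
apply: measurable_ReImP => /=.
  by apply: (measurableT_comp (@measurable_sqnorm R n)); exact: measurable_fst.
by apply: mReC; exact: measurable_snd.
Qed.

Lemma measurable_shell (a b : R) : measurable_fun setT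
  (fun u => (a <= normc (bV u)) && (normc (bV u) < b)).
Proof.
have mV := mnormC measurable_bV.
by apply: measurable_and; [exact: measurable_fun_ler|exact: measurable_fun_ltr].
Qed.

Lemma measurable_trial M : measurable_fun setT (trial M).
Proof.
apply: mifC; first exact: measurable_shell.
by apply: measurable_hom_test; exact: measurable_bV.
Qed.

Lemma Cintegral_param (f : Defs.cpoint R n -> R[i]) : measurable_fun setT f ->
  cintegrable (bmu n) (fun x => f (bsiegel_param x)) ->
  Cintegral f = cint (bmu n) (fun x => f (bsiegel_param x)).
Proof.
move=> mf [_ fi]; have T := chvar_transport (bmu n) (@measurable_bsiegel_param R n)
  (@measurable_bsiegel_coord R n) (@bsiegel_paramK R n).
have fb : cintegrable (beta R n) f.
  split=> //; rewrite ge0_integral_beta//; last by move=> u; rewrite lee_fin normc_ge0.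
  by apply/measurable_EFinP; exact: mnormC.
transitivity (cint (beta R n) f); first by [].
rewrite (chvar_cint T fb); apply: eq_cint => x; exact: mul1r.
Qed.

Lemma measurable_rho (z : Defs.cpoint R n) : measurable_fun setT (rho z).
Proof.
rewrite /rho; apply: mDC.
  apply: mMC; first exact: measurable_cst.
  apply: mDC; last exact: measurable_cst.
  by apply: mJC; exact: measurable_snd.
apply: mNC; exact: (measurableT_comp (measurable_hdot _) measurable_fst).
Qed.

Lemma cauchy_szego_trial (M : R) (y : X) : cauchy_szego (trial M) (lift1 y) =
  (n`!%:R / (4 * pi ^+ n.+1) * 2 ^+ n.+1)%:C *
  cint (bmu n) (fun x => if (1 <= brad x) && (brad x < M) then
    (bW x + cZ (lift1 y) - 2%:R * hdot y.1 x.1) ^- n.+1 * hom_test al be (bW x)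
    else 0).
Proof.
have [c c0 low] := gap_lower y.
have [iF _] := cint_mean_value al0 be0 NE c0 low.
have mb : measurable_fun setT (fun x : X => (1 <= brad x) && (brad x < M)).
  have mV := @measurable_brad R n.
  by apply: measurable_and; [exact: measurable_fun_ler|exact: measurable_fun_ltr].
have iG := cintegrable_if mb iF.
have E (x : X) : rho (lift1 y) (bsiegel_param x) ^- n.+1 * trial M (bsiegel_param x) =
    (2 ^+ n.+1)%:C * (if (1 <= brad x) && (brad x < M) then
    (bW x + cZ (lift1 y) - 2%:R * hdot y.1 x.1) ^- n.+1 * hom_test al be (bW x)
    else 0).
  rewrite rho_param /trial -[bV _]/(bW x) -[normc (bW x)]/(brad x).
  case: ifP => _; last by rewrite !mulr0.
  rewrite -[hdot (lift1 y).1 _]/(hdot y.1 x.1).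
  move: (_ - 2%:R * _) (hom_test _ _ _) => w t.
  by rewrite expr_div_n invf_div mulrA rmorphXn rmorph_nat.
rewrite /cauchy_szego Cintegral_param; last 2 first.
- apply: mMC; last exact: measurable_trial.
  by apply: mVC; apply: mXC; exact: measurable_rho.
- have -> := funext E; exact: (cintegrableZ _ iG).
rewrite (eq_cint _ E) (cintZ _ iG) mulrA -rmorphM //.
Qed.

(** The factor of |W|^(-al) in the lower bound for the projection, with [u] the
    inverse of the safety factor from the two edges of the shell; it tends to the
    constant of the theorem as [u] tends to 0. *)
Definition low_const (u : R) : R := n`!%:R / (4 * pi ^+ n.+1) * 2 ^+ n.+1 *
  (bmass n * beta_const n al be * (1 + u) `^ (- al) -
   2 * 4 ^+ n.+1 * dom_mass n al * (u `^ be + u `^ al)).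

Lemma cauchy_szego_lower (M K : R) (y : X) : 72 <= K -> K <= brad y ->
  K * brad y <= M ->
  low_const K^-1 * brad y `^ (- al) <= normc (cauchy_szego (trial M) (lift1 y)).
Proof.
move=> K72 Ky yM; have K0 : 0 < K by lra.
have := annulus_lower al0 be0 NE K72 Ky yM.
rewrite cauchy_szego_trial normcM normcR.
have c0 : 0 <= n`!%:R / (4 * pi ^+ n.+1) * 2 ^+ n.+1 :> R.
  by rewrite mulr_ge0 ?exprn_ge0// divr_ge0// mulr_ge0// exprn_ge0// pi_ge0.
have Kp a : K^-1 `^ a = K `^ (- a).
  by rewrite -(powR_inv1 (ltW K0)) -powRrM mulN1r.
rewrite (ger0_norm c0) => /(ler_wpM2l c0); apply: le_trans.
by rewrite /low_const 2!Kp -[X in X <= _]mulrA [_ * brad y `^ _]mulrC.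
Qed.

End trial.

(** * Shells and their invariant mass *)

Section shells.
Context {R : realType} (n : nat).
Let leb := (@lebesgue_measure R).
Let X := (n.-tuple R[i] * measurableTypeR R)%type.

Let mbrad : measurable_fun setT (@brad R n). Proof. exact: measurable_brad. Qed.

(** The power is the one for which the density is invariant under dilations. *)
Definition shell_density (a b r : R) : R := if (a <= r) && (r < b) then r ^- n.+1 else 0.

Definition shell_mass (a b : R) : \bar R :=
  \int[bmu n]_(x in [set: X]) (shell_density a b (brad x))%:E.

Lemma shell_density_ge0 a b r : 0 <= r -> 0 <= shell_density a b r.
Proof.
by move=> r0; rewrite /shell_density; case: ifP => // _; rewrite invr_ge0 exprn_ge0.
Qed.

Lemma measurable_shell_density a b : measurable_fun setT (shell_density a b).
Proof.
apply: mifR; last by apply: mVR; exact: measurable_funX.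
by apply: measurable_and; [exact: measurable_fun_ler|exact: measurable_fun_ltr].
Qed.

Let mdens a b : measurable_fun [set: X] (fun x => (shell_density a b (brad x))%:E).
Proof.
apply/measurable_EFinP.
exact: (measurableT_comp (measurable_shell_density a b) mbrad).
Qed.

Lemma shell_mass_dil (s a b : R) : 0 < s ->
  shell_mass (s * a) (s * b) = shell_mass a b.
Proof.
move=> s0; rewrite /shell_mass; have [_ _ _ ->//] := chvar_dilb n s0; last first.
  by move=> x; rewrite lee_fin shell_density_ge0// brad_ge0.
apply: eq_integral => x _; rewrite -EFinM; congr EFin.
rewrite brad_dil// /shell_density ler_pM2l// ltr_pM2l//; case: ifP => _; last exact: mulr0.
rewrite powR_mulrn ?ltW// exprMn invfM mulrA mulfV ?mul1r// expf_neq0// gt_eqF//.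
Qed.

Lemma shell_mass_cat (a b c : R) : a <= b -> b <= c ->
  shell_mass a c = (shell_mass a b + shell_mass b c)%E.
Proof.
move=> ab bc; rewrite /shell_mass -ge0_integralD//; last 2 first.
- by move=> x _; rewrite lee_fin shell_density_ge0// brad_ge0.
- by move=> x _; rewrite lee_fin shell_density_ge0// brad_ge0.
apply: eq_integral => x _; rewrite -EFinD; congr EFin; rewrite /shell_density.
case: (ltP (brad x) b) => h; last by rewrite (le_trans ab h) andbF add0r.
by rewrite (lt_le_trans h bc) addr0.
Qed.

Variables (K : R).
Hypothesis K1 : 1 < K.

Lemma shell_mass_fin : (shell_mass 1 K < +oo)%E.
Proof.
(* Any two positive exponents of sum n+1 would do here. *)
have al0 : 0 < n.+1%:R / 2 :> R by rewrite divr_gt0.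
have NE : n.+1%:R / 2 + n.+1%:R / 2 = n.+1%:R :> R by rewrite -splitr.
have al0' := ltW al0; have K0 : 0 < K by exact: lt_trans K1.
have c0 : 0 <= 2 ^+ n.+1 * K `^ (n.+1%:R / 2) :> R.
  by rewrite mulr_ge0 ?exprn_ge0 ?powR_ge0.
apply: (@le_lt_trans _ _ (2 ^+ n.+1 * K `^ (n.+1%:R / 2) *
  dom_mass n (n.+1%:R / 2))%:E); last exact: ltry.
apply: (ge0_integral_le_dom al0 al0 NE c0) => x.
rewrite shell_density_ge0 ?brad_ge0//= /shell_density; case: ifP => [/andP[r1 rK]|_]; last first.
  by rewrite mulr_ge0// dom_fun_ge0.
have r0 : 0 < brad x by exact: lt_le_trans r1.
rewrite /dom_fun mulrACA -[X in X <= _]mulr1 ler_pM//.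
- by rewrite invr_ge0 exprn_ge0// ltW.
- rewrite -[2 ^+ _]invrK -invfM -(exprVn 2) -exprMn le_invX ?mulr_gt0 ?invr_gt0 ?addr_gt0//; lra.
- rewrite powRN -ler_pdivrMr ?invr_gt0 ?powR_gt0// invrK mul1r.
  by rewrite ge0_ler_powR// ?nnegrE ltW.
Qed.

Lemma shell_mass_gt0 : (0 < shell_mass 1 K)%E.
Proof.
have K0 : 0 < K by exact: lt_trans K1.
have mphi : measurable_fun [set: R] (fun r : R => (shell_density 1 K `|r|)%:E).
  apply/measurable_EFinP; apply: (measurableT_comp (measurable_shell_density 1 K)).
  exact: normr_measurable.
have H := ge0_integral_brad n mphi (fun r => _ : (0 <= (shell_density 1 K `|r|)%:E)%E).
have -> : shell_mass 1 K = (\int[bmu n]_x (shell_density 1 K `|brad x|)%:E)%E.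
  by apply: eq_integral => x _; rewrite ger0_norm// brad_ge0.
rewrite H; last by move=> r; rewrite lee_fin shell_density_ge0.
rewrite mule_gt0// ?lte_fin ?bmass_gt0//.
have m1 : measurable ([set` `[1, K[] : set (measurableTypeR R)) by exact: measurable_itv.
apply: (@lt_le_trans _ _ (\int[leb]_r (K^-1 * \1_[set` `[1, K[] r)%:E)%E).
  under eq_integral do rewrite EFinM.
  rewrite ge0_integralZl_EFin ?invr_ge0 ?(ltW K0)//; last first.
    by apply/measurable_EFinP; exact: measurable_indic.
  rewrite integral_indic// setIT.
  suff : (0 < (K^-1)%:E * leb [set` `[1%R, K[])%E by [].
  have -> : leb [set` `[1, K[] = (K - 1)%:E.
    by apply: etrans (lebesgue_measure_itv _) _; rewrite /= lte_fin K1 -EFinB.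
  by rewrite -EFinM lte_fin mulr_gt0 ?invr_gt0// subr_gt0.
apply: ge0_le_integral_nonmeas => r; first by rewrite lee_fin mulr_ge0// invr_ge0 ltW.
rewrite indicE mem_setE in_itv /= /shell_density.
case: (boolP ((1 <= r) && (r < K))) => /=.
  move=> /andP[r1 rK]; have r0 : 0 < r by exact: lt_le_trans r1.
  rewrite -EFinM lee_fin ppow_gt0// (ger0_norm (ltW r0)) r1 rK /= mulr1.
  rewrite -powR_invn ?(ltW r0)// -powRD_gt0//.
  rewrite (_ : _ + _ = -1) ?powR_inv1 ?(ltW r0)// ?lef_pV2 ?posrE// ?ltW//.
  by lra.
by move=> _; rewrite mulr0 -EFinM lee_fin mulr_ge0 ?ppow_ge0// shell_density_ge0.
Qed.

Lemma shell_mass_pow m : shell_mass 1 (K ^+ m) = (m%:R%:E * shell_mass 1 K)%E.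
Proof.
have K0 : 0 < K by exact: lt_trans K1.
elim: m => [|m IH].
  rewrite expr0 mul0e /shell_mass /shell_density; apply: integral0_eq => x _.
  by case: ltgtP.
rewrite (@shell_mass_cat _ (K ^+ m)) ?exprn_ege1 ?(ltW K1)//; last first.
  by rewrite ler_eXn2l.
rewrite IH -[in X in (_ + shell_mass X _)%E](mulr1 (K ^+ m)) exprSr shell_mass_dil ?exprn_gt0//.
by rewrite -natr1 EFinD ge0_muleDl ?mul1e// lee_fin.
Qed.

Lemma shell_mass_inner m : shell_mass K (K ^+ m.+1) = (m%:R%:E * shell_mass 1 K)%E.
Proof.
have K0 : 0 < K by exact: lt_trans K1.
by rewrite exprS -[X in shell_mass X]mulr1 shell_mass_dil// shell_mass_pow.
Qed.

End shells.

(** * The norm of the projection *)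

Section norm_bound.
Context {R : realType} (n : nat).
Let X := (n.-tuple R[i] * measurableTypeR R)%type.
Variables (p al be : R).
Hypotheses (p1 : 1 < p) (al0 : 0 < al) (be0 : 0 < be) (NE : al + be = n.+1%:R).
Hypothesis alp : al * p = n.+1%:R.

Let p0 : 0 < p. Proof. exact: lt_trans p1. Qed.
Let pn0 : p != 0. Proof. by rewrite gt_eqF. Qed.

Lemma LpC_normE (f : Defs.cpoint R n -> R[i]) :
  LpC_norm p f = ((\int[beta R n]_u (normc (f u) `^ p)%:E) `^ p^-1)%E.
Proof.
rewrite /LpC_norm unlock; congr (_ `^ _)%E; apply: eq_integral => u _.
by rewrite /= ger0_norm ?normc_ge0.
Qed.

Lemma LpC_norm_val (f : Defs.cpoint R n -> R[i]) (I : R) :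
  (\int[beta R n]_u (normc (f u) `^ p)%:E = I%:E)%E ->
  LpC_norm p f = (I `^ p^-1)%:E.
Proof. by rewrite LpC_normE => ->; rewrite poweR_EFin. Qed.

Lemma le_LpC_norm (f : Defs.cpoint R n -> R[i]) (g : Defs.cpoint R n -> R) (I : R) :
  (forall u, 0 <= g u) -> (forall u, g u <= normc (f u)) ->
  (\int[beta R n]_u (g u `^ p)%:E = I%:E)%E -> ((I `^ p^-1)%:E <= LpC_norm p f)%E.
Proof.
move=> g0 gf gI; have I0 : (0 <= I%:E)%E.
  by rewrite -gI; apply: integral_ge0 => u _; rewrite lee_fin powR_ge0.
rewrite LpC_normE -poweR_EFin; apply: gt0_ler_poweR.
- by rewrite invr_ge0 ltW.
- by rewrite in_itv /= I0 leey.
- have i0 : (0 <= \int[beta R n]_u (normc (f u) `^ p)%:E)%E.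
    by apply: integral_ge0 => u _; rewrite lee_fin powR_ge0.
  by rewrite in_itv /= i0 leey.
rewrite -gI; apply: ge0_le_integral_nonmeas => u; rewrite lee_fin ?powR_ge0//.
by rewrite ge0_ler_powR ?nnegrE ?normc_ge0// ltW.
Qed.

Lemma powRN_al (r : R) : 0 <= r -> (r `^ (- al)) `^ p = r ^- n.+1.
Proof. by move=> r0; rewrite -powRrM mulNr alp powR_invn. Qed.

Lemma trial_mass (M : R) :
  (\int[beta R n]_u (normc (trial al be M u) `^ p)%:E = shell_mass n 1 M)%E.
Proof.
have E (u : Defs.cpoint R n) :
    normc (trial al be M u) `^ p = shell_density n 1 M (normc (bV u)).
  rewrite /trial /shell_density; case: ifP => _.
    by rewrite normc_hom_test powRN_al ?normc_ge0.
  by rewrite normc0 powR0.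
under eq_integral do rewrite E.
have mE : measurable_fun setT (fun u : Defs.cpoint R n =>
    (shell_density n 1 M (normc (bV u)))%:E).
  apply/measurable_EFinP; apply: (measurableT_comp (measurable_shell_density n 1 M)).
  by apply: mnormC; exact: measurable_bV.
rewrite (ge0_integral_beta mE)// => u; rewrite lee_fin shell_density_ge0//.
exact: normc_ge0.
Qed.

(** The first condition confines the comparison with the projection to the
    boundary, which carries the measure. *)
Definition minorant (b K L : R) (u : Defs.cpoint R n) : R :=
  if (complex.Im u.2 == sqnorm u.1) &&
     ((K <= normc (bV u)) && (normc (bV u) < L))
  then b * normc (bV u) `^ (- al) else 0.

Lemma minorant_mass (b K L : R) : 0 <= b ->
  (\int[beta R n]_u (minorant b K L u `^ p)%:E = (b `^ p)%:E * shell_mass n K L)%E.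
Proof.
move=> b0; have mV := mnormC (@measurable_bV R n).
have mm : measurable_fun setT (minorant b K L).
  apply: mifR; last first.
    by apply: measurable_funM => //; exact: (measurableT_comp (measurable_powR (- al)) mV).
  apply: measurable_and; last exact: measurable_shell.
  apply: measurable_fun_eqr; first by apply: mImC; exact: measurable_snd.
  by apply: (measurableT_comp (@measurable_sqnorm R n)); exact: measurable_fst.
have mE : measurable_fun setT (fun u => (minorant b K L u `^ p)%:E).
  by apply/measurable_EFinP; exact: (measurableT_comp (measurable_powR p) mm).
rewrite (ge0_integral_beta mE); last by move=> u; rewrite lee_fin powR_ge0.
have md : measurable_fun [set: X] (fun x => (shell_density n K L (brad x))%:E).
  apply/measurable_EFinP; apply: (measurableT_comp (measurable_shell_density n K L)).
  exact: measurable_brad.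
rewrite /shell_mass -(ge0_integralZl_EFin _ measurableT _ md (powR_ge0 b p)); last first.
  by move=> x _; rewrite lee_fin shell_density_ge0// brad_ge0.
apply: eq_integral => x _; rewrite -EFinM; congr EFin.
rewrite /minorant [complex.Im _ == _]eqxx -[normc (bV _)]/(brad x) /shell_density.
rewrite andTb; case: ifP => _; last by rewrite powR0// mulr0.
by rewrite powRM ?powR_ge0// powRN_al// brad_ge0.
Qed.

Lemma minorant_le (K M : R) (u : Defs.cpoint R n) : 72 <= K ->
  minorant (low_const n al be K^-1) K (M / K) u <=
  normc (cauchy_szego (trial al be M) (vshift 1 u)).
Proof.
move=> K72; rewrite /minorant; case: ifP => [|_]; last exact: normc_ge0.
case/andP => /eqP uE /andP[Ku uM]; have K0 : 0 < K by lra.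
have -> : u = bsiegel_param (bsiegel_coord u).
  by case: u uE {Ku uM} => u1 [a b] /= ->.
apply: (@cauchy_szego_lower R n al be al0 be0 NE M K (bsiegel_coord u)) => //.
by rewrite mulrC -ler_pdivlMr// ltW.
Qed.

Lemma trial_neq0 (M : R) (I : R) : 0 < I -> shell_mass n 1 M = I%:E ->
  ~ {ae beta R n, forall u, trial al be M u = 0}.
Proof.
move=> I0 MI ae0; have := trial_mass M; rewrite MI.
rewrite (@ge0_ae_eq_integral _ _ _ _ _ _ (cst 0%E)) //.
- by rewrite integral0 => -[] I00; rewrite -I00 ltxx in I0.
- apply/measurable_EFinP; apply: (measurableT_comp (measurable_powR p)).
  by apply: mnormC; exact: measurable_trial.
- by move=> u _; rewrite lee_fin powR_ge0.
- apply: filterS ae0 => u /= -> _; by rewrite normc0 powR0.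
Qed.

(** The shell 1 <= |W| < K^(m+3) consists of m+3 shells of ratio [K] with the same
    mass, and [minorant] lives on all of them but the first and the last. The
    p-th root of the ratio is at least the ratio itself, which is at most 1. *)
Lemma opnorm_lower (K : R) (m : nat) : 72 <= K -> 0 <= low_const n al be K^-1 ->
  ((low_const n al be K^-1 * (m.+1%:R / m.+3%:R))%:E <=
   opnorm_Lp_Hp p (@cauchy_szego R n))%E.
Proof.
set b := low_const _ _ _ _ => K72 b0.
have K0 : 0 < K by lra. have K1 : 1 < K by lra.
have Lf := shell_mass_fin n K1; have Lg := shell_mass_gt0 n K1.
have [L L0 LE] : exists2 L : R, 0 < L & shell_mass n 1 K = L%:E.
  exists (fine (shell_mass n 1 K)); first by rewrite fine_gt0// Lg Lf.
  by rewrite fineK// ge0_fin_numE// ltW.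
pose M := K ^+ m.+3.
have ME : shell_mass n 1 M = (m.+3%:R * L)%:E.
  by rewrite /M shell_mass_pow// LE EFinM.
have T0 : 0 < m.+3%:R * L by rewrite mulr_gt0.
have nf := LpC_norm_val (etrans (trial_mass M) ME).
have iE : (\int[beta R n]_u (minorant b K (M / K) u `^ p)%:E =
    (b `^ p * (m.+1%:R * L))%:E)%E.
  have -> : M / K = K ^+ m.+2 by rewrite /M exprS mulrC mulKf// gt_eqF.
  by rewrite minorant_mass// shell_mass_inner// LE -!EFinM.
have m0 u : 0 <= minorant b K (M / K) u.
  by rewrite /minorant; case: ifP => // _; rewrite mulr_ge0 ?powR_ge0.
have hl := le_LpC_norm m0 (fun u => minorant_le M u K72) iE.
apply: (@le_trans _ _
  (hardy_norm p (cauchy_szego (trial al be M)) / LpC_norm p (trial al be M))%E); last first.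
  apply: ereal_sup_ubound => /=; exists (trial al be M) => //; split.
    by split; [exact: measurable_trial|rewrite nf ltry].
  exact: trial_neq0 ME.
have np : 0 < (m.+3%:R * L) `^ p^-1 by rewrite powR_gt0.
rewrite nf inver gt_eqF// lee_pdivlMr//.
apply: (@le_trans _ _ ((b `^ p * (m.+1%:R * L)) `^ p^-1)%:E); last first.
  apply: (le_trans hl); apply: ereal_sup_ubound => /=; exists 1 => //.
have p0' := ltW p0.
have m13 : 0 < (m.+1%:R / m.+3%:R : R) <= 1.
  by rewrite divr_gt0//= ler_pdivrMr// mul1r ler_nat leqW.
have mL : 0 <= m.+1%:R * L by rewrite mulr_ge0// ltW.
rewrite -EFinM lee_fin (powRM _ (powR_ge0 b p) mL).
rewrite -powRrM mulfV// powRr1// -mulrA ler_wpM2l//.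
have -> : m.+1%:R * L = (m.+1%:R / m.+3%:R) * (m.+3%:R * L) by rewrite mulrA divfK.
rewrite (powRM _ (ltW (andP m13).1) (ltW T0)) ler_wpM2r ?powR_ge0// ger1_powR//.
by rewrite invf_le1// ltW.
Qed.

End norm_bound.

Section limit.
Context {R : realType} (n : nat).
Variables (al be : R).
Hypotheses (al0 : 0 < al) (be0 : 0 < be).

Lemma low_const_cvg : low_const n al be u @[u --> 0^'+] -->
  (n`!%:R / (4 * pi ^+ n.+1) * 2 ^+ n.+1 * (bmass n * beta_const n al be) : R).
Proof.
have h1 : (1 + u) `^ (- al) @[u --> 0^'+] --> expR (- al * ln (1 + 0)).
  apply: (@cvg_trans _ ((expR (- al * ln (1 + u))) @[u --> 0^'+])).
    apply: near_eq_cvg; near=> u.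
    have u1 : 0 < 1 + u by rewrite addr_gt0.
    by rewrite /powR (gt_eqF u1).
  apply: continuous_cvg; first exact: continuous_expR.
  apply: cvgM; first exact: cvg_cst.
  apply: continuous_cvg; first by apply: continuous_ln; rewrite addr0.
  apply: cvgD; first exact: cvg_cst.
  by apply: cvg_at_right_filter; exact: cvg_id.
rewrite addr0 ln1 mulr0 expR0 in h1; rewrite /low_const; set k := n`!%:R / _ * _; set b := bmass n * _.
set e := 2 * _ * _.
rewrite -[k * b]/(k * b) (_ : k * b = k * (b * 1 - e * (0 + 0))); last first.
  by rewrite addr0 mulr0 subr0 mulr1.
apply: cvgM; first exact: cvg_cst.
apply: cvgB; first by apply: cvgM => //; exact: cvg_cst.
apply: cvgM; first exact: cvg_cst.
by apply: cvgD; exact: powR_cvg0.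
Unshelve. all: by end_near.
Qed.

Lemma limit_constE : n`!%:R / (4 * pi ^+ n.+1) * 2 ^+ n.+1 *
    (bmass n * beta_const n al be) =
  Gamma al * Gamma be / Gamma (n.+1%:R / 2) ^+ 2 :> R.
Proof.
rewrite /beta_const Gamma_nat /bmass (exprS 2 n).
have G0 : Gamma (n.+1%:R / 2) != 0 :> R by rewrite gt_eqF// Gamma_gt0// divr_gt0.
have f0 : n`!%:R != 0 :> R by rewrite pnatr_eq0 -lt0n fact_gt0.
have pi0 : pi ^+ n.+1 != 0 :> R by rewrite expf_neq0// gt_eqF// pi_gt0.
have t0 : 2 ^+ n != 0 :> R by rewrite expf_neq0.
move: (Gamma al) (Gamma be) (Gamma _) (pi ^+ _) (2 ^+ n) G0 pi0 t0.
move: (n`!%:R) f0 => f f0 g1 g2 g3 P T G0 P0 T0.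
by field; rewrite G0 P0 T0 f0.
Qed.

End limit.

Lemma conjugate_dims (R : realType) (n : nat) (p q : R) : 1 < p -> q = p / (p - 1) ->
  [/\ 0 < n.+1%:R / p, 0 < n.+1%:R / q & n.+1%:R / p + n.+1%:R / q = n.+1%:R].
Proof.
move=> p1 ->; have p0 : 0 < p by exact: lt_trans p1.
have p10 : 0 < p - 1 by rewrite subr_gt0.
split; rewrite ?divr_gt0//.
by field; rewrite !gt_eqF.
Qed.

Theorem theorem4 (R : realType) (n : nat) (p q : R) (p_gt1 : 1 < p)
    (qE : q = p / (p - 1)) :
  ((Gamma (n.+1%:R / p) * Gamma (n.+1%:R / q) /
      Gamma (n.+1%:R / 2) ^+ 2)%:E
    <= opnorm_Lp_Hp p (@cauchy_szego R n))%E.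
Proof.
have [al0 be0 NE] := conjugate_dims n p_gt1 qE.
set al := n.+1%:R / p in al0 NE *; set be := n.+1%:R / q in be0 NE *.
have alp : al * p = n.+1%:R by rewrite /al divfK// gt_eqF// (lt_trans ltr01).
have := @low_const_cvg R n al be al0 be0; rewrite limit_constE.
set c := Gamma al * _ / _ => cvg_c.
have c0 : 0 < c.
  apply: divr_gt0; first by apply: mulr_gt0; exact: Gamma_gt0.
  by apply: exprn_gt0; apply: Gamma_gt0; rewrite divr_gt0.
rewrite leNgt; apply/negP; set o := opnorm_Lp_Hp _ _ => oc.
have [r [r0 rc orr]] : exists r : R, [/\ 0 <= r, r < c & (o <= r%:E)%E].
  move: oc; case: o => [r| |] //.
    rewrite lte_fin => rc; exists (Num.max r 0); split.
    - by rewrite le_max lexx orbT.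
    - by rewrite gt_max rc.
    - by rewrite lee_fin le_max lexx.
  by move=> _; exists 0; split => //; exact: leNye.
have [u [u0 u72 ru]] : exists u, [/\ 0 < u, u < 72^-1 & r < low_const n al be u].
  near (0 : R)^'+ => u; exists u; split; near: u.
  - exact: nbhs_right_gt.
  - by apply: nbhs_right_lt; rewrite invr_gt0.
  - exact: cvgr_gt cvg_c _ rc.
have u72' : 72 <= u^-1 by rewrite -[leLHS]invrK lef_pV2 ?posrE ?invr_gt0// ltW.
have b0 : 0 <= low_const n al be u by rewrite (le_trans r0)// ltW.
(* As the number of shells is unbounded, these bounds contradict [ru]. *)
have H m : low_const n al be u * (m.+1%:R / m.+3%:R) <= r.
  rewrite -lee_fin; apply: le_trans orr.
  have := @opnorm_lower R n p al be p_gt1 al0 be0 NE alp u^-1 m u72'.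
  by rewrite invrK; exact.
move: (low_const _ _ _ _) ru b0 H => b rb b0 H.
have d0 : 0 < b - r by rewrite subr_gt0.
have := H (Num.bound (2 * b / (b - r))).
have := archi_boundP (divr_ge0 (mulr_ge0 (ler0n _ 2) b0) (ltW d0)).
move: (Num.bound _) => m; rewrite ltr_pdivrMr// mulrA ler_pdivrMr// -!natr1.
move: (m%:R) (ler0n R m) => t t0; nra.
Unshelve. all: by end_near.
Qed.
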